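(* Let $Z(t)_{t\ge0}$ be a piecewise deterministic Markov process (PDMP) in $\mathbb R^d$, let $W$ be an open subset of its state space, and let $\mu$ be the quasistationary distribution (QSD) of $Z(t)_{t\ge0}$ in $W$. Suppose $\mathcal L(Z(0))=\mu$, let $\tau=\inf\{t\ge0:Z(t)\notin W\}$, and assume $\tau<\infty$ almost surely. Let $f$ be a bounded measurable real-valued function on state space, let $\Delta t>0$, let $R\ge1$, and let $(Z^r(t)_{t\ge0})^{r=1,\ldots,R}$ be independent copies of the PDMP with $Z^r(0)$, $r=1,\dots,R$, i.i.d. with law $\mu$. Let $\tau^r=\inf\{t:Z^r(t)\notin W\}$. (i) (Synchronous parallel step.) Let $N=\inf\{n\in\mathbb N:\exists\, r\text{ such that }\tau^r\le n\Delta t\}$, $J=\min\{r:\tau^r\le N\Delta t\}$, $$f_{par}=\sum_{n=1}^{N-1}\sum_{r=1}^R\int_{(n-1)\Delta t}^{n\Delta t}f(Z^r(t))\,dt+\sum_{r=1}^{J-1}\int_{(N-1)\Delta t}^{N\Delta t}f(Z^r(t))\,dt+\int_{(N-1)\Delta t}^{\tau^J}f(Z^J(t))\,dt,$$ let $T_{par}$ be given by the same formula with $f$ replaced by the constant function $1$, and let $Z_{par}=Z^J(\tau^J)$. Then $$\mathbb E(f_{par})=\mathbb E\left(\int_0^\tau f(Z(t))\,dt\right)\qquad\text{and}\qquad(T_{par},Z_{par})\stackrel{\mathcal L}{=}(\tau,Z(\tau)).$$ (ii) (Asynchronous parallel step.) Let $(t_{wall}^r(m)_{m\ge0})^{1\le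 r\le R}$ be nonnegative random numbers such that: they are independent of $(Z^r(t)_{t\ge0})^{1\le r\le R}$; almost surely, $t_{wall}^r(m)\le t_{wall}^r(n)$ whenever $m\le n$ and $1\le r\le R$; and almost surely there is a unique sequence $(r_k,m_k)_{k\ge1}$ with range $\{1,\ldots,R\}\times\{0,1,2,\ldots\}$ and $t_{wall}^{r_1}(m_1)<t_{wall}^{r_2}(m_2)<\cdots$. Let $K=\inf\{k:\tau^{r_k}\le(m_k+1)\Delta t\}$, $$f_{par}=\sum_{k=1}^{K-1}\int_{m_k\Delta t}^{(m_k+1)\Delta t}f(Z^{r_k}(t))\,dt+\int_{m_K\Delta t}^{\tau^{r_K}}f(Z^{r_K}(t))\,dt,$$ let $T_{par}$ be given by the same formula with $f$ replaced by the constant function $1$, and let $Z_{par}=Z^{r_K}(\tau^{r_K})$. Then, again, $$\mathbb E(f_{par})=\mathbb E\left(\int_0^\tau f(Z(t))\,dt\right)\qquad\text{and}\qquad(T_{par},Z_{par})\stackrel{\mathcal L}{=}(\tau,Z(\tau)).$$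
   Context: A PDMP in $\mathbb R^d$ is determined by a vector field $\Gamma$ with (globally defined) flow $\psi$, $\partial_t\psi(t,z)=\Gamma(\psi(t,z))$, $\psi(0,z)=z$; a jump rate $\lambda(z)\ge0$; and a Markov kernel $Q(z,dz')$. Formally its generator is $Lf(z)=\partial_{\Gamma(z)}f(z)+\lambda(z)\int(f(z')-f(z))\,Q(z,dz')$. It is the càdlàg process constructed as follows: starting from $\xi_0=Z(0)$ at time $0$, given the position $\xi_n$ immediately after the $n$th jump, the holding time $\theta_n$ satisfies $\mathbb P(\theta_n>s)=\exp\left(-\int_0^s\lambda(\psi(u,\xi_n))\,du\right)$, the process follows $s\mapsto\psi(s,\xi_n)$ for $s\in[0,\theta_n)$ after the $n$th jump time, and then jumps to $\xi_{n+1}$ drawn from $Q(\psi(\theta_n,\xi_n),dz)$. The process is assumed defined for all times $t\ge0$ (no explosion); it is a time homogeneous strong Markov process with càdlàg paths. A probability measure $\mu$ is a QSD of $Z(t)_{t\ge0}$ in $W$ if $\mu(W)=1$ and, when $\mathcal L(Z(0))=\mu$, $\mathbb P(Z(t)\in A\mid\tau>t)=\mu(A)$ for all $t\ge0$ and measurable $A\subseteq W$, where $\tau=\inf\{t\ge0:Z(t)\notin W\}$. Standing assumption: the QSD $\mu$ exists, is unique and satisfies $\mu(A)=\lim_{t\to\infty}\mathbb P(Z(t)\in A\mid Z(s)\in W,\ 0\le s\le t)$ for all measurable $A\subseteq W$ and any initial distribution supported in $W$. Conditional probabilities are understood when the conditioning event has positive probability. $\mathcal L$ denotes probability law, $\stackrel{\mathcal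 L}{=}$ equality in law, $\mathbb N=\{1,2,\ldots\}$, and empty sums are $0$. *)

(* Defs.v *)
From HB Require Import structures.
From mathcomp Require Import all_boot all_order all_algebra.
From mathcomp Require Import all_classical all_reals all_analysis.
From mathcomp Require Import measurable_realfun.

Set Implicit Arguments.
Unset Strict Implicit.
Unset Printing Implicit Defensive.
Import Order.TTheory GRing.Theory Num.Theory.
Import numFieldNormedType.Exports.

Local Open Scope classical_set_scope.
Local Open Scope ring_scope.

(* R^d carries its Borel sigma-algebra. *)
HB.instance Definition _ (R : realType) (d : nat) :=
  @isMeasurable.Build (sigma_display (@open 'rV[R]_d)) 'rV[R]_d
    <<s @open 'rV[R]_d >> (@sigma_algebra0 _ setT open)
    (@sigma_algebraC _ open) (@sigma_algebra_bigcup _ setT open).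

(* The least element of A; 0 when A is empty, so that an infimum of an empty
   set of step numbers (a null event below) gets a harmless value. *)
Definition least (A : set nat) : nat :=
  xget 0%N [set n | A n /\ forall m, A m -> (n <= m)%N].

Definition preimages {T I : Type} {d'} {T' : measurableType d'}
    (D : set I) (X : I -> T -> T') : set (set T) :=
  \bigcup_(i in D) preimage_set_system setT (X i) measurable.

(* The sigma-algebra generated by the maps X i, i in D. *)
Definition generated_sigma {T I : Type} {d'} {T' : measurableType d'}
    (D : set I) (X : I -> T -> T') : set (set T) := <<s preimages D X >>.

Section probability_notions.
Context {dT} {T : measurableType dT} {R : realType} (P : probability T R).

Definition cond_prob (A B : set T) : R := fine (P (A `&` B)) / fine (P B).

Definition independent_classes (F G : set (set T)) : Prop :=
  forall A B, F A -> G B -> P (A `&` B) = (P A * P B)%E.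

Definition mutually_independent (I : finType) (F : I -> set (set T)) : Prop :=
  forall (J : {set I}) (E : I -> set T), (forall i, i \in J -> F i (E i)) ->
    P (\bigcap_(i in [set` J]) E i) = (\prod_(i in J) P (E i))%E.

End probability_notions.

Definition same_law {R : realType} {d1 d2 d'} {T1 : measurableType d1}
    {T2 : measurableType d2} {T' : measurableType d'}
    (P1 : probability T1 R) (P2 : probability T2 R)
    (X1 : T1 -> T') (X2 : T2 -> T') : Prop :=
  [/\ measurable_fun setT X1, measurable_fun setT X2 &
      forall A, measurable A -> P1 (X1 @^-1` A) = P2 (X2 @^-1` A)].

(* Local characteristics of a PDMP in R^d. The derivative and group laws make
   flow the globally defined flow of the vector field. *)
Record pdmp (R : realType) (d : nat) := Pdmp {
  vfield : 'rV[R]_d -> 'rV[R]_d;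
  flow : R -> 'rV[R]_d -> 'rV[R]_d;
  rate : 'rV[R]_d -> R;
  jump : R.-pker 'rV[R]_d ~> 'rV[R]_d;
  flow_derive : forall t z,
    is_derive (t : R^o) 1 (fun s : R^o => flow s z) (vfield (flow t z));
  flow0 : forall z, flow 0 z = z;
  flowD : forall s t z, flow (s + t) z = flow s (flow t z);
  measurable_flow : forall t, measurable_fun setT (flow t);
  rate_ge0 : forall z, 0 <= rate z;
  measurable_rate : measurable_fun setT rate
}.

Section pdmp_process.
Context {R : realType} {d : nat} (c : pdmp R d).
Implicit Types (W : set 'rV[R]_d).

(* The integral may be +oo, and then the survival probability is 0. *)
Definition survival (s : R) (z : 'rV[R]_d) : \bar R :=
  expeR (- \int[lebesgue_measure]_(u in `[0%R, s]) (rate c (flow c u z))%:E)%E.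

Section skeleton.
Context {dT} {T : measurableType dT} (P : probability T R).
Variables (xi : nat -> T -> 'rV[R]_d) (theta : nat -> T -> \bar R).

(* Information carried by xi_0, ..., xi_n and theta_i for i < k. *)
Definition history (n k : nat) : set (set T) :=
  <<s preimages [set i | (i <= n)%N] xi `|`
      preimages [set i | (i < k)%N] theta >>.

(* The post-jump positions xi_n and holding times theta_n. A holding time is
   +oo when there is no further jump; the later xi_n then play no role. The
   conditional laws of theta_n and xi_{n+1} given the past are expressed by
   integration over the events of the past. *)
Record pdmp_skeleton (nu : probability 'rV[R]_d R) : Prop := PdmpSkeleton {
  measurable_xi : forall n, measurable_fun setT (xi n);
  measurable_theta : forall n, measurable_fun setT (theta n);
  theta_ge0 : forall n w, (0 <= theta n w)%E;
  xi0_law : forall B, measurable B -> P (xi 0%N @^-1` B) = nu B;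
  theta_law : forall n s H, 0 <= s -> history n n H ->
    P (H `&` [set w | (s%:E < theta n w)%E]) =
    (\int[P]_(w in H) survival s (xi n w))%E;
  xi_law : forall n B H, measurable B -> history n n.+1 H ->
    P (H `&` [set w | (theta n w < +oo)%E] `&` xi n.+1 @^-1` B) =
    (\int[P]_(w in H `&` [set w | (theta n w < +oo)%E])
       jump c (flow c (fine (theta n w)) (xi n w)) B)%E
}.

Definition jump_time (n : nat) (w : T) : \bar R :=
  (\sum_(i < n) theta i w)%E.

(* The path follows the flow from xi_n on [T_n, T_{n+1}). It is sent to 0 once
   the jump times have accumulated, a null event for a non-explosive PDMP. *)
Definition pdmp_path (t : R) (w : T) : 'rV[R]_d :=
  xget 0 [set z | exists n : nat,
    (jump_time n w <= t%:E < jump_time n.+1 w)%E /\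
    z = flow c (t - fine (jump_time n w)) (xi n w)].

End skeleton.

Definition pdmp_law {dT} {T : measurableType dT} (P : probability T R)
    (nu : probability 'rV[R]_d R) (Z : R -> T -> 'rV[R]_d) : Prop :=
  exists (xi : nat -> T -> 'rV[R]_d) (theta : nat -> T -> \bar R),
    pdmp_skeleton P xi theta nu /\
    forall t w, 0 <= t -> Z t w = pdmp_path xi theta t w.

Definition nonexplosive : Prop :=
  forall dT (T : measurableType dT) (P : probability T R)
    (nu : probability 'rV[R]_d R) xi theta,
  pdmp_skeleton P xi theta nu ->
  {ae P, forall w, (\sum_(0 <= i <oo) theta i w = +oo)%E}.

Definition exit_time {T : Type} W (Z : R -> T -> 'rV[R]_d) (w : T) : \bar R :=
  ereal_inf [set t%:E | t in [set t | 0 <= t /\ ~ W (Z t w)]].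

Definition exit_pos {T : Type} W (Z : R -> T -> 'rV[R]_d) (w : T) : 'rV[R]_d :=
  Z (fine (exit_time W Z w)) w.

(* The existence clause keeps the second one from holding vacuously. *)
Definition is_qsd W (mu : probability 'rV[R]_d R) : Prop :=
  [/\ mu W = 1%E,
      exists dT (T : measurableType dT) (P : probability T R)
        (Z : R -> T -> 'rV[R]_d), pdmp_law P mu Z &
      forall dT (T : measurableType dT) (P : probability T R)
        (Z : R -> T -> 'rV[R]_d), pdmp_law P mu Z ->
      forall (t : R) A, 0 <= t -> measurable A -> A `<=` W ->
        let alive := [set w | (t%:E < exit_time W Z w)%E] in
        (0 < P alive)%E -> (cond_prob P (Z t @^-1` A) alive)%:E = mu A].

Definition qsd_limit W (mu : probability 'rV[R]_d R) : Prop :=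
  forall dT (T : measurableType dT) (P : probability T R)
    (nu : probability 'rV[R]_d R) (Z : R -> T -> 'rV[R]_d),
  nu W = 1%E -> pdmp_law P nu Z ->
  let stay (t : R) := [set w | forall s, 0 <= s <= t -> W (Z s w)] in
  (forall t, 0 <= t -> (0 < P (stay t))%E) ->
  forall A, measurable A -> A `<=` W ->
    cond_prob P (Z t @^-1` A) (stay t) @[t --> +oo] --> fine (mu A).

(* The QSD exists, is unique, and attracts every initial law supported in W. *)
Definition the_qsd W (mu : probability 'rV[R]_d R) : Prop :=
  [/\ is_qsd W mu,
      forall nu : probability 'rV[R]_d R, is_qsd W nu ->
        forall A, measurable A -> nu A = mu A &
      qsd_limit W mu].

End pdmp_process.

Section parallel_step.
Context {R : realType} {d p : nat} {T : Type}.
(* The copies are numbered by 'I_p.+1: there are p.+1 >= 1 of them. *)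
Variables (W : set 'rV[R]_d) (dt : R) (Z : 'I_p.+1 -> R -> T -> 'rV[R]_d).
Implicit Types (f : 'rV[R]_d -> R) (w : T).

Let tau (r : 'I_p.+1) (w : T) : \bar R := exit_time W (Z r) w.

Definition path_int {T' : Type} f (Y : R -> T' -> 'rV[R]_d) (w : T')
    (a b : R) : R := \int[lebesgue_measure]_(t in `[a, b]) f (Y t w).

Definition sync_N w : nat :=
  least [set n | (0 < n)%N /\ exists r, (tau r w <= (n%:R * dt)%:E)%E].

Definition sync_J w : 'I_p.+1 :=
  let late r := (tau r w <= ((sync_N w)%:R * dt)%:E)%E in
  xget ord0 [set r | late r /\ forall r', late r' -> (r <= r')%N].

Definition sync_fpar f w : R :=
  let N := sync_N w in let J := sync_J w in
  \sum_(1 <= n < N) \sum_(r < p.+1)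
      path_int f (Z r) w (n.-1%:R * dt) (n%:R * dt)
  + \sum_(r < p.+1 | (r < J)%N)
      path_int f (Z r) w (N.-1%:R * dt) (N%:R * dt)
  + path_int f (Z J) w (N.-1%:R * dt) (fine (tau J w)).

Definition sync_Zpar w : 'rV[R]_d := exit_pos W (Z (sync_J w)) w.

Variable twall : 'I_p.+1 -> nat -> T -> R.

(* The sequence (r_k, m_k) is indexed from k = 0. *)
Definition is_wall_order w (s : nat -> 'I_p.+1 * nat) : Prop :=
  range s = setT /\
  forall k, twall (s k).1 (s k).2 w < twall (s k.+1).1 (s k.+1).2 w.

(* Constant when there is no such sequence, which is a null event. *)
Definition wall_order w : nat -> 'I_p.+1 * nat :=
  xget (fun=> (ord0, 0%N)) (is_wall_order w).

Definition async_r w (k : nat) : 'I_p.+1 := (wall_order w k).1.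
Definition async_m w (k : nat) : nat := (wall_order w k).2.

Definition async_K w : nat :=
  least [set k | (tau (async_r w k) w <= ((async_m w k).+1%:R * dt)%:E)%E].

Definition async_fpar f w : R :=
  let K := async_K w in let r := async_r w in let m := async_m w in
  \sum_(k < K) path_int f (Z (r k)) w ((m k)%:R * dt) ((m k).+1%:R * dt)
  + path_int f (Z (r K)) w ((m K)%:R * dt) (fine (tau (r K) w)).

Definition async_Zpar w : 'rV[R]_d := exit_pos W (Z (async_r w (async_K w))) w.

End parallel_step.

(* Main.v *)
(** Conditionally on survival up to time t, the position of a copy has law mu, so by the Markov
    property at the time k dt the pair (tau - k dt, Z(tau)) has, given tau > k dt, the law of
    (tau, Z(tau)). Hence tau > k dt has probability alpha^k for alpha = P(tau > dt). Each step of
    the parallel algorithm continues one copy r from the time m dt to (m+1) dt. The order of the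
    steps and the fate of the other copies are independent of the copy r, so given that the earlier
    steps saw no exit, the step is a fresh piece of trajectory started from mu. The first k steps
    therefore see no exit with probability alpha^k, as for k consecutive steps of a single copy,
    and splitting according to the step that sees the exit gives the same series for the laws of
    (T_par, Z_par) and (tau, Z(tau)). For the expectations, quasistationarity and Fubini show that
    a piece of trajectory killed at the exit contributes to the integral of f, on average, mu(f)
    times its mean duration; so both sides are mu(f) E(tau). The synchronous step is the
    asynchronous one for the deterministic clock m (p+1) + r.

    The Markov property at a fixed time t is obtained by restarting the skeleton in the leg that
    contains t: the remaining holding time has the right conditional law because the survival
    function is multiplicative along the flow, and the law of the position and time of exit is
    determined leg by leg from the conditional laws of a skeleton. *)
Require Import Defs.
From HB Require Import structures.
From mathcomp Require Import all_boot all_order all_algebra.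
From mathcomp Require Import all_classical all_reals all_analysis.
From mathcomp Require Import measurable_realfun.
From mathcomp Require Import ring lra.

Set Implicit Arguments.
Unset Strict Implicit.
Unset Printing Implicit Defensive.
Import Order.TTheory GRing.Theory Num.Theory.
Import numFieldNormedType.Exports.

Local Open Scope classical_set_scope.
Local Open Scope ring_scope.

(** * Measurability *)

(** No conditional law is ever formed. A skeleton gives its laws as integrals over events of the
    past, so each comparison is an identity, up to a constant factor, between image measures
    restricted to events and possibly living on two spaces ([agree_on]). Such identities pass from
    generators to all measurable sets and then to integrals. The obstacle is the restart. The time
    elapsed on the current leg is random, while the law of a holding time is given at fixed times
    only. Moreover the hazard may jump to +oo, so [survival] is left-continuous but perhaps not
    right-continuous, unlike the tail of a law. Its right-continuous version [survivalr] is a tail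
    for every starting point; the holding time can then be realised as a quantile of a uniform
    variable, and Fubini allows a random time. Measurability needs care too: an exit time is an
    infimum over uncountably many times and the wall order is a choice among sequences. Both are
    reduced to countably many conditions. Finiteness of E(tau) is derived: since tau is almost
    surely finite, the survival ratio is below 1 and the decay is geometric. *)

Section set_measurability.
Context {d} {T : measurableType d}.
Implicit Types P Q : T -> Prop.

Lemma mset_ext P Q : (forall w, P w <-> Q w) ->
  measurable [set w | P w] -> measurable [set w | Q w].
Proof. by move=> PQ; rewrite (_ : mkset P = mkset Q)//; apply/seteqP; split=> w /PQ. Qed.

Lemma mset_cst (p : Prop) : measurable [set _ : T | p].
Proof.
have [hp|hp] := pselect p.
- by rewrite (_ : mkset _ = setT) //; apply/seteqP; split.
- by rewrite (_ : mkset _ = set0) //; apply/seteqP; split.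
Qed.

Lemma mset_and P Q : measurable [set w | P w] -> measurable [set w | Q w] ->
  measurable [set w | P w /\ Q w].
Proof. exact: measurableI. Qed.

Lemma mset_or P Q : measurable [set w | P w] -> measurable [set w | Q w] ->
  measurable [set w | P w \/ Q w].
Proof. exact: measurableU. Qed.

Lemma mset_not P : measurable [set w | P w] -> measurable [set w | ~ P w].
Proof. exact: measurableC. Qed.

Lemma mset_imply P Q : measurable [set w | P w] -> measurable [set w | Q w] ->
  measurable [set w | P w -> Q w].
Proof.
move=> mP mQ; apply: (@mset_ext (fun w => ~ P w \/ Q w)).
  move=> w; split=> [[]//|PQ]; have [/PQ|] := pselect (P w); by [right|left].
by apply: mset_or => //; exact: mset_not.
Qed.

Lemma mset_exists (I : countType) (F : I -> T -> Prop) :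
  (forall i, measurable [set w | F i w]) -> measurable [set w | exists i, F i w].
Proof.
move=> mF; rewrite (_ : mkset _ = \bigcup_(i : I) [set w | F i w]); last first.
  by apply/seteqP; split=> w [i]; [exists i|exists i].
exact: countable_bigcupT_measurable.
Qed.

Lemma mset_forall (I : countType) (F : I -> T -> Prop) :
  (forall i, measurable [set w | F i w]) -> measurable [set w | forall i, F i w].
Proof.
move=> mF; apply: (@mset_ext (fun w => ~ exists i, ~ F i w)).
  move=> w; split=> [|h [i /(_ (h i))]//].
  by move=> h i; apply: contrapT => nF; apply: h; exists i.
by apply: mset_not; apply: mset_exists => i; apply: mset_not.
Qed.

End set_measurability.

Lemma measurable_fun_set {d1 d2} {T1 : measurableType d1} {T2 : measurableType d2}
  (X : T1 -> T2) (B : set T2) :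
  measurable_fun setT X -> measurable B -> measurable [set w | B (X w)].
Proof. by move=> mX mB; rewrite -[mkset _]setTI; exact: mX. Qed.

Section real_sets.
Context {R : realType} {d} {T : measurableType d}.

Lemma mset_ltr (X Y : T -> R) : measurable_fun setT X -> measurable_fun setT Y ->
  measurable [set w | X w < Y w].
Proof.
by move=> mX mY; exact: (measurable_fun_set (measurable_fun_ltr mX mY) (B := [set true])).
Qed.

Lemma mset_ler (X Y : T -> R) : measurable_fun setT X -> measurable_fun setT Y ->
  measurable [set w | X w <= Y w].
Proof.
by move=> mX mY; exact: (measurable_fun_set (measurable_fun_ler mX mY) (B := [set true])).
Qed.

Lemma mset_lte (X Y : T -> \bar R) : measurable_fun setT X -> measurable_fun setT Y ->
  measurable [set w | (X w < Y w)%E].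
Proof.
by move=> mX mY; rewrite -[mkset _]setTI; exact: measurable_lte.
Qed.

Lemma mset_lee (X Y : T -> \bar R) : measurable_fun setT X -> measurable_fun setT Y ->
  measurable [set w | (X w <= Y w)%E].
Proof.
by move=> mX mY; rewrite -[mkset _]setTI; exact: measurable_lee.
Qed.

Lemma emeasurable_upper_levels (X : T -> \bar R) :
  (forall s : R, measurable [set w | (s%:E < X w)%E]) -> measurable_fun setT X.
Proof.
move=> mX; apply: (measurability _ (ErealGenOInfty.measurableE R)).
move=> _ [_ [x ->] <-]; rewrite setTI.
by apply: mset_ext (mX x) => w; rewrite /= in_itv /= andbT.
Qed.

Lemma emeasurable_lower_levels (X : T -> \bar R) :
  (forall s : R, measurable [set w | (X w < s%:E)%E]) -> measurable_fun setT X.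
Proof.
move=> mX; apply: (measurability _ (ErealGenInftyO.measurableE R)).
move=> _ [_ [x ->] <-]; rewrite setTI.
by apply: mset_ext (mX x) => w; rewrite /= in_itv.
Qed.

End real_sets.

Section measurable_select.
Context {d1 d2} {T1 : measurableType d1} {T2 : measurableType d2}.

Lemma measurable_select (I : countType) (i : T1 -> I) (X : I -> T1 -> T2) :
  (forall j, measurable [set w | i w = j]) ->
  (forall j, measurable_fun setT (X j)) ->
  measurable_fun setT (fun w => X (i w) w).
Proof.
move=> mi mX _ B mB; rewrite setTI.
apply: (@mset_ext _ _ (fun w => exists j, i w = j /\ B (X j w))) => [w|].
  by split=> [[j [<-]]|h] //; exists (i w).
apply: mset_exists => j; apply: mset_and => //.
exact: (measurable_fun_set (mX j)).
Qed.

Lemma measurable_if_set (D : set T1) (X Y : T1 -> T2) :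
  measurable D -> measurable_fun setT X -> measurable_fun setT Y ->
  measurable_fun setT (fun w => if w \in D then X w else Y w).
Proof.
move=> mD mX mY; rewrite (_ : (fun w => _) = fun w => (if w \in D then X else Y) w); last first.
  by apply/funext => w; case: ifP.
apply: (measurable_select (i := fun w => w \in D)
  (X := fun b : bool => if b then X else Y)); last by case.
case=> /=.
- by apply: mset_ext mD => w; split=> [/mem_set|/set_mem].
- apply: mset_ext (mset_not mD) => w /=.
  by split=> [h|/negP h /mem_set//]; apply/negP => /set_mem.
Qed.

End measurable_select.

Section vector_borel.
Context {R : realType} {n : nat}.
Local Notation V := 'rV[R]_n.

Lemma open_measurable_rV (U : set V) : open U -> measurable U.
Proof. by move=> oU; exact: sub_sigma_algebra. Qed.

Lemma closed_measurable_rV (C : set V) : closed C -> measurable C.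
Proof.
by move=> cC; rewrite -[C]setCK; apply: measurableC; apply: open_measurable_rV;
  rewrite openC.
Qed.

Lemma measurable_fun_open {d} {T : measurableType d} (X : T -> V) :
  (forall U, open U -> measurable [set w | U (X w)]) -> measurable_fun setT X.
Proof.
move=> mX; apply: (measurability (open : set (set V))) => //.
by move=> _ [U oU <-]; rewrite setTI; exact: mX.
Qed.

Lemma continuous_measurable_rV (g : V -> R) : continuous g -> measurable_fun setT g.
Proof.
move=> cg; apply: (measurability _ (RGenOpens.measurableE R)).
move=> _ [_ [a [b ->]] <-]; rewrite setTI; apply: open_measurable_rV.
by apply: open_comp => // x _; exact: cg.
Qed.

Lemma measurable_coord (i : 'I_n) : measurable_fun setT (fun z : V => z ord0 i).
Proof. by apply: continuous_measurable_rV; exact: coord_continuous. Qed.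

Lemma mset_eq_rV {d} {T : measurableType d} (X Y : T -> V) :
  measurable_fun setT X -> measurable_fun setT Y -> measurable [set w | X w = Y w].
Proof.
move=> mX mY.
have mc i (X' : T -> V) : measurable_fun setT X' ->
    measurable_fun setT (fun w => X' w ord0 i).
  by move=> mX'; exact: (measurableT_comp (measurable_coord i)).
apply: (@mset_ext _ _ (fun w =>
    forall i, X w ord0 i <= Y w ord0 i /\ Y w ord0 i <= X w ord0 i)).
  move=> w; split=> [h|-> //]; apply/rowP => i; have [h1 h2] := h i.
  by apply/eqP; rewrite eq_le h1.
by apply: mset_forall => i; apply: mset_and; apply: mset_ler; exact: mc.
Qed.

Lemma cvg_measurable_rV {d} {T : measurableType d} (X : nat -> T -> V) (Y : T -> V) :
  (forall k, measurable_fun setT (X k)) ->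
  (forall w, X k w @[k --> \oo] --> Y w) -> measurable_fun setT Y.
Proof.
move=> mX XY; apply: measurable_fun_open => U oU.
(* The points at distance at least 1/k from the complement of U form closed sets that exhaust U. *)
pose V_ (k : nat) := \bigcap_(y in ~` U) [set z : V | k.+1%:R^-1 <= `|y - z|].
have cV k : closed (V_ k).
  apply: closed_bigI => y _.
  apply: (preimage_closed (f := fun z : V => `|y - z|) _ (@closed_ge _ _)) => z _.
  apply: (@continuous_comp _ _ _ (fun z : V => y - z) Num.norm); last exact: norm_continuous.
  exact: (@continuousB _ _ _ (cst y) id _ (@cst_continuous _ _ y z) (@cvg_id _ _)).
apply: (@mset_ext _ _ (fun w => exists k N, forall m, (N <= m)%N -> V_ k (X m w))).
  move=> w; split=> [[k [N h]]|UY].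
    have : V_ k (Y w).
      by apply: (closed_cvg (V_ k) (cV k) _ _ (XY w)); exists N.
    by move=> VY; apply: contrapT => /VY /=; rewrite subrr normr0 leNgt invr_gt0 ltr0n.
  have /nbhs_ballP [e /= e0 eU] := open_nbhs_nbhs (conj oU UY).
  (* Half of [e] absorbs the distance from [X m w] to its limit; the other half still exceeds
     [k.+1%:R^-1]. *)
  have e20 : 0 < e / 2 by rewrite divr_gt0.
  have [k ke] : exists k, k.+1%:R^-1 < e / 2.
    have [k _ /(_ k (leqnn k)) hk] := near_infty_natSinv_lt (PosNum e20).
    by exists k.
  have /cvgrPdist_lt /(_ _ e20) [N _ hN] := XY w.
  exists k, N => m /hN /= XYm y nUy /=.
  have yY : e <= `|y - Y w|.
    by rewrite leNgt; apply: contra_notN nUy => ye; apply: eU; rewrite -ball_normE /= distrC.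
  have := ler_distD (X m w) y (Y w); rewrite (distrC (X m w)) => tri.
  have aux (k' a b c : R) : k' < e / 2 -> e <= a -> c < e / 2 -> a <= b + c -> k' <= b.
    by lra.
  exact: aux ke yY XYm tri.
apply: mset_exists => k; apply: mset_exists => N; apply: mset_forall => m.
apply: mset_imply; first exact: mset_cst.
by apply: measurable_fun_set => //; exact: closed_measurable_rV.
Qed.

End vector_borel.

(** * Paths and exit times *)

Section random_time.
Context {R : realType} {n : nat} {d} {T : measurableType d}.
Local Notation V := 'rV[R]_n.

(** Sequential form: the approximations from the right used below are sequences with error at most
    [k.+1%:R^-1]. *)
Definition right_continuous (z : R -> V) := forall t (s : nat -> R), 0 <= t ->
  (forall k, t <= s k) -> s k @[k --> \oo] --> t -> z (s k) @[k --> \oo] --> z t.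

(** For nonnegative [x], the first point strictly above [x] in the grid of mesh [k.+1%:R^-1]:
    countably many values, tending to [x] from the right. *)
Definition grid_above (x : R) (k : nat) : R := (Num.truncn (x * k.+1%:R)).+1%:R / k.+1%:R.

Lemma grid_above_bounds x k : 0 <= x ->
  x <= grid_above x k <= x + k.+1%:R^-1.
Proof.
move=> x0; have k0 : 0 < k.+1%:R :> R by rewrite ltr0n.
have /truncn_itv/andP[h1 h2] : 0 <= x * k.+1%:R by rewrite mulr_ge0 // ltW.
rewrite /grid_above ler_pdivlMr // ltW //= ler_pdivrMr // mulrDl mulVf ?gt_eqF//.
by rewrite -natr1 lerD2r.
Qed.

Lemma grid_above_cvg x : 0 <= x -> grid_above x k @[k --> \oo] --> x.
Proof.
move=> x0; apply: (@squeeze_cvgr _ _ _ _ (fun=> x) (fun k => x + k.+1%:R^-1)).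
- by apply: nearW => k; exact: grid_above_bounds.
- exact: cvg_cst.
- rewrite -[X in _ --> X]addr0; apply: cvgD; first exact: cvg_cst.
  exact: cvg_harmonic.
Qed.

(** Grid times take countably many values, so selecting among them reduces to the measurability of
    [X t] at fixed [t]; right continuity carries it to the limit. *)
Lemma measurable_random_time (X : R -> T -> V) (S : T -> R) :
  (forall t, 0 <= t -> measurable_fun setT (X t)) ->
  (forall w, right_continuous (X ^~ w)) ->
  measurable_fun setT S -> (forall w, 0 <= S w) ->
  measurable_fun setT (fun w => X (S w) w).
Proof.
move=> mX rX mS S0.
apply: (@cvg_measurable_rV _ _ _ _ (fun k w => X (grid_above (S w) k) w)); last first.
  move=> w; apply: rX => //; last exact: grid_above_cvg.
  by move=> k; have /andP[] := grid_above_bounds k (S0 w).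
move=> k; apply: (measurable_select (i := fun w => Num.truncn (S w * k.+1%:R))
  (X := fun j => X (j.+1%:R / k.+1%:R))) => [j|j]; last exact: mX.
have S1 w : 0 <= S w * k.+1%:R by rewrite mulr_ge0.
apply: (@mset_ext _ _ (fun w => j%:R <= S w * k.+1%:R /\ S w * k.+1%:R < j.+1%:R)).
  move=> w; split=> [[h1 h2]|<-]; last by have /andP := truncn_itv (S1 w).
  by apply/eqP; rewrite truncn_eq // h1.
have mSk : measurable_fun setT (fun w => S w * k.+1%:R) by exact: measurable_funM.
by apply: mset_and; [exact: mset_ler|exact: mset_ltr].
Qed.

End random_time.

Section flow_paths.
Context {R : realType} {n : nat} (c : pdmp R n).
Local Notation V := 'rV[R]_n.

Lemma flow_continuous (z : V) : continuous (fun s : R => flow c s z).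
Proof.
move=> s; have [/= + _] := flow_derive c s z.
by move=> /derivable1_diffP/differentiable_continuous.
Qed.

(* The second alternative is the path after an accumulation of jump times. *)
Definition piecewise_flow (z : R -> V) := forall t, 0 <= t ->
  (exists2 e, 0 < e & forall u, t <= u < t + e -> z u = flow c (u - t) (z t)) \/
  (forall u, t <= u -> z u = 0).

Lemma piecewise_flow_right_continuous z : piecewise_flow z -> right_continuous z.
Proof.
move=> pz t s t0 ts st; have [[e e0 ez]|z0] := pz t t0; last first.
  rewrite z0 // (_ : (fun k => _) = fun=> 0); first exact: cvg_cst.
  by apply/funext => k; rewrite z0.
have h : flow c (s k - t) (z t) @[k --> \oo] --> z t.
  rewrite -[X in _ --> X](flow0 c (z t)).
  apply: (@cvg_comp _ _ _ (fun k => s k - t) (fun u => flow c u (z t)) _ (nbhs (0 : R))).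
    by rewrite -(subrr t); apply: cvgB => //; exact: cvg_cst.
  exact: flow_continuous.
apply: cvg_trans h; apply: near_eq_cvg.
have /cvgrPdist_lt /(_ _ e0) [N _ hN] := st.
exists N => // k /hN /= ke; rewrite -ez // ts /=.
by move: ke; rewrite distrC ger0_norm ?subr_ge0 // ltrBlDl.
Qed.

(** The flow is given as measurable at fixed times; its continuity in time supplies joint
    measurability. *)
Lemma measurable_flow_random_time {d} {T : measurableType d} (S : T -> R) (X : T -> V) :
  measurable_fun setT S -> measurable_fun setT X -> (forall w, 0 <= S w) ->
  measurable_fun setT (fun w => flow c (S w) (X w)).
Proof.
move=> mS mX S0.
apply: (@measurable_random_time _ _ _ _ (fun t w => flow c t (X w)) S) => //.
- by move=> t t0; apply: measurableT_comp => //; exact: measurable_flow.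
- move=> w t s t0 ts st.
  apply: (@cvg_comp _ _ _ s (fun u => flow c u (X w)) _ (nbhs t)) => //.
  exact: flow_continuous.
Qed.

End flow_paths.

Lemma exit_time_ge0 {R : realType} {n : nat} {T : Type} (W : set 'rV[R]_n)
  (Z : R -> T -> 'rV[R]_n) w : (0 <= exit_time W Z w)%E.
Proof. by apply: le_ereal_inf_tmp => _ [t [t0 _] <-]; rewrite lee_fin. Qed.

Section exit_measurability.
Context {R : realType} {n : nat} (c : pdmp R n).
Local Notation V := 'rV[R]_n.
Variables (W : set V) (oW : open W).

Lemma right_limit_eq (z v : R -> V) u : right_continuous z -> continuous v ->
  0 <= u -> (forall e, 0 < e -> exists2 u', u < u' < u + e & z u' = v u') -> 
  z u = v u.
Proof.
move=> rz cv u0 zv.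
have /choice[s hs] : forall k : nat, exists u', u < u' < u + k.+1%:R^-1 /\ z u' = v u'.
  by move=> k; have [|u' h1 h2] := zv k.+1%:R^-1; [rewrite invr_gt0|exists u'].
have su : s k @[k --> \oo] --> u.
  apply: (@squeeze_cvgr _ _ _ _ (fun=> u) (fun k => u + k.+1%:R^-1)).
  - by apply: nearW => k; have [/andP[/ltW -> /ltW ->]] := hs k.
  - exact: cvg_cst.
  - by rewrite -[X in _ --> X]addr0; apply: cvgD; [exact: cvg_cst|exact: cvg_harmonic].
have z1 : z (s k) @[k --> \oo] --> z u.
  by apply: rz => // k; have [/andP[/ltW]] := hs k.
have z2 : z (s k) @[k --> \oo] --> v u.
  rewrite (_ : (fun k => z (s k)) = v \o s); last first.
    by apply/funext => k /=; have [] := hs k.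
  by apply: (@cvg_comp _ _ _ s v _ (nbhs u)) => //; exact: cv.
exact: (cvg_unique _ z1 z2).
Qed.

(** No jump separates the exit at [t] from the time [a], so the stretch between them is the backward
    flow line of [z a] and can be read off from that single position. *)
Definition flowed_exit (z : R -> V) (a : R) := exists t, [/\ 0 <= t <= a,
  forall u, t <= u <= a -> z u = flow c (u - a) (z a) & ~ W (z t)].

Definition near_exit (k : nat) : set V := \bigcup_(y in ~` W) ball y k.+1%:R^-1.

(** The right side quantifies over countable sets only, which makes the event measurable. For the
    converse, the approximate exits [q k] cluster at some [t] by compactness, and [t] is a true exit
    because the complement of [W] is closed. *)
Lemma flowed_exitP (z : R -> V) (a : rat) : right_continuous z -> 0 <= ratr a :> R ->
  flowed_exit z (ratr a) <-> forall k : nat, exists q : rat,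
    [/\ 0 <= (ratr q : R) <= ratr a,
        forall u : rat, ratr q <= (ratr u : R) <= ratr a ->
          z (ratr u) = flow c (ratr u - ratr a) (z (ratr a)) &
        near_exit k (flow c (ratr q - ratr a) (z (ratr a)))].
Proof.
move=> rz a0; set A : R := ratr a; pose v u := flow c (u - A) (z A).
have cv : continuous v.
  move=> u; apply: (@continuous_comp _ _ _ (fun u => u - A) (fun s => flow c s (z A))).
    exact: (@continuousB _ _ _ id (cst A) _ (@cvg_id _ _) (@cst_continuous _ _ A u)).
  exact: flow_continuous.
have vA : v A = z A by rewrite /v subrr flow0.
split=> [[t [/andP[t0 tA] zv nW]] k|h].
  have k0 : 0 < k.+1%:R^-1 :> R by rewrite invr_gt0.
  (* The path may be outside [W] for one instant only, so a rational shortly after [t] is merely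
     close to the complement; if [t = A], the rational [a] itself serves. *)
  have : exists q : rat, t <= ratr q <= A /\ `|v t - v (ratr q)| < k.+1%:R^-1.
    have [<-|tA'] := eqVneq A t.
      by exists a; rewrite lexx subrr normr0.
    have {}tA' : t < A by rewrite lt_neqAle eq_sym tA'.
    have /cvgrPdist_lt /(_ _ k0) /nbhs_ballP[e /= e0 he] := cv t.
    have [q] := @rat_in_itvoo R t (Num.min A (t + e)) ltac:(by rewrite lt_min tA' ltrDl).
    rewrite in_itv /= lt_min => /and3P[tq qA qe].
    exists q; rewrite !ltW //; split=> //; apply: he.
    by rewrite /ball /= distrC ger0_norm ?subr_ge0 ?ltW // ltrBlDl.
  move=> [q [/andP[tq qA] vq]]; exists q; split.
  - by rewrite qA (le_trans t0).
  - by move=> u /andP[qu uA]; rewrite -zv // uA (le_trans tq).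
  - by exists (z t) => //; rewrite zv ?lexx // -ball_normE.
have /choice[q hq] := h.
have : compact `[0, A] by exact: segment_compact.
move=> /(_ ((fun k => ratr (q k) : R) @ \oo)) [].
  by exists 0%N => // k _ /=; rewrite in_itv /=; have [] := hq k.
move=> t [/=]; rewrite in_itv /= => /andP[t0 tA] clt.
have qt e K : 0 < e -> exists2 k, (K <= k)%N & `|t - ratr (q k)| < e.
  move=> e0; have [] := clt [set x | exists2 k, (K <= k)%N & x = ratr (q k)] (ball t e).
  - by exists K => // k /= Kk; exists k.
  - exact: nbhsx_ballx.
  - by move=> _ [[k Kk ->] hk]; exists k.
have zv1 k u : ratr (q k) <= u <= A -> z u = v u.
  move=> /andP[qu uA]; have [_ hz _] := hq k.
  have [->//|uA'] := eqVneq u A.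
  have {}uA' : u < A by rewrite lt_neqAle uA'.
  have u0 : 0 <= u by have [/andP[q0 _] _ _] := hq k; exact: le_trans qu.
  apply: (right_limit_eq rz cv u0) => e e0.
  have [u'] := @rat_in_itvoo R u (Num.min A (u + e)) ltac:(by rewrite lt_min uA' ltrDl).
  rewrite in_itv /= lt_min => /and3P[uu' uA'' ue].
  by exists (ratr u'); [rewrite uu'|rewrite hz // (le_trans qu) ltW // ltW].
have zv2 u : t < u <= A -> z u = v u.
  move=> /andP[tu uA]; have [|k _ hk] := qt (u - t) 0%N; first by rewrite subr_gt0.
  apply: (zv1 k); rewrite uA andbT.
  by move: hk; rewrite ltr_distlC subrKC => /andP[_ /ltW].
have zvt : z t = v t.
  have [->//|tA'] := eqVneq t A.
  have {}tA' : t < A by rewrite lt_neqAle tA'.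
  apply: (right_limit_eq rz cv t0) => e e0.
  (* Half of the smaller of [A - t] and [e] keeps [u] strictly after [t], at most [A] and strictly
     below [t + e]. *)
  pose u := t + Num.min (A - t) e / 2.
  have m0 : 0 < Num.min (A - t) e by rewrite lt_min subr_gt0 tA'.
  have m1 : Num.min (A - t) e <= A - t by rewrite ge_min lexx.
  have m2 : Num.min (A - t) e <= e by rewrite ge_min lexx orbT.
  by exists u; [|apply: zv2]; apply/andP; split; rewrite /u; lra.
exists t; split; first by rewrite t0.
- move=> u /andP[]; rewrite le_eqVlt => /predU1P[<- //|tu uA].
  by rewrite zv2 // tu.
(* If [v t] were in [W], so would be a ball of radius [e] around it; but some [q k] near [t] yields
   a point outside [W] within [e / 2 + e / 2] of [v t]. *)
- rewrite zvt => Wt.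
  have /nbhs_ballP [e /= e0 eW] := open_nbhs_nbhs (conj oW Wt).
  have e20 : 0 < e / 2 by rewrite divr_gt0.
  have [K _ hK] := near_infty_natSinv_lt (PosNum e20).
  have /cvgrPdist_lt /(_ _ e20) /nbhs_ballP[b /= b0 hb] := cv t.
  have [k Kk hk] := qt _ K b0.
  have [_ _ [y nWy]] := hq k.
  rewrite -ball_normE /= -/(v _) => yv; rewrite distrC in yv; apply: nWy; apply: eW.
  have {}hK := hK _ Kk; have {}hb := hb _ hk.
  have tri := ler_distD (v (ratr (q k))) (v t) y.
  rewrite -ball_normE /=.
  have aux (k' p1 p2 p3 : R) : k' < e / 2 -> p1 < e / 2 -> p2 < k' -> p3 <= p1 + p2 -> p3 < e.
    by lra.
  exact: aux hK hb yv tri.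
Qed.

Context {d} {T : measurableType d} (Z : R -> T -> V).
Hypothesis mZ : forall t, 0 <= t -> measurable_fun setT (Z t).
Hypothesis pZ : forall w, piecewise_flow c (Z ^~ w).

(** Legs are half-open on the right, so an exit at [t < s] is followed by a rational [a < s] on the
    same leg. After an accumulation of jumps the path is constant and [a] is itself an exit. *)
Lemma exit_time_lt w s : (exit_time W Z w < s%:E)%E <->
  exists a : rat, 0 <= (ratr a : R) < s /\ flowed_exit (Z ^~ w) (ratr a).
Proof.
split=> [/ereal_inf_lt[_ [t [t0 nW] <-]]|[a [/andP[a0 as_] [t [/andP[t0 ta] _ nW]]]]].
  rewrite lte_fin => ts; have [[e e0 ez]|z0] := pZ w t0.
    have [a] := @rat_in_itvoo R t (Num.min s (t + e)) ltac:(by rewrite lt_min ts ltrDl).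
    rewrite in_itv /= lt_min => /and3P[ta as_ ae].
    exists a; rewrite as_ (le_trans t0 (ltW ta)); split=> //.
    exists t; split=> //; first by rewrite t0 ltW.
    move=> u /andP[tu ua]; rewrite ez ?tu ?(le_lt_trans ua) // (ez (ratr a)) ?(ltW ta) //.
    by rewrite -flowD; congr (flow c _ _); ring.
  have [a] := @rat_in_itvoo R t s ts; rewrite in_itv /= => /andP[ta as_].
  exists a; rewrite as_ (le_trans t0 (ltW ta)); split=> //.
  exists (ratr a); split; first by rewrite (le_trans t0 (ltW ta)) lexx.
    by move=> u /le_anti <-; rewrite subrr flow0.
  by rewrite z0 ?ltW // -(z0 t).
apply: (@le_lt_trans _ _ t%:E); last by rewrite lte_fin (le_lt_trans ta).
by apply: ereal_inf_lbound; exists t.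
Qed.

Lemma measurable_exit_time : measurable_fun setT (exit_time W Z).
Proof.
apply: emeasurable_lower_levels => s.
apply: (@mset_ext _ _ (fun w => exists a : rat, 0 <= (ratr a : R) < s /\
    forall k : nat, exists q : rat,
    [/\ 0 <= (ratr q : R) <= ratr a,
        forall u : rat, ratr q <= (ratr u : R) <= ratr a ->
          Z (ratr u) w = flow c (ratr u - ratr a) (Z (ratr a) w) &
        near_exit k (flow c (ratr q - ratr a) (Z (ratr a) w))])).
  move=> w; rewrite exit_time_lt; split=> -[a [/andP[a0 as_] h]]; exists a; rewrite a0 as_;
    split=> //; move: h; rewrite flowed_exitP //;
    exact: piecewise_flow_right_continuous.
apply: mset_exists => a.
have [a0|/negP a0] := boolP (0 <= ratr a :> R); last first.
  apply: (@mset_ext _ _ (fun=> False)); last exact: mset_cst.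
  by move=> w; split=> // -[/andP[]].
apply: mset_and; first exact: mset_cst.
apply: mset_forall => k; apply: mset_exists => q.
apply: (@mset_ext _ _ (fun w => 0 <= (ratr q : R) <= ratr a /\
  ((forall u : rat, ratr q <= (ratr u : R) <= ratr a ->
          Z (ratr u) w = flow c (ratr u - ratr a) (Z (ratr a) w)) /\
  near_exit k (flow c (ratr q - ratr a) (Z (ratr a) w))))).
  by move=> w; split=> [[? []]|[]].
have mf b : measurable_fun setT (fun w => flow c b (Z (ratr a) w)).
  by apply: measurableT_comp; [exact: measurable_flow|exact: mZ].
have [q0|/negP q0] := boolP (0 <= ratr q :> R); last first.
  apply: (@mset_ext _ _ (fun=> False)); last exact: mset_cst.
  by move=> w; split=> // -[/andP[]].
apply: mset_and; first exact: mset_cst.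
apply: mset_and.
  apply: mset_forall => u.
  have [qu|qu] := pselect (ratr q <= (ratr u : R) <= ratr a); last first.
    by apply: (@mset_ext _ _ (fun=> True)); [move=> w; split|exact: mset_cst].
  apply: mset_imply; first exact: mset_cst.
  by apply: mset_eq_rV => //; apply: mZ; move/andP: qu => [+ _]; exact: le_trans.
apply: (measurable_fun_set (mf _)); apply: open_measurable_rV.
by apply: bigcup_open => y _; exact: ball_open.
Qed.

Lemma measurable_exit_pos : measurable_fun setT (exit_pos W Z).
Proof.
apply: (measurable_random_time mZ) => [w||w].
- exact: piecewise_flow_right_continuous.
- by apply: measurableT_comp => //; exact: measurable_exit_time.
- by apply: fine_ge0; exact: exit_time_ge0.
Qed.

End exit_measurability.

Section exit_times.
Context {R : realType} {n : nat} {T : Type}.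
Local Notation V := 'rV[R]_n.
Variables (W : set V) (oW : open W) (Z : R -> T -> V) (w : T).

Lemma exit_time_le t : 0 <= t -> ~ W (Z t w) -> (exit_time W Z w <= t%:E)%E.
Proof. by move=> t0 nW; apply: ereal_inf_lbound; exists t. Qed.

(** Openness of [W] decides the end point: a path in [W] at [t] stays there for a while by right
    continuity, so exits cannot accumulate at [t] from the right. *)
Lemma exit_time_gtP t : right_continuous (Z ^~ w) -> 0 <= t ->
  (t%:E < exit_time W Z w)%E <-> forall s, 0 <= s <= t -> W (Z s w).
Proof.
move=> rz t0; split=> [tt s /andP[s0 st]|h].
  apply: contrapT => /(exit_time_le s0) /(lt_le_trans tt).
  by rewrite lte_fin ltNge st.
rewrite ltNge; apply/negP => tle.
have /choice[s hs] : forall k : nat, exists s, t <= s <= t + k.+1%:R^-1 /\ ~ W (Z s w).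
  move=> k; have /ereal_inf_lt[_ [s [s0 nW] <-]] : (exit_time W Z w < (t + k.+1%:R^-1)%:E)%E.
    by rewrite (le_lt_trans tle) // lte_fin ltrDl invr_gt0 ltr0n.
  rewrite lte_fin => /ltW sk; exists s; split=> //; rewrite sk andbT.
  by rewrite leNgt; apply/negP => /ltW st; apply: nW; apply: h; rewrite s0.
have st : s k @[k --> \oo] --> t.
  apply: (@squeeze_cvgr _ _ _ _ (fun=> t) (fun k => t + k.+1%:R^-1)).
  - by apply: nearW => k; have [] := hs k.
  - exact: cvg_cst.
  - by rewrite -[X in _ --> X]addr0; apply: cvgD; [exact: cvg_cst|exact: cvg_harmonic].
have zst : Z (s k) w @[k --> \oo] --> Z t w.
  by apply: rz => // k; have [/andP[]] := hs k.
have Wt : W (Z t w) by apply: h; rewrite t0 lexx.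
have [N _ hN] := zst _ (open_nbhs_nbhs (conj oW Wt)).
by have [_] := hs N; apply; exact: (hN N (leqnn N)).
Qed.

(** The infimum is attained: a path still in [W] at its exit time would, by [exit_time_gtP], exit
    strictly later than it does. *)
Lemma exit_pos_notin : right_continuous (Z ^~ w) ->
  (exit_time W Z w < +oo)%E -> ~ W (exit_pos W Z w).
Proof.
move=> rz toy; have t0 := exit_time_ge0 W Z w.
have tE : exit_time W Z w = (fine (exit_time W Z w))%:E by rewrite fineK // ge0_fin_numE.
rewrite /exit_pos => Wt; have f0 := fine_ge0 t0.
suff : (exit_time W Z w < exit_time W Z w)%E by rewrite ltxx.
rewrite [X in (X < _)%E]tE; apply/exit_time_gtP => // s /andP[s0].
rewrite le_eqVlt => /predU1P[->//|st]; apply: contrapT => /(exit_time_le s0).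
by rewrite tE lee_fin leNgt st.
Qed.

Lemma exit_time_shift t : 0 <= t -> (t%:E < exit_time W Z w)%E ->
  exit_time W (fun u => Z (t + u)) w = (exit_time W Z w - t%:E)%E.
Proof.
move=> t0 tt; apply/eqP; rewrite eq_le; apply/andP; split.
  rewrite leeBrDr //; apply: le_ereal_inf_tmp => _ [s [s0 nW] <-].
  have ts : t <= s.
    by rewrite leNgt; apply/negP => st; have := lt_le_trans tt (exit_time_le s0 nW);
      rewrite lte_fin ltNge ltW.
  rewrite -leeBrDr // -EFinB; apply: ereal_inf_lbound; exists (s - t) => //.
  by rewrite /= subr_ge0 subrKC.
apply: le_ereal_inf_tmp => _ [s [s0 nW] <-].
by rewrite leeBlDr // -EFinD addrC; apply: exit_time_le => //; rewrite addr_ge0.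
Qed.

Lemma exit_pos_shift t : 0 <= t -> (t%:E < exit_time W Z w < +oo)%E ->
  exit_pos W (fun u => Z (t + u)) w = exit_pos W Z w.
Proof.
move=> t0 /andP[tt too]; rewrite /exit_pos exit_time_shift // fineB //; last first.
  by rewrite ge0_fin_numE // exit_time_ge0.
by rewrite subrKC.
Qed.

End exit_times.

Lemma eq_exit_time {R : realType} {n : nat} {T T' : Type} (W : set 'rV[R]_n)
    (Z : R -> T -> 'rV[R]_n) (Z' : R -> T' -> 'rV[R]_n) w w' :
  (forall t, 0 <= t -> Z t w = Z' t w') -> exit_time W Z w = exit_time W Z' w'.
Proof.
move=> ZZ; congr ereal_inf; apply/seteqP; split=> _ [t [t0 h] <-]; exists t => //.
  by rewrite /= -ZZ.
by rewrite /= ZZ.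
Qed.

Lemma eq_exit_pos {R : realType} {n : nat} {T T' : Type} (W : set 'rV[R]_n)
    (Z : R -> T -> 'rV[R]_n) (Z' : R -> T' -> 'rV[R]_n) w w' :
  (forall t, 0 <= t -> Z t w = Z' t w') -> exit_pos W Z w = exit_pos W Z' w'.
Proof.
move=> ZZ; rewrite /exit_pos (eq_exit_time W ZZ) ZZ //.
by apply: fine_ge0; exact: exit_time_ge0.
Qed.

Section paths.
Context {R : realType} {n : nat} (c : pdmp R n).
Local Notation V := 'rV[R]_n.
Context {d} {T : measurableType d}.
Variables (xi : nat -> T -> V) (theta : nat -> T -> \bar R) (w : T).
Hypothesis theta_ge0 : forall k, (0 <= theta k w)%E.
Local Notation J k := (jump_time theta k w).
Local Notation Z := (pdmp_path c xi theta).

Lemma jump_time0 : J 0 = 0%E.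
Proof. by rewrite /jump_time big_ord0. Qed.

Lemma jump_timeS k : J k.+1 = (J k + theta k w)%E.
Proof. by rewrite /jump_time big_ord_recr. Qed.

Lemma jump_time_ge0 k : (0 <= J k)%E.
Proof. by apply: sume_ge0 => i _. Qed.

Lemma jump_time_mono k m : (k <= m)%N -> (J k <= J m)%E.
Proof.
move=> /subnKC <-; elim: (m - k)%N => [|i IH]; first by rewrite addn0.
by rewrite addnS jump_timeS (le_trans IH) // leeDl.
Qed.

Lemma jump_time_fineK k t : (J k <= t%:E)%E -> (fine (J k))%:E = J k.
Proof.
move=> kt; rewrite fineK // ge0_fin_numE ?jump_time_ge0 //.
exact: le_lt_trans kt (ltry _).
Qed.

Definition on_leg k t := (J k <= t%:E < J k.+1)%E.

Lemma on_leg_uniq k m t : on_leg k t -> on_leg m t -> k = m.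
Proof.
move=> /andP[k1 k2] /andP[m1 m2]; apply/eqP; rewrite eqn_leq.
apply/andP; split; rewrite leqNgt; apply/negP => /jump_time_mono.
  by move=> /le_trans /(_ k1); rewrite leNgt m2.
by move=> /le_trans /(_ m1); rewrite leNgt k2.
Qed.

Lemma on_leg_path k t : on_leg k t -> Z t w = flow c (t - fine (J k)) (xi k w).
Proof.
move=> kt; rewrite /pdmp_path; set A := (X in xget _ X).
have [|m [mt ->]] := @xgetPex _ 0 A; last by rewrite (on_leg_uniq kt mt).
by exists (flow c (t - fine (J k)) (xi k w)), k.
Qed.

Lemma on_leg_pathD k u : (J k < +oo)%E -> 0 <= u -> (u%:E < theta k w)%E ->
  on_leg k (fine (J k) + u) /\ Z (fine (J k) + u) w = flow c u (xi k w).
Proof.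
move=> Jk u0 ut; have JK : (fine (J k))%:E = J k by rewrite fineK // ge0_fin_numE // jump_time_ge0.
have leg : on_leg k (fine (J k) + u).
  by rewrite /on_leg jump_timeS EFinD JK leeDl //= lteD2lE // ge0_fin_numE // jump_time_ge0.
by split=> //; rewrite (on_leg_path leg); congr (flow c _ _); ring.
Qed.

Lemma no_leg_path t : (forall k, ~ on_leg k t) -> Z t w = 0.
Proof. by move=> h; apply: xgetPN => z [k [/h]]. Qed.

Lemma on_legVexploded t : 0 <= t ->
  (exists k, on_leg k t) \/ (forall k, (J k <= t%:E)%E).
Proof.
move=> t0; have [h|h] := pselect (exists k, on_leg k t); [by left|right].
elim=> [|k IH]; first by rewrite jump_time0 lee_fin.
by rewrite leNgt; apply/negP => kt; apply: h; exists k; rewrite /on_leg IH.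
Qed.

Lemma piecewise_flow_path : piecewise_flow c (Z ^~ w).
Proof.
move=> t t0; have [[k kt]|h] := on_legVexploded t0; last first.
  right=> u tu; apply: no_leg_path => k /andP[_]; rewrite ltNge.
  by rewrite (le_trans (h k.+1)).
left; have /andP[k1 k2] := kt.
have [e e0 he] : exists2 e, 0 < e & ((t + e)%:E <= J k.+1)%E.
  move: k2; case: (J k.+1) => [r| |//].
    by rewrite lte_fin => tr; exists (r - t); rewrite ?subr_gt0 // lee_fin subrKC.
  by move=> _; exists 1; rewrite // leey.
exists e => // u /andP[tu ue].
rewrite (on_leg_path kt) (@on_leg_path k u); last first.
  by rewrite /on_leg (le_trans k1) ?lee_fin //= (lt_le_trans _ he) // lte_fin.
by rewrite -flowD; congr (flow c _ _); ring.
Qed.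

Let rZ := piecewise_flow_right_continuous piecewise_flow_path.

Variables (W : set V) (oW : open W).
Local Notation H z := (exit_time W (flow c) z).

Lemma flow_right_continuous z : right_continuous (fun t => flow c t z).
Proof.
apply: (@piecewise_flow_right_continuous _ _ c) => t t0; left; exists 1 => // u _.
by rewrite -flowD subrK.
Qed.

(** Equality of [theta i w] with the hitting time is allowed: a leg is half-open, so the jump takes
    the path away just before the flow would leave. The condition reads only [xi i] and [theta i]
    with [i < k]. *)
Definition legs_survived k :=
  forall i, (i < k)%N -> (theta i w < +oo)%E /\ (theta i w <= H (xi i w))%E.

Lemma legs_survived_jump_time k : legs_survived k -> (J k < +oo)%E.
Proof.
move=> h; rewrite /jump_time; apply: lte_sum_pinfty => i _.
by have [] := h i (ltn_ord i).
Qed.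

Lemma leg_in_W k u : (theta k w <= H (xi k w))%E -> 0 <= u ->
  (u%:E < theta k w)%E -> W (flow c u (xi k w)).
Proof.
move=> hk u0 uk; have := lt_le_trans uk hk.
move=> /(exit_time_gtP oW (@flow_right_continuous _) u0); apply.
by rewrite u0 lexx.
Qed.

(** Once [t] is known to lie on leg [k], survival up to [t] no longer involves [theta k]. This is
    what makes it an event of the past of that holding time. *)
Lemma exit_time_on_leg k t : 0 <= t -> on_leg k t ->
  (t%:E < exit_time W Z w)%E <->
  legs_survived k /\ ((t - fine (J k))%:E < H (xi k w))%E.
Proof.
move=> t0 kt; have /andP[k1 k2] := kt; have JK := jump_time_fineK k1.
have tJ : 0 <= t - fine (J k) by rewrite subr_ge0 -lee_fin JK.
rewrite exit_time_gtP // exit_time_gtP //; last exact: flow_right_continuous.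
split=> [h|[h1 h2] s /andP[s0 st]].
  split=> [i ik|u /andP[u0 ut]]; last first.
    have Jkfin : (J k < +oo)%E by rewrite -JK ltry.
    have [|_ <-] := on_leg_pathD Jkfin u0.
      move: k2; rewrite jump_timeS -JK; case: (theta k w) => [r| |] //; last by move=> _; rewrite ltry.
      by rewrite -EFinD !lte_fin => kr; move: ut kr; lra.
    apply: h; rewrite addr_ge0 //=; last by apply: fine_ge0; exact: jump_time_ge0.
    by move: ut; lra.
  have Ji : (J i.+1 <= t%:E)%E by rewrite (le_trans _ k1) // jump_time_mono.
  have ti : (theta i w < +oo)%E.
    rewrite (le_lt_trans _ (ltry t)) // (le_trans _ Ji) // jump_timeS leeDr //.
    exact: jump_time_ge0.
  have Jifin : (J i < +oo)%E.
    by rewrite (le_lt_trans _ (ltry t)) // (le_trans _ Ji) // jump_time_mono.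
  split=> //; rewrite leNgt; apply/negP => Hi.
  have Hfin : (H (xi i w) < +oo)%E := lt_trans Hi ti.
  have := exit_pos_notin oW (@flow_right_continuous _) Hfin.
  have HK : (fine (H (xi i w)))%:E = H (xi i w) by rewrite fineK // ge0_fin_numE // exit_time_ge0.
  have H0 : 0 <= fine (H (xi i w)) by rewrite fine_ge0 // exit_time_ge0.
  rewrite /exit_pos; apply.
  have [|/andP[l1 l2] <-] := on_leg_pathD Jifin H0; first by rewrite HK.
  apply: h; rewrite addr_ge0 //=; last by apply: fine_ge0; exact: jump_time_ge0.
  by rewrite -lee_fin ltW // (lt_le_trans l2).
have [[i si]|/(_ k.+1)] := on_legVexploded s0; last first.
  by move=> /(lt_le_trans k2); rewrite lte_fin ltNge st.
have /andP[i1 i2] := si; have JiK := jump_time_fineK i1.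
have sJi : 0 <= s - fine (J i) by rewrite subr_ge0 -lee_fin JiK.
rewrite (on_leg_path si).
have ik : (i <= k)%N.
  rewrite leqNgt; apply/negP => /jump_time_mono => /(lt_le_trans k2).
  by move=> /lt_le_trans /(_ i1); rewrite lte_fin ltNge st.
move: ik; rewrite leq_eqVlt => /predU1P[ik|ik].
  by subst i; apply: h2; rewrite sJi lerD2r.
have [ti hi] := h1 i ik; apply: leg_in_W => //.
move: i2; rewrite jump_timeS -JiK; case: (theta i w) => [r| |] //; last by move=> _; rewrite ltry.
by rewrite -EFinD !lte_fin ltrBlDl.
Qed.

Definition exits_on_leg k := legs_survived k /\ (H (xi k w) < theta k w)%E.

(** The flow leaves [W] strictly before the jump, so the exit is a function of the start time and
    start position of leg [k]. *)
Lemma exits_on_legE k : exits_on_leg k ->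
  exit_time W Z w = (J k + H (xi k w))%E /\
  exit_pos W Z w = exit_pos W (flow c) (xi k w).
Proof.
move=> [h1 h2]; have Jk := legs_survived_jump_time h1.
have JK : (fine (J k))%:E = J k by rewrite fineK // ge0_fin_numE // jump_time_ge0.
have Hfin : (H (xi k w) < +oo)%E := lt_le_trans h2 (leey _).
have HK : (fine (H (xi k w)))%:E = H (xi k w) by rewrite fineK // ge0_fin_numE // exit_time_ge0.
have H0 : 0 <= fine (H (xi k w)) by rewrite fine_ge0 // exit_time_ge0.
have J0 : 0 <= fine (J k) by rewrite fine_ge0 // jump_time_ge0.
have [|leg Zleg] := on_leg_pathD Jk H0; first by rewrite HK.
have tE : exit_time W Z w = (J k + H (xi k w))%E.
  apply/eqP; rewrite eq_le; apply/andP; split.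
    rewrite -JK -HK -EFinD; apply: exit_time_le; first by rewrite addr_ge0.
    by rewrite Zleg; exact: exit_pos_notin (@flow_right_continuous _) Hfin.
  (* An earlier exit would be attained on some leg [i <= k], at a point where the flow of that leg
     is still in [W]. *)
  rewrite leNgt -JK -HK -EFinD; apply/negP => lt.
  have tfin : (exit_time W Z w < +oo)%E := lt_trans lt (ltry _).
  apply: (exit_pos_notin oW rZ tfin); rewrite /exit_pos.
  move: lt; rewrite -(@fineK _ (exit_time W Z w)); last first.
    by rewrite ge0_fin_numE // exit_time_ge0.
  rewrite lte_fin /=; set t := fine _ => lt.
  have t0 : 0 <= t by rewrite fine_ge0 // exit_time_ge0.
  have [[i ti]|/(_ k.+1)] := on_legVexploded t0; last first.
    have /andP[_ l2] := leg; move=> /(lt_le_trans l2); rewrite lte_fin => ll.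
    by have := lt_trans lt ll; rewrite ltxx.
  rewrite (on_leg_path ti); have /andP[i1 i2] := ti; have JiK := jump_time_fineK i1.
  have sJi : 0 <= t - fine (J i) by rewrite subr_ge0 -lee_fin JiK.
  have ik : (i <= k)%N.
    have /andP[_ l2] := leg.
    rewrite leqNgt; apply/negP => /jump_time_mono => /(lt_le_trans l2).
    by move=> /lt_le_trans /(_ i1); rewrite lte_fin ltNge ltW.
  move: ik; rewrite leq_eqVlt => /predU1P[ik|ik].
    subst i; have /(exit_time_gtP oW (@flow_right_continuous _) sJi) :
      ((t - fine (J k))%:E < H (xi k w))%E by rewrite -HK lte_fin ltrBlDl.
    by apply; rewrite sJi lexx.
  have [_ hi] := h1 i ik; apply: leg_in_W => //.
  move: i2; rewrite jump_timeS -JiK; case: (theta i w) => [r| |] //; last by move=> _; rewrite ltry.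
  by rewrite -EFinD !lte_fin ltrBlDl.
by split=> //; rewrite /exit_pos tE -JK -HK.
Qed.

(** As jumps do not accumulate, the attained exit time lies on some leg. An earlier leg whose flow
    left [W] before its jump would give an earlier exit. *)
Lemma exits_on_leg_exists : (forall t : R, exists k, (t%:E < J k)%E) ->
  (exit_time W Z w < +oo)%E -> exists k, exits_on_leg k.
Proof.
move=> noexpl tfin.
have tK : (fine (exit_time W Z w))%:E = exit_time W Z w.
  by rewrite fineK // ge0_fin_numE // exit_time_ge0.
have t0 : 0 <= fine (exit_time W Z w) by rewrite fine_ge0 // exit_time_ge0.
have nW := exit_pos_notin oW rZ tfin; rewrite /exit_pos in nW.
have [[k kt]|h] := on_legVexploded t0; last first.
  by have [k] := noexpl (fine (exit_time W Z w)); rewrite ltNge h.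
have /andP[k1 k2] := kt; have JK := jump_time_fineK k1.
have tJ : 0 <= fine (exit_time W Z w) - fine (J k) by rewrite subr_ge0 -lee_fin JK.
exists k; split; last first.
  move: nW; rewrite (on_leg_path kt) => /(@exit_time_le _ _ _ W (flow c) _ _ tJ).
  move=> /le_lt_trans; apply; move: k2; rewrite jump_timeS -JK.
  case: (theta k w) => [r| |] //; last by move=> _; rewrite ltry.
by rewrite -EFinD !lte_fin ltrBlDl.
move=> i ik.
have Ji : (J i.+1 <= exit_time W Z w)%E by rewrite -tK (le_trans _ k1) // jump_time_mono.
have ti : (theta i w < +oo)%E.
  rewrite (le_lt_trans _ tfin) // (le_trans _ Ji) // jump_timeS leeDr //.
  exact: jump_time_ge0.
have Jifin : (J i < +oo)%E.
  by rewrite (le_lt_trans _ tfin) // (le_trans _ Ji) // jump_time_mono.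
split=> //; rewrite leNgt; apply/negP => Hi.
have Hfin : (H (xi i w) < +oo)%E := lt_trans Hi ti.
have HK : (fine (H (xi i w)))%:E = H (xi i w) by rewrite fineK // ge0_fin_numE // exit_time_ge0.
have H0 : 0 <= fine (H (xi i w)) by rewrite fine_ge0 // exit_time_ge0.
have J0 : 0 <= fine (J i) by rewrite fine_ge0 // jump_time_ge0.
have := exit_pos_notin oW (@flow_right_continuous _) Hfin; rewrite /exit_pos.
have [|/andP[l1 l2] <-] := on_leg_pathD Jifin H0; first by rewrite HK.
move=> /(exit_time_le (addr_ge0 J0 H0)) /le_lt_trans /(_ l2).
by rewrite ltNge Ji.
Qed.

Lemma exits_on_leg_uniq k m : exits_on_leg k -> exits_on_leg m -> k = m.
Proof.
move=> [k1 k2] [m1 m2]; have [km|mk|//] := ltngtP k m.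
  by have [_] := m1 k km; rewrite leNgt k2.
by have [_] := k1 m mk; rewrite leNgt m2.
Qed.

End paths.

(** * Laws that agree up to a factor *)

Section agreement.
Context {R : realType} {d1 d2 d} {T1 : measurableType d1} {T2 : measurableType d2}
  {E : measurableType d}.
Variables (m1 : {measure set T1 -> \bar R}) (m2 : {measure set T2 -> \bar R}).
Variables (a : R) (G1 : set T1) (f1 : T1 -> E) (G2 : set T2) (f2 : T2 -> E).
Hypotheses (a0 : 0 <= a) (mG1 : measurable G1) (mG2 : measurable G2).
Hypotheses (mf1 : measurable_fun setT f1) (mf2 : measurable_fun setT f2).

(** Equality of two conditional laws with the denominators cleared, so that null events need no
    separate case. *)
Definition agree_on (B : set E) :=
  m1 (G1 `&` f1 @^-1` B) = (a%:E * m2 (G2 `&` f2 @^-1` B))%E.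

Local Notation push m mf :=
  (measure_function_pushforward__canonical__measure_function_Measure m mf).

Let k : {nonneg R} := NngNum a0.
Let n1 : {measure set E -> \bar R} := push (mrestr m1 mG1) mf1.
Let n2 : {measure set E -> \bar R} := mscale k (push (mrestr m2 mG2) mf2).

Let n12 B : agree_on B -> n1 B = n2 B.
Proof. by rewrite /agree_on setIC [X in m2 X]setIC. Qed.

(** Uniqueness of finite measures that agree on a pi-system; [C setT] fixes the total mass and
    supplies the exhausting sequence. *)
Lemma agree_pi (C : set (set E)) : @measurable _ E = <<s C >> -> setI_closed C ->
  C setT -> (m1 G1 < +oo)%E -> (forall B, C B -> agree_on B) ->
  forall B, measurable B -> agree_on B.
Proof.
move=> EC CI CT G1oo h B mB; rewrite /agree_on setIC [X in m2 X]setIC.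
apply: (@measure_unique _ R E C (fun=> setT) EC CI _ _ n1 n2) => //.
- by rewrite bigcup_const.
- by move=> A /h; exact: n12.
- by move=> _; rewrite /n1 /= /pushforward preimage_setT /mrestr setTI.
Qed.

Let integral_mrestrT {d'} {T : measurableType d'} (m : {measure set T -> \bar R})
    (G : set T) (mG : measurable G) (phi : T -> \bar R) :
  measurable_fun setT phi -> (forall x, 0 <= phi x)%E ->
  (\int[mrestr m mG]_x phi x = \int[m]_(x in G) phi x)%E.
Proof.
move=> mphi phi0.
have N0 : mrestr m mG (~` G) = 0%E by rewrite /mrestr setICl measure0.
rewrite (ge0_negligible_integral (measurableC mG) _ _ _ N0) //.
rewrite setDE setCK setTI; apply: eq_measure_integral => A mA AG.
by rewrite /= /mrestr setIidl.
Qed.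

Lemma agree_integral (phi : E -> \bar R) :
  (forall B, measurable B -> agree_on B) ->
  measurable_fun setT phi -> (forall x, 0 <= phi x)%E ->
  (\int[m1]_(x in G1) phi (f1 x) = a%:E * \int[m2]_(x in G2) phi (f2 x))%E.
Proof.
move=> h mphi phi0.
rewrite -(integral_mrestrT m1 mG1) //; last exact: measurableT_comp.
rewrite -(integral_mrestrT m2 mG2) //; last exact: measurableT_comp.
rewrite -[LHS](@ge0_integral_pushforward _ _ _ _ _ f1 mf1 (mrestr m1 mG1) setT) //.
rewrite -[in RHS](@ge0_integral_pushforward _ _ _ _ _ f2 mf2 (mrestr m2 mG2) setT) //.
transitivity (\int[n2]_x phi x)%E; last exact: ge0_integral_mscale.
by apply: eq_measure_integral => A mA _; exact: n12 (h A mA).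
Qed.

End agreement.

Section agreement_product.
Context {R : realType} {d1 d2 d d'} {T1 : measurableType d1} {T2 : measurableType d2}
  {E : measurableType d} {E' : measurableType d'}.
Variables (m1 : {measure set T1 -> \bar R}) (m2 : {measure set T2 -> \bar R}).
Variables (a : R) (G1 : set T1) (G2 : set T2).
Hypotheses (a0 : 0 <= a) (mG1 : measurable G1) (mG2 : measurable G2).
Hypothesis (G1oo : (m1 G1 < +oo)%E).

Lemma agree_prod (f1 : T1 -> E) (f2 : T2 -> E) (g1 : T1 -> E') (g2 : T2 -> E') :
  measurable_fun setT f1 -> measurable_fun setT f2 ->
  measurable_fun setT g1 -> measurable_fun setT g2 ->
  (forall A B, measurable A -> measurable B ->
    m1 (G1 `&` [set w | A (f1 w) /\ B (g1 w)]) =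
    (a%:E * m2 (G2 `&` [set w | A (f2 w) /\ B (g2 w)]))%E) ->
  forall B, measurable B -> agree_on m1 m2 a G1 (fun w => (f1 w, g1 w)) G2 (fun w => (f2 w, g2 w)) B.
Proof.
move=> mf1 mf2 mg1 mg2 h.
apply: (@agree_pi _ _ _ _ _ _ _ m1 m2 a G1 _ G2 _ a0 mG1 mG2 _ _
  [set A `*` B | A in @measurable _ E & B in @measurable _ E']) => //.
- exact: measurable_fun_pair.
- exact: measurable_fun_pair.
- exact: measurable_prod_measurableType.
- move=> _ _ [A mA [B mB <-]] [A' mA' [B' mB' <-]].
  by rewrite -setXI; exists (A `&` A'); [exact: measurableI|
    exists (B `&` B') => //; exact: measurableI].
- by exists setT => //; exists setT => //; rewrite setXTT.
- by move=> _ [A mA [B mB <-]]; exact: h.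
Qed.

(** The half-lines above a real [s] never contain -oo, so they do not fix the total mass; hence the
    separate hypothesis on [G1] and [G2]. *)
Lemma agree_ereal (g1 : T1 -> \bar R) (g2 : T2 -> \bar R) :
  measurable_fun setT g1 -> measurable_fun setT g2 ->
  m1 G1 = (a%:E * m2 G2)%E ->
  (forall s, m1 (G1 `&` [set w | (s%:E < g1 w)%E]) =
    (a%:E * m2 (G2 `&` [set w | (s%:E < g2 w)%E]))%E) ->
  forall B, measurable B -> agree_on m1 m2 a G1 g1 G2 g2 B.
Proof.
move=> mg1 mg2 hT h.
pose C := [set A : set (\bar R) | A = setT \/ exists s : R, A = `]s%:E, +oo[%classic].
apply: (@agree_pi _ _ _ _ _ _ _ m1 m2 a G1 _ G2 _ a0 mG1 mG2 _ _ C) => //.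
- rewrite /measurable /= ErealGenOInfty.measurableE; apply/seteqP; split.
    by apply: sub_sigma_algebra2 => _ [s ->]; right; exists s.
  apply: smallest_sub; first exact: smallest_sigma_algebra.
  move=> _ [->|[s ->]]; first exact: measurableT.
  by apply: sub_sigma_algebra; exists s.
- move=> _ _ [->|[s ->]] [->|[t ->]]; rewrite ?setTI ?setIT; [by left|by right; exists t|by right; exists s|].
  right; exists (Num.max s t); apply/seteqP; split=> x /=; rewrite !in_itv /= !andbT EFin_max gt_max.
    by move=> [-> ->].
  by move=> /andP[].
- by left.
- move=> _ [->|[s ->]]; rewrite /agree_on ?preimage_setT ?setIT //.
  rewrite (_ : g1 @^-1` _ = [set w | (s%:E < g1 w)%E]); last first.
    by apply/seteqP; split=> x; rewrite /= in_itv /= andbT.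
  rewrite (_ : g2 @^-1` _ = [set w | (s%:E < g2 w)%E]) //.
  by apply/seteqP; split=> x; rewrite /= in_itv /= andbT.
Qed.

End agreement_product.

(** * Survival functions and holding times *)

Section integral_param.
Context {R : realType} {d} {T : measurableType d}.

Lemma measurable_integral_param (D : set (T * R)) (f : T * R -> \bar R) :
  measurable D -> measurable_fun setT f -> (forall x, 0 <= f x)%E ->
  measurable_fun setT
    (fun w => \int[lebesgue_measure]_(u in [set u | D (w, u)]) f (w, u))%E.
Proof.
move=> mD mf f0; pose g p : \bar R := if p \in D then f p else 0%E.
have mg : measurable_fun setT g by apply: measurable_if_set.
have g0 p : (0 <= g p)%E by rewrite /g; case: ifP.
rewrite (_ : (fun w => _) = fubini_F lebesgue_measure g); last first.
  apply/funext => w; rewrite [LHS]integral_mkcond; apply: eq_integral => u _.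
  rewrite /g /patch; congr (if _ then _ else _).
exact: measurable_fun_fubini_tonelli_F.
Qed.

Lemma lebesgue_measure_shift (s : R) (A : set R) : measurable A ->
  lebesgue_measure ((fun u => u + s) @^-1` A) = lebesgue_measure A.
Proof.
move=> mA; have ms : measurable_fun setT (fun u : R => (u + s : measurableTypeR R)).
  exact: measurable_funD.
pose m' := measure_function_pushforward__canonical__measure_function_Measure
  (@lebesgue_measure R) ms.
have h X : ocitv X -> lebesgue_measure X = m' X.
  move=> [[a b] _ <-]; rewrite /m' /= /pushforward.
  rewrite (_ : _ @^-1` _ = `]a - s, b - s]%classic); last first.
    by apply/seteqP; split=> u; rewrite /= !in_itv /= ltrBlDr lerBrDr.
  rewrite !lebesgue_measure_itv /= !lte_fin ltrD2r -!EFinB.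
  by rewrite opprB addrA subrK.
exact/esym/(lebesgue_measure_unique h mA).
Qed.

Lemma ge0_integral_shift (s : R) (A : set R) (f : R -> \bar R) : measurable A ->
  measurable_fun setT f -> (forall x, 0 <= f x)%E ->
  (\int[lebesgue_measure]_(u in A) f u =
   \int[lebesgue_measure]_(u in (fun u => u + s)%R @^-1` A) f (u + s)%R)%E.
Proof.
move=> mA mf f0; pose phi : measurableTypeR R -> measurableTypeR R := fun u => u + s.
have ms : measurable_fun setT phi by exact: measurable_funD.
have mfA : measurable_fun A f by exact: measurable_funS mf.
rewrite -[RHS](@ge0_integral_pushforward _ _ _ _ _ phi ms lebesgue_measure A f) //.
apply: eq_measure_integral => B mB _.
by rewrite /= /pushforward lebesgue_measure_shift.
Qed.

End integral_param.

Section survival.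
Context {R : realType} {n : nat} (c : pdmp R n).
Local Notation V := 'rV[R]_n.
Local Notation leb := (@lebesgue_measure R).
Implicit Types (z : V) (s r : R).

(** Clipping the time at 0 makes the function measurable on the whole product through
    [measurable_flow_random_time], which asks for nonnegative times; the hazards integrate over
    nonnegative times. *)
Definition rate_along (p : V * R) : \bar R := (rate c (flow c (Num.max p.2 0) p.1))%:E.

Lemma rate_along_ge0 p : (0 <= rate_along p)%E.
Proof. by rewrite lee_fin rate_ge0. Qed.

Lemma measurable_rate_along : measurable_fun setT rate_along.
Proof.
apply/measurable_EFinP; apply: (measurableT_comp (measurable_rate c)).
apply: measurable_flow_random_time => //.
  by apply: measurable_maxr => //; exact: measurable_snd.
by move=> p; rewrite le_max lexx orbT.
Qed.

Lemma measurable_rate_along1 z : measurable_fun setT (fun u => rate_along (z, u)).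
Proof. by apply: measurableT_comp; [exact: measurable_rate_along|exact: pair1_measurable]. Qed.

Definition hazard s z : \bar R := (\int[leb]_(u in `[0%R, s]) rate_along (z, u))%E.

Lemma survivalE s z : survival c s z = expeR (- hazard s z).
Proof.
congr (expeR (- _)%E); apply: eq_integral => u; rewrite inE /= in_itv /= => /andP[u0 _].
by rewrite /rate_along /= max_l.
Qed.

Lemma hazard_ge0 s z : (0 <= hazard s z)%E.
Proof. by apply: integral_ge0 => u _; exact: rate_along_ge0. Qed.

Lemma measurable_hazard s : measurable_fun setT (hazard s).
Proof.
have mD : measurable [set p : V * R | `[0, s]%classic p.2].
  by apply: measurable_fun_set; [exact: measurable_snd|exact: measurable_itv].
exact: (measurable_integral_param mD measurable_rate_along rate_along_ge0).
Qed.

Lemma hazard0 z : hazard 0 z = 0%E.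
Proof. by rewrite /hazard set_itv1 integral_set1. Qed.

Lemma hazard_split s r z : 0 <= s -> 0 <= r ->
  hazard (s + r) z = (hazard s z + \int[leb]_(u in `]s, (s + r)%R]) rate_along (z, u))%E.
Proof.
move=> s0 r0; rewrite /hazard.
rewrite (_ : `[0, s + r]%classic = `[0, s] `|` `]s, s + r]); last first.
  apply/seteqP; split=> u /=; rewrite !in_itv /=.
    by move=> /andP[u0 usr]; have [us|us] := leP u s; [left; rewrite u0|right].
  by move=> [/andP[u0 us]|/andP[su ->]]; rewrite ?u0 ?andbT; lra.
rewrite ge0_integral_setU //.
- exact: measurable_funS (measurable_rate_along1 z).
- by move=> u _; exact: rate_along_ge0.
- rewrite disj_set2E; apply/eqP/seteqP; split=> u //= [] /=; rewrite !in_itv /=; lra.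
Qed.

Lemma hazardD s r z : 0 <= s -> 0 <= r ->
  hazard (s + r) z = (hazard s z + hazard r (flow c s z))%E.
Proof.
move=> s0 r0; rewrite hazard_split //; congr (_ + _)%E.
rewrite (@ge0_integral_shift _ s) //; last 2 first.
- exact: measurable_rate_along1.
- by move=> u; exact: rate_along_ge0.
rewrite (_ : _ @^-1` _ = `]0, r]%classic); last first.
  by apply/seteqP; split=> u; rewrite /= !in_itv /= ltrDr addrC lerD2l.
rewrite /hazard -integral_itv_obnd_cbnd; last exact: measurable_funS (measurable_rate_along1 _).
apply: eq_integral => u; rewrite inE /= in_itv /= => /andP[u0 _].
by rewrite /rate_along /= !max_l ?addr_ge0 ?(ltW u0) // flowD.
Qed.

Lemma survival_ge0 s z : (0 <= survival c s z)%E.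
Proof. by rewrite survivalE expeR_ge0. Qed.

Lemma survival_le1 s z : (survival c s z <= 1)%E.
Proof. by rewrite survivalE -expeR0 lee_expeR oppe_le0 hazard_ge0. Qed.

Lemma survival0 z : survival c 0 z = 1%E.
Proof. by rewrite survivalE hazard0 oppe0 expeR0. Qed.

Lemma survivalD s r z : 0 <= s -> 0 <= r ->
  survival c (s + r) z = (survival c s z * survival c r (flow c s z))%E.
Proof.
move=> s0 r0; rewrite !survivalE hazardD // -expeRD -oppeD //.
by rewrite ge0_adde_def ?inE ?hazard_ge0.
Qed.

Lemma survival_anti s r z : 0 <= s <= r -> (survival c r z <= survival c s z)%E.
Proof.
move=> /andP[s0 sr]; rewrite -(subrKC s r) survivalD ?subr_ge0 //.
rewrite -[leRHS]mule1; apply: lee_wpmul2l; [exact: survival_ge0|exact: survival_le1].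
Qed.

Lemma measurable_survival s : measurable_fun setT (survival c s).
Proof.
rewrite (_ : survival c s = fun z => expeR (- hazard s z)); last first.
  by apply/funext => z; exact: survivalE.
apply: emeasurable_upper_levels => r.
have [r0|r0] := ltP r 0.
  apply: (@mset_ext _ _ (fun=> True)); last exact: mset_cst.
  by move=> z; split=> // _; rewrite (lt_le_trans _ (expeR_ge0 _)) // lte_fin.
have [y yr] := expeR_total (r0 : (0 <= r%:E)%E).
apply: (@mset_ext _ _ (fun z => (y < - hazard s z)%E)).
  by move=> z; rewrite -yr lte_expeR.
apply: mset_lte => //.
by apply: measurableT_comp => //; exact: measurable_hazard.
Qed.

(* The right-continuous version of s |-> survival s z. The two differ at most
   at the time where the hazard jumps to +oo. *)
Definition survivalr s z : \bar R :=
  ereal_sup (range (fun k : nat => survival c (s + k.+1%:R^-1) z)).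

Lemma survivalr_ge s z k : (survival c (s + k.+1%:R^-1) z <= survivalr s z)%E.
Proof. by apply: ereal_sup_ubound; exists k. Qed.

Lemma survivalr_ge0 s z : (0 <= survivalr s z)%E.
Proof. by apply: le_trans (survivalr_ge s z 0); exact: survival_ge0. Qed.

Lemma survivalr_le1 s z : (survivalr s z <= 1)%E.
Proof. by apply: ge_ereal_sup => _ [k _ <-]; exact: survival_le1. Qed.

Lemma measurable_survivalr s : measurable_fun setT (survivalr s).
Proof.
apply: emeasurable_upper_levels => r.
apply: (@mset_ext _ _ (fun z => exists k : nat, (r%:E < survival c (s + k.+1%:R^-1) z)%E)).
  move=> z; split=> [[k rk]|/ereal_sup_gt[_ [k _ <-] rk]]; last by exists k.
  exact: lt_le_trans rk (survivalr_ge s z k).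
apply: mset_exists => k; apply: mset_lte; first exact: measurable_cst.
exact: measurable_survival.
Qed.

Let inv_gt0 (k : nat) : 0 < k.+1%:R^-1 :> R. Proof. by rewrite invr_gt0. Qed.

(** The first factor is the plain [survival]: the perturbation [k.+1%:R^-1] can be attached to the
    second time, so the supremum passes through the first factor. *)
Lemma survivalrD1 s r z : 0 <= s -> 0 <= r ->
  survivalr (s + r) z = (survival c s z * survivalr r (flow c s z))%E.
Proof.
move=> s0 r0; rewrite -(@fineK _ (survival c s z)); last first.
  by rewrite ge0_fin_numE ?survival_ge0 // (le_lt_trans (survival_le1 _ _)) ?ltry.
rewrite -ereal_supZl; last 2 first.
- by apply/set0P; exists (survival c (r + 0.+1%:R^-1) (flow c s z)); exists 0%N.
- by rewrite fine_ge0 // survival_ge0.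
rewrite fineK; last first.
  by rewrite ge0_fin_numE ?survival_ge0 // (le_lt_trans (survival_le1 _ _)) ?ltry.
rewrite /survivalr; congr ereal_sup; apply/seteqP; split.
  move=> _ [k _ <-]; exists (survival c (r + k.+1%:R^-1) (flow c s z)); first by exists k.
  by rewrite -addrA [RHS]survivalD // addr_ge0 // ltW.
move=> _ [_ [k _ <-] <-]; exists k => //.
by rewrite -addrA [LHS]survivalD // addr_ge0 // ltW.
Qed.

(** The integrals over the sets [A m], which avoid 0, increase to the finite hazard of the whole
    interval; what is left near 0 therefore tends to 0. *)
Lemma hazard_small z k e : (hazard k.+1%:R^-1 z < +oo)%E -> 0 < e ->
  exists m, (hazard m.+1%:R^-1 z < e%:E)%E.
Proof.
move=> hfin e0; set x : R := k.+1%:R^-1 in hfin *.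
have x0 : 0 < x by exact: inv_gt0.
pose A (m : nat) : set (measurableTypeR R) := `]m.+1%:R^-1, x]%classic.
have ndA : nondecreasing_seq A.
  apply/nondecreasing_seqP => m; apply/subsetPset => u; rewrite /A /= !in_itv /=.
  move=> /andP[mu ->]; rewrite andbT (le_lt_trans _ mu) // lef_pV2 ?posrE ?ltr0n //.
  by rewrite ler_nat.
have mA m : measurable (A m) by exact: measurable_itv.
have mfA m : measurable_fun (A m) (fun u => rate_along (z, u)).
  exact: measurable_funS (measurable_rate_along1 z).
have := @ge0_nondecreasing_set_cvg_integral _ (measurableTypeR R) R A
  (fun u => rate_along (z, u)) leb ndA mA mfA (fun _ _ _ => rate_along_ge0 _).
rewrite (_ : \bigcup_i A i = `]0, x]%classic); last first.
  apply/seteqP; split=> u.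
    by move=> [m _]; rewrite /A /= !in_itv /= => /andP[mu ->]; rewrite andbT (lt_trans _ mu).
  rewrite /= in_itv /= => /andP[u0 ux].
  have [m _ /(_ m (leqnn m)) hm] := near_infty_natSinv_lt (PosNum u0).
  by exists m => //; rewrite /A /= in_itv /= hm.
rewrite integral_itv_obnd_cbnd; last exact: measurable_funS (measurable_rate_along1 z).
rewrite -/(hazard x z).
have hK : (fine (hazard x z))%:E = hazard x z by rewrite fineK // ge0_fin_numE // hazard_ge0.
rewrite -{1}hK => /fine_cvgP[_ /cvgrPdist_lt /(_ _ e0) [N _ hN]].
pose m := maxn N k; exists m; have := hN m (leq_maxl _ _) => /= {hN}.
have mx : m.+1%:R^-1 <= x.
  by rewrite lef_pV2 ?posrE ?ltr0n // ler_nat ltnS leq_maxr.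
have split_x : hazard x z = (hazard m.+1%:R^-1 z + \int[leb]_(u in A m) rate_along (z, u))%E.
  have := @hazard_split m.+1%:R^-1 (x - m.+1%:R^-1) z (ltW (inv_gt0 m)).
  by rewrite subr_ge0 subrKC; apply.
have i0 : (0 <= \int[leb]_(u in A m) rate_along (z, u))%E.
  by apply: integral_ge0 => u _; exact: rate_along_ge0.
have := hazard_ge0 m.+1%:R^-1 z.
move: i0 split_x; case: (\int[leb]_(u in A m) _)%E => [i| |] //=; last first.
  by move=> _ hx; move: hfin; rewrite hx addey ?ltxx // gt_eqF // (lt_le_trans _ (hazard_ge0 _ _)) ?ltNy0.
rewrite lee_fin => i0; case: (hazard m.+1%:R^-1 z) => [h| |] //=; last first.
  by move=> hx; move: hfin; rewrite hx addye ?ltxx.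
move=> -> /=; rewrite lee_fin lte_fin => h0; rewrite addrK ger0_norm //.
Qed.

(** Either the hazard is +oo on each of the intervals shrinking to 0, or it tends to 0 there; in the
    second case [expR (- r)] is at least [1 - r]. *)
Lemma survivalr0_01 z : survivalr 0 z = 0%E \/ survivalr 0 z = 1%E.
Proof.
have [[k hk]|h] := pselect (exists k : nat, (hazard k.+1%:R^-1 z < +oo)%E); [right|left].
  apply/eqP; rewrite eq_le survivalr_le1 /=; apply/lee_addgt0Pr => e e0.
  have [m hm] := hazard_small hk e0.
  rewrite -leeBlDr //; apply: le_trans (survivalr_ge 0 z m); rewrite add0r survivalE.
  move: hm (hazard_ge0 m.+1%:R^-1 z); case: (hazard _ _) => [r| |] //=.
  rewrite lte_fin lee_fin -EFinB lee_fin => re r0.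
  by apply: le_trans (expR_ge1Dx _); rewrite lerD2l lerN2 ltW.
apply/eqP; rewrite eq_le survivalr_ge0 andbT; apply: ge_ereal_sup => _ [k _ <-].
rewrite add0r survivalE (_ : hazard _ _ = +oo%E) //.
by apply/eqP; rewrite -leye_eq leNgt; apply/negP => hk; apply: h; exists k.
Qed.

Lemma survivalr_anti0 r z : 0 <= r -> (survivalr r z <= survivalr 0 z)%E.
Proof.
move=> r0; apply: ge_ereal_sup => _ [k _ <-]; apply: le_trans (survivalr_ge 0 z k).
by apply: survival_anti; rewrite add0r lerDr r0 ltW.
Qed.

(** By [survivalrD1] with second time 0, [survivalr s z] is [survival s z] times [survivalr 0] at
    the point reached. That factor is 0 or 1, and if it is 0 both sides vanish. *)
Lemma survivalrD s r z : 0 <= s -> 0 <= r ->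
  survivalr (s + r) z = (survivalr s z * survivalr r (flow c s z))%E.
Proof.
move=> s0 r0; rewrite survivalrD1 // -[s in RHS]addr0 survivalrD1 // -muleA addr0.
congr (_ * _)%E; have [y0|->] := survivalr0_01 (flow c s z); last by rewrite mul1e.
rewrite y0 mul0e; apply/eqP; rewrite eq_le survivalr_ge0 andbT -y0.
exact: survivalr_anti0.
Qed.

(* If v is uniform on [0,1[, then holding_quantile (z, v) has the law of the
   holding time at z. *)
Definition holding_quantile (p : V * R) : \bar R :=
  ereal_sup ([set 0%E] `|` [set s%:E | s in [set s | 0 <= s /\ (p.2%:E < survival c s p.1)%E]]).

Lemma holding_quantile_ge0 p : (0 <= holding_quantile p)%E.
Proof. by apply: ereal_sup_ubound; left. Qed.

(** Right continuity of [survivalr] in time makes both inequalities strict, so the levels [v] whose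
    quantile exceeds [s] are exactly those below [survivalr s z]. *)
Lemma holding_quantile_gt s z v : 0 <= s ->
  (s%:E < holding_quantile (z, v))%E <-> (v%:E < survivalr s z)%E.
Proof.
move=> s0; split.
  move=> /ereal_sup_gt[_ [->|[s' [s'0 h] <-]]]; rewrite lte_fin; first by rewrite ltNge s0.
  move=> ss'.
  have ds : 0 < s' - s by rewrite subr_gt0.
  have [k _ /(_ k (leqnn k)) hk] := near_infty_natSinv_lt (PosNum ds).
  apply: (lt_le_trans h); apply: le_trans (survivalr_ge s z k); apply: survival_anti.
  by rewrite addr_ge0 ?(ltW (inv_gt0 _)) //=; move: hk; rewrite /= ltrBrDl => /ltW.
move=> /ereal_sup_gt[_ [k _ <-] h].
apply: (@lt_le_trans _ _ (s + k.+1%:R^-1)%:E); first by rewrite lte_fin ltrDl.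
by apply: ereal_sup_ubound; right; exists (s + k.+1%:R^-1); rewrite //= addr_ge0 // ltW.
Qed.

Lemma measurable_holding_quantile : measurable_fun setT holding_quantile.
Proof.
apply: emeasurable_upper_levels => s; have [s0|s0] := ltP s 0.
  apply: (@mset_ext _ _ (fun=> True)); last exact: mset_cst.
  by move=> p; split=> // _; rewrite (lt_le_trans _ (holding_quantile_ge0 _)) // lte_fin.
apply: (@mset_ext _ (V * R)%type (fun p => (p.2%:E < survivalr s p.1)%E) (fun p => (s%:E < holding_quantile p)%E)).
  by move=> [z v]; rewrite holding_quantile_gt.
apply: mset_lte; first by apply/measurable_EFinP; exact: measurable_snd.
by apply: measurableT_comp; [exact: measurable_survivalr|exact: measurable_fst].
Qed.

Lemma lebesgue_holding_quantile s z : 0 <= s ->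
  leb [set v | 0 <= v < 1 /\ (s%:E < holding_quantile (z, v))%E] = survivalr s z.
Proof.
move=> s0.
have pK : (fine (survivalr s z))%:E = survivalr s z.
  rewrite fineK // ge0_fin_numE ?survivalr_ge0 //.
  by rewrite (le_lt_trans (survivalr_le1 _ _)) // ltry.
have p0 := survivalr_ge0 s z; have p1 := survivalr_le1 s z.
rewrite -pK !lee_fin in p0 p1; rewrite -pK; set p := fine _ in p0 p1 *.
rewrite (_ : [set v | _] = `[0, p[%classic); last first.
  apply/seteqP; split=> v /=; rewrite in_itv /= holding_quantile_gt // -pK lte_fin.
    by move=> [/andP[-> _] ->].
  by move=> /andP[-> vp]; rewrite vp (lt_le_trans vp).
rewrite lebesgue_measure_itv /= lte_fin; case: ifPn => [_|]; first by rewrite sube0.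
by rewrite -leNgt => ple; congr EFin; apply/eqP; rewrite eq_le p0.
Qed.

End survival.

Section holding_time_law.
Context {R : realType} {n : nat} (c : pdmp R n).
Local Notation V := 'rV[R]_n.
Local Notation leb := (@lebesgue_measure R).
Context {d d'} {T : measurableType d} {E : measurableType d'} (P : probability T R).
Variables (eta : T -> E) (x : E -> V) (theta : T -> \bar R).
Hypotheses (meta : measurable_fun setT eta) (mx : measurable_fun setT x).
Hypotheses (mtheta : measurable_fun setT theta) (theta0 : forall w, (0 <= theta w)%E).
Hypothesis thetaP : forall D s, measurable D -> 0 <= s ->
  P (eta @^-1` D `&` [set w | (s%:E < theta w)%E]) =
  (\int[P]_(w in eta @^-1` D) survivalr c s (x (eta w)))%E.

Let TR : measurableType _ := (T * measurableTypeR R)%type.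
Let PL : {measure set TR -> \bar R} := (P \x leb)%E.
Let G2 : set TR := [set p | 0 <= p.2 < 1].
Let eta2 (p : TR) := eta p.1.
Let q2 (p : TR) := holding_quantile c (x (eta p.1), p.2).

Let mG2 : measurable G2.
Proof.
apply: (@mset_ext _ TR (fun p => 0 <= p.2 /\ p.2 < 1)).
  by move=> p; split=> [[-> ->]|/andP].
by apply: mset_and; [apply: mset_ler|apply: mset_ltr] => //; exact: measurable_snd.
Qed.

Let meta2 : measurable_fun setT eta2.
Proof. by apply: measurableT_comp => //; exact: measurable_fst. Qed.

Let mq2 : measurable_fun setT q2.
Proof.
apply: (measurableT_comp (measurable_holding_quantile c)).
apply: measurable_fun_pair; last exact: measurable_snd.
by apply: measurableT_comp => //; exact: meta2.
Qed.

Let mD D : measurable D -> measurable (eta @^-1` D).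
Proof. by move=> mD; exact: measurable_fun_set. Qed.

Let PLE (Q : TR -> Prop) : measurable [set p | Q p] ->
  PL [set p | Q p] = (\int[P]_w leb [set v | Q (w, v)])%E.
Proof.
move=> mQ; rewrite /PL /product_measure1; apply: eq_integral => w _ /=.
by congr (leb _); apply/seteqP; split=> v; rewrite /xsection /= inE.
Qed.

Let PLD D (Q : TR -> Prop) : measurable D -> measurable [set p | Q p] ->
  PL [set p | G2 p /\ D (eta2 p) /\ Q p] =
  (\int[P]_(w in eta @^-1` D) leb [set v : R | (0 <= v < 1)%R /\ Q (w, v)])%E.
Proof.
move=> mD' mQ; rewrite PLE; last first.
  by do 2 (apply: mset_and => //); exact: measurable_fun_set.
rewrite [RHS]integral_mkcond; apply: eq_integral => w _; rewrite patchE.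
have [h|h] := boolP (w \in _).
  congr (leb _); apply/seteqP; split=> v /=; first by move=> [? []].
  by move=> [? ?]; split=> //; split=> //; move/set_mem: h.
rewrite (_ : [set v | _] = set0) ?measure0 //; apply/seteqP; split=> v //= -[_ [Dw _]].
by move/negP: h; apply; apply/mem_set.
Qed.

Let leb01 : leb [set v | 0 <= v < 1] = 1%E.
Proof.
rewrite (_ : [set v | _] = `[0, 1[%classic); last first.
  by apply/seteqP; split=> v /=; rewrite in_itv.
by rewrite lebesgue_measure_itv /= lte_fin ltr01 sube0.
Qed.

Let PL_fst D : measurable D -> PL [set p | G2 p /\ D (eta2 p)] = P (eta @^-1` D).
Proof.
move=> mD'; rewrite (_ : [set p | _] = [set p | G2 p /\ D (eta2 p) /\ True]); last first.
  by apply/seteqP; split=> p /=; tauto.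
rewrite PLD //; last exact: mset_cst.
rewrite (eq_integral (cst 1%E)); last first.
  move=> w _; rewrite (_ : [set v | _] = [set v | 0 <= v < 1]) ?leb01 //.
  by apply/seteqP; split=> v /=; tauto.
by rewrite integral_cst ?mul1e //; exact: mD.
Qed.

(** The pair of past and holding time has the law of the past together with a quantile at an
    independent uniform level. On half-lines this is the hypothesis [thetaP]. *)
Let holding_agree B : measurable B ->
  agree_on P PL 1 setT (fun w => (eta w, theta w)) G2 (fun p => (eta2 p, q2 p)) B.
Proof.
have PT : (P setT < +oo)%E by rewrite probability_setT ltry.
apply: (agree_prod ler01 measurableT mG2 PT meta meta2 mtheta mq2).
move=> D B' mD' mB'.
have mDG : measurable [set p | G2 p /\ D (eta2 p)].
  by apply: mset_and => //; exact: measurable_fun_set.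
have := @agree_ereal _ _ _ T TR P PL 1 (eta @^-1` D) [set p | G2 p /\ D (eta2 p)]
  ler01 (mD mD') mDG _ theta q2 mtheta mq2 _ _ B' mB'.
rewrite /agree_on !setTI (_ : G2 `&` _ = [set p | G2 p /\ D (eta2 p)] `&` q2 @^-1` B'); last first.
  by apply/seteqP; split=> p /=; tauto.
apply.
- by apply: le_lt_trans (probability_le1 P (mD mD')) _; rewrite ltry.
- by rewrite mul1e PL_fst.
- move=> s; rewrite mul1e; have [s0|s0] := ltP s 0.
    rewrite (_ : _ `&` _ = eta @^-1` D); last first.
      by rewrite setIidl // => w _ /=; rewrite (lt_le_trans _ (theta0 w)) // lte_fin.
    rewrite (_ : [set p | _] `&` _ = [set p | G2 p /\ D (eta2 p)]) ?PL_fst //.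
    by rewrite setIidl // => p _ /=; rewrite (lt_le_trans _ (holding_quantile_ge0 _ _)) // lte_fin.
  etransitivity; first exact: (thetaP mD' s0).
  rewrite (_ : [set p | _] `&` _ = [set p | G2 p /\ D (eta2 p) /\ (s%:E < q2 p)%E]); last first.
    by apply/seteqP; split=> p /=; tauto.
  rewrite PLD //; last by apply: mset_lte; [exact: measurable_cst|exact: mq2].
  apply: eq_integral => w _; apply/esym.
  exact: (lebesgue_holding_quantile c (x (eta w)) s0).
Qed.

(** [thetaP] concerns constant times; here the threshold [S] depends on the past. With the holding
    time replaced by a quantile, Fubini freezes the past and the threshold becomes constant. *)
Lemma holding_time_integral D (S : E -> R) (psi : E -> \bar R) :
  measurable D -> measurable_fun setT S -> (forall e, 0 <= S e) ->
  measurable_fun setT psi -> (forall e, 0 <= psi e)%E ->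
  (\int[P]_(w in eta @^-1` D `&` [set w | ((S (eta w))%:E < theta w)%E]) psi (eta w) =
   \int[P]_(w in eta @^-1` D) (psi (eta w) * survivalr c (S (eta w)) (x (eta w))))%E.
Proof.
move=> mD' mS S0 mpsi psi0.
pose A : set (E * \bar R) := [set p | D p.1 /\ ((S p.1)%:E < p.2)%E].
have mA : measurable A.
  apply: mset_and; first by apply: measurable_fun_set => //; exact: measurable_fst.
  apply: mset_lte; last exact: measurable_snd.
  by apply/measurable_EFinP; apply: measurableT_comp => //; exact: measurable_fst.
pose phi (p : E * \bar R) : \bar R := if p \in A then psi p.1 else 0%E.
have mphi : measurable_fun setT phi.
  by apply: measurable_if_set => //; apply: measurableT_comp => //; exact: measurable_fst.
have phi0 p : (0 <= phi p)%E by rewrite /phi; case: ifP.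
have := agree_integral ler01 measurableT mG2 (measurable_fun_pair meta mtheta)
  (measurable_fun_pair meta2 mq2) holding_agree mphi phi0.
rewrite mul1e => agr.
transitivity (\int[P]_w phi (eta w, theta w))%E.
  rewrite [LHS]integral_mkcond; apply: eq_integral => w _.
  by rewrite /phi /patch; congr (if _ then _ else _); apply/idP/idP => /set_mem ?; apply/mem_set.
rewrite {}agr integral_mkcond.
pose g (p : TR) := if p \in G2 then phi (eta2 p, q2 p) else 0%E.
have mg : measurable_fun setT g.
  by apply: measurable_if_set => //; apply: measurableT_comp => //; exact: measurable_fun_pair.
have g0 p : (0 <= g p)%E by rewrite /g; case: ifP.
rewrite [LHS](@fubini_tonelli1 _ _ T (measurableTypeR R) R P leb g mg g0).
rewrite [RHS]integral_mkcond; apply: eq_integral => w _; rewrite /fubini_F patchE.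
have [h|h] := boolP (w \in _); last first.
  rewrite integral0_eq // => v _; rewrite /g; case: ifP => // _.
  rewrite /phi ifN //; apply: contraNN h => /set_mem[/= ? _]; exact/mem_set.
move/set_mem: h => /= h.
pose B : set (measurableTypeR R) :=
  [set v | 0 <= v < 1 /\ ((S (eta w))%:E < holding_quantile c (x (eta w), v))%E].
have mB : measurable B.
  have mq : measurable_fun setT (fun v : measurableTypeR R => holding_quantile c (x (eta w), v)).
    by apply: measurableT_comp; [exact: measurable_holding_quantile|exact: pair1_measurable].
  apply: mset_and; last by apply: mset_lte; [exact: measurable_cst|exact: mq].
  apply: (@mset_ext _ (measurableTypeR R) (fun v => 0 <= v /\ v < 1)).
    by move=> v; split=> [[-> ->]|/andP].
  by apply: mset_and; [apply: mset_ler|apply: mset_ltr].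
rewrite -(lebesgue_holding_quantile c (x (eta w)) (S0 _)).
transitivity (\int[leb]_(v in B) cst (psi (eta w)) v)%E; last by rewrite integral_cst.
rewrite [RHS]integral_mkcond; apply: eq_integral => v _; rewrite /g /phi patchE /=.
have [hB|hB] := boolP (v \in B).
  have [h1 h2] := set_mem hB.
  by rewrite mem_set // mem_set.
case: ifP => // /set_mem h1; case: ifP => // /set_mem [_ h2].
by move/negP: hB; case; apply/mem_set; split.
Qed.

End holding_time_law.

Section measurable_paths.
Context {R : realType} {n : nat} (c : pdmp R n) (W : set 'rV[R]_n) (oW : open W).
Local Notation V := 'rV[R]_n.
Local Notation hit := (exit_time W (flow c)).

Lemma flow_piecewise_flow z : piecewise_flow c (fun t => flow c t z).
Proof. by move=> t t0; left; exists 1 => // u _; rewrite -flowD subrK. Qed.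

Lemma measurable_hit : measurable_fun setT hit.
Proof.
apply: (measurable_exit_time (c := c)) => //; last exact: flow_piecewise_flow.
by move=> t _; exact: measurable_flow.
Qed.

Lemma measurable_hit_pos : measurable_fun setT (exit_pos W (flow c)).
Proof.
apply: (measurable_exit_pos (c := c)) => //; last exact: flow_piecewise_flow.
by move=> t _; exact: measurable_flow.
Qed.

Context {d} {T : measurableType d} (xi : nat -> T -> V) (theta : nat -> T -> \bar R).

Lemma measurable_jump_time k : (forall i, (i < k)%N -> measurable_fun setT (theta i)) ->
  measurable_fun setT (jump_time theta k).
Proof. by move=> m; apply: emeasurable_sum => i; exact: m (ltn_ord i). Qed.

Lemma measurable_legs_survived k :
  (forall i, (i < k)%N -> measurable_fun setT (xi i)) ->
  (forall i, (i < k)%N -> measurable_fun setT (theta i)) ->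
  measurable [set w | legs_survived c xi theta w W k].
Proof.
move=> mx mt; apply: mset_forall => i; have [ik|ik] := ltnP i k; last first.
  by apply: (@mset_ext _ _ (fun=> True)) => [w|]; [split|exact: mset_cst].
apply: mset_imply; first exact: mset_cst.
apply: mset_and; first by apply: mset_lte; [exact: mt|exact: measurable_cst].
apply: mset_lee; first exact: mt.
by apply: measurableT_comp; [exact: measurable_hit|exact: mx].
Qed.

Hypothesis mxi : forall i, measurable_fun setT (xi i).
Hypothesis mtheta : forall i, measurable_fun setT (theta i).

Lemma measurable_on_leg k t : measurable [set w | on_leg theta w k t].
Proof.
apply: (@mset_ext _ _ (fun w =>
    (jump_time theta k w <= t%:E)%E /\ (t%:E < jump_time theta k.+1 w)%E)).
  by move=> w; split=> [[h1 h2]|/andP//]; apply/andP.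
by apply: mset_and; [apply: mset_lee|apply: mset_lte] => //; exact: measurable_jump_time.
Qed.

Lemma measurable_exits_on_leg k : measurable [set w | exits_on_leg c xi theta w W k].
Proof.
apply: mset_and; first exact: measurable_legs_survived.
by apply: mset_lte => //; apply: measurableT_comp => //; exact: measurable_hit.
Qed.

Hypothesis theta_ge0 : forall i w, (0 <= theta i w)%E.

Lemma measurable_path t : measurable_fun setT (pdmp_path c xi theta t).
Proof.
move=> _ B mB; rewrite setTI.
apply: (@mset_ext _ _ (fun w =>
  (exists k, on_leg theta w k t /\
     B (flow c (Num.max (t - fine (jump_time theta k w)) 0) (xi k w))) \/
  (~ (exists k, on_leg theta w k t) /\ B 0))).
  move=> w; have t0w k := theta_ge0 k w.
  have legE k : on_leg theta w k t ->
      flow c (Num.max (t - fine (jump_time theta k w)) 0) (xi k w) = pdmp_path c xi theta t w.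
    move=> h; rewrite (on_leg_path _ _ t0w h) max_l // subr_ge0 -lee_fin.
    by have /andP[h1 _] := h; rewrite (jump_time_fineK t0w h1).
  split=> [[[k [h1 h2]]|[h1 h2]]|h].
  - by rewrite /preimage /= -(legE k h1).
  - by rewrite /preimage /= no_leg_path // => k hk; apply: h1; exists k.
  - have [[k hk]|h1] := pselect (exists k, on_leg theta w k t).
      by left; exists k; split=> //; rewrite legE.
    by right; split=> //; move: h; rewrite /= no_leg_path // => k hk; apply: h1; exists k.
apply: mset_or.
  apply: mset_exists => k; apply: mset_and; first exact: measurable_on_leg.
  apply: (@measurable_fun_set _ _ _ _ (fun w =>
    flow c (Num.max (t - fine (jump_time theta k w)) 0) (xi k w))) => //.
  apply: measurable_flow_random_time => //; last by move=> w; rewrite le_max lexx orbT.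
  apply: measurable_maxr => //; apply: measurable_funB => //.
  by apply: measurableT_comp => //; exact: measurable_jump_time.
apply: mset_and; last exact: mset_cst.
by apply: mset_not; apply: mset_exists => k; exact: measurable_on_leg.
Qed.

End measurable_paths.

Section histories.
Context {R : realType} {n : nat} {d} {T : measurableType d}.
Local Notation V := 'rV[R]_n.
Variables (xi : nat -> T -> V) (theta : nat -> T -> \bar R).

Definition history_gen (m k : nat) : set (set T) :=
  preimages [set i | (i <= m)%N] xi `|` preimages [set i | (i < k)%N] theta.

(** The set [T] with the events of the past as measurable sets, so that the general measurability
    lemmas also prove that an event belongs to the past. *)
Definition history_space m k : measurableType (sigma_display (history_gen m k)) :=
  g_sigma_algebraType (history_gen m k).

Lemma historyE m k (H : set T) :
  history xi theta m k H = measurable (H : set (history_space m k)).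
Proof. by []. Qed.

Lemma history_xi m k i : (i <= m)%N ->
  measurable_fun [set: history_space m k] (xi i : history_space m k -> V).
Proof.
by move=> im _ B mB; apply: sub_sigma_algebra; left; exists i => //; exists B.
Qed.

Lemma history_theta m k i : (i < k)%N ->
  measurable_fun [set: history_space m k] (theta i : history_space m k -> \bar R).
Proof.
by move=> ik _ B mB; apply: sub_sigma_algebra; right; exists i => //; exists B.
Qed.

Hypothesis mxi : forall i, measurable_fun setT (xi i).
Hypothesis mtheta : forall i, measurable_fun setT (theta i).

Lemma history_measurable m k H : history xi theta m k H -> measurable H.
Proof.
apply: (smallest_sub (sigma_algebra_measurable T)).
by move=> _ [|] [i _ [B mB <-]]; [exact: mxi|exact: mtheta].
Qed.

Lemma measurable_history_space m k :
  measurable_fun setT (id : T -> history_space m k).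
Proof. by move=> _ H mH; rewrite setTI; exact: history_measurable mH. Qed.

End histories.

(** * The Markov property at a fixed time *)

Section runs.
Context {R : realType} {n : nat} (c : pdmp R n).
Local Notation V := 'rV[R]_n.

(* A skeleton observed on the event G0 only, with the right-continuous
   survival function. Unlike [pdmp_skeleton], this is stable under restarting
   the process at a fixed time on the event that it has not exited yet. *)
Record run {d} {T : measurableType d} (P : probability T R) (G0 : set T)
    (xi : nat -> T -> V) (theta : nat -> T -> \bar R) : Prop := Run {
  run_event : measurable G0;
  run_xi : forall k, measurable_fun setT (xi k);
  run_theta : forall k, measurable_fun setT (theta k);
  run_ge0 : forall k w, (0 <= theta k w)%E;
  run_theta_law : forall k s H, 0 <= s -> history xi theta k k H ->
    P (G0 `&` H `&` [set w | (s%:E < theta k w)%E]) =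
    (\int[P]_(w in G0 `&` H) survivalr c s (xi k w))%E;
  run_xi_law : forall k B H, measurable B -> history xi theta k k.+1 H ->
    P (G0 `&` H `&` [set w | (theta k w < +oo)%E] `&` xi k.+1 @^-1` B) =
    (\int[P]_(w in G0 `&` H `&` [set w | (theta k w < +oo)%E])
       jump c (flow c (fine (theta k w)) (xi k w)) B)%E
}.

(** The tail of [theta k] is right-continuous whereas [survival] need not be. Letting the times
    [s + i.+1%:R^-1] decrease to [s] on both sides of [theta_law] replaces [survival] by
    [survivalr]. *)
Lemma run_of_skeleton {d} {T : measurableType d} (P : probability T R) xi theta nu :
  pdmp_skeleton c P xi theta nu -> run P setT xi theta.
Proof.
case=> mxi mtheta t0 _ tlaw xlaw; split=> // [k s H s0 hH|k B H mB hH]; last first.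
  by rewrite !setTI; exact: xlaw.
rewrite !setTI; have mH : measurable H := history_measurable mxi mtheta hH.
have inv_gt0 (i : nat) : 0 < i.+1%:R^-1 :> R by rewrite invr_gt0.
pose A (i : nat) := H `&` [set w | ((s + i.+1%:R^-1)%:E < theta k w)%E].
have mA i : measurable (A i).
  by apply: measurableI => //; apply: mset_lte => //; exact: measurable_cst.
have AE : H `&` [set w | (s%:E < theta k w)%E] = \bigcup_i A i.
  apply/seteqP; split=> [w [Hw /= sw]|w [i _ [Hw /= sw]]]; last first.
    by split=> //=; apply: lt_trans sw; rewrite lte_fin ltrDl.
  have [i hi] : exists i : nat, ((s + i.+1%:R^-1)%:E < theta k w)%E.
    move: sw; case: (theta k w) => [r| |] //; last by move=> _; exists 0%N; rewrite ltry.
    rewrite lte_fin => sr; have ds : 0 < r - s by rewrite subr_gt0.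
    have [i _ /(_ i (leqnn i)) hi] := near_infty_natSinv_lt (PosNum ds).
    by exists i; move: hi; rewrite lte_fin /= ltrBrDl.
  by exists i.
have decr i j : (i <= j)%N -> s + j.+1%:R^-1 <= s + i.+1%:R^-1.
  by move=> ij; rewrite lerD2l lef_pV2 ?posrE ?ltr0n // ler_nat.
have ndA : nondecreasing_seq A.
  move=> i j ij; apply/subsetPset => w [Hw /= h]; split=> //=.
  by apply: le_lt_trans h; rewrite lee_fin decr.
have cv1 : (P \o A) i @[i --> \oo] --> P (\bigcup_i A i).
  exact: (nondecreasing_cvg_mu mA (bigcup_measurable (fun i _ => mA i)) ndA).
rewrite AE; apply: (cvg_unique _ cv1) => //.
have -> : (\int[P]_(w in H) survivalr c s (xi k w))%E =
    (\int[P]_(w in H) limn (fun i => survival c (s + i.+1%:R^-1) (xi k w)))%E.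
  apply: eq_integral => w _; apply/esym/cvg_lim => //.
  apply/ereal_nondecreasing_cvgn => i j ij.
  by apply: survival_anti; rewrite decr // addr_ge0 // ltW.
rewrite (_ : _ \o _ = fun i => (\int[P]_(w in H) survival c (s + i.+1%:R^-1) (xi k w))%E); last first.
  by apply/funext => i; rewrite /= tlaw // addr_ge0 // ltW.
apply: cvg_monotone_convergence => //.
- move=> i; apply: measurable_funTS; apply: measurableT_comp => //; exact: measurable_survival.
- by move=> i w _; exact: survival_ge0.
- by move=> w _ i j ij; apply: survival_anti; rewrite decr // addr_ge0 // ltW.
Qed.

End runs.

(** * The law at exit of a run is determined by its initial law *)

Section run_uniqueness.
Context {R : realType} {n : nat} (c : pdmp R n) (W : set 'rV[R]_n) (oW : open W).
Local Notation V := 'rV[R]_n.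
Local Notation hit := (exit_time W (flow c)).
Local Notation legs X Th k := [set w | legs_survived c X Th w W k].
Local Notation start_time Th k := (fun w => fine (jump_time Th k w)).

Section one_run.
Context {d} {T : measurableType d} (P : probability T R) (G0 : set T)
  (X : nat -> T -> V) (Th : nat -> T -> \bar R).
Hypothesis hrun : run c P G0 X Th.
Let mX := run_xi hrun.
Let mTh := run_theta hrun.
Let Th0 := run_ge0 hrun.

Lemma history_legs k m i : (m <= i)%N -> (m <= k.+1)%N ->
  history X Th k i (legs X Th m).
Proof.
move=> mi mk; rewrite historyE.
apply: (@measurable_legs_survived _ _ c W oW _ (history_space X Th k i)) => j jm.
  by apply: history_xi; rewrite -ltnS (leq_trans jm).
by apply: history_theta; rewrite (leq_trans jm).
Qed.

Lemma history_start_time k m i : (m <= i)%N ->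
  measurable_fun [set: history_space X Th k i]
    (start_time Th m : history_space X Th k i -> R).
Proof.
move=> mi; apply: measurableT_comp => //.
apply: (@measurable_jump_time _ _ (history_space X Th k i)) => j jm.
by apply: history_theta; rewrite (leq_trans jm).
Qed.

Lemma measurable_start_time k : measurable_fun setT (start_time Th k).
Proof. by apply: measurableT_comp => //; exact: measurable_jump_time. Qed.

Lemma measurable_legs k : measurable (legs X Th k).
Proof. by apply: measurable_legs_survived. Qed.

Lemma legs_lty k w : legs_survived c X Th w W k -> (jump_time Th k w < +oo)%E.
Proof. by move=> h; exact: legs_survived_jump_time h. Qed.

Lemma start_timeS k w : legs_survived c X Th w W k -> (Th k w < +oo)%E ->
  fine (jump_time Th k.+1 w) = fine (jump_time Th k w) + fine (Th k w).
Proof.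
move=> hl ht; rewrite jump_timeS fineD // ge0_fin_numE //; first exact: legs_lty hl.
by apply: jump_time_ge0 => i; exact: Th0.
Qed.

Lemma legs_survivedS k w : legs_survived c X Th w W k.+1 <->
  legs_survived c X Th w W k /\ (Th k w < +oo)%E /\ (Th k w <= hit (X k w))%E.
Proof.
split=> [h|[h hk] i]; last by rewrite ltnS leq_eqVlt => /predU1P[->|/h].
by split=> [i ik|]; apply: h => //; rewrite ltnS ltnW.
Qed.

End one_run.

Context {d1 d2} {T1 : measurableType d1} {T2 : measurableType d2}
  (P1 : probability T1 R) (P2 : probability T2 R) (G1 : set T1) (G2 : set T2)
  (X1 : nat -> T1 -> V) (X2 : nat -> T2 -> V)
  (Th1 : nat -> T1 -> \bar R) (Th2 : nat -> T2 -> \bar R).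
Hypotheses (run1 : run c P1 G1 X1 Th1) (run2 : run c P2 G2 X2 Th2).
Variables (a : R) (a0 : 0 <= a).
Hypothesis init : forall B, measurable B ->
  P1 (G1 `&` X1 0%N @^-1` B) = (a%:E * P2 (G2 `&` X2 0%N @^-1` B))%E.

Let E1 k := G1 `&` legs X1 Th1 k.
Let E2 k := G2 `&` legs X2 Th2 k.
Let p1 k w := (start_time Th1 k w, X1 k w).
Let p2 k w := (start_time Th2 k w, X2 k w).

Let mE1 k : measurable (E1 k).
Proof. by apply: measurableI; [exact: run_event run1|exact: measurable_legs run1 k]. Qed.
Let mE2 k : measurable (E2 k).
Proof. by apply: measurableI; [exact: run_event run2|exact: measurable_legs run2 k]. Qed.
Let mp1 k : measurable_fun setT (p1 k).
Proof. by apply: measurable_fun_pair; [exact: measurable_start_time run1 k|exact: run_xi run1 k]. Qed.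
Let mp2 k : measurable_fun setT (p2 k).
Proof. by apply: measurable_fun_pair; [exact: measurable_start_time run2 k|exact: run_xi run2 k]. Qed.
Let P1_lty A : measurable A -> (P1 A < +oo)%E.
Proof. by move=> mA; rewrite (le_lt_trans (probability_le1 _ mA)) ?ltry. Qed.

(** The induction alternates between the start of a leg and the leg with its holding time. Start
    time and start position are all that later legs and the exit read of the past. *)
Definition same_start k := forall B, measurable B ->
  agree_on P1 P2 a (E1 k) (p1 k) (E2 k) (p2 k) B.

Definition same_leg k := forall B, measurable B ->
  agree_on P1 P2 a (E1 k) (fun w => (p1 k w, Th1 k w)) (E2 k) (fun w => (p2 k w, Th2 k w)) B.

Lemma same_leg_start k : same_start k -> same_leg k.
Proof.
move=> hs; apply: (agree_prod a0 (mE1 k) (mE2 k)) => //.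
- exact: P1_lty.
- exact: run_theta run1 k.
- exact: run_theta run2 k.
move=> D B mD mB.
have mD1 : measurable [set w | D (p1 k w)] by exact: measurable_fun_set.
have mD2 : measurable [set w | D (p2 k w)] by exact: measurable_fun_set.
have := @agree_ereal _ _ _ T1 T2 P1 P2 a (E1 k `&` [set w | D (p1 k w)])
  (E2 k `&` [set w | D (p2 k w)]) a0 (measurableI _ _ (mE1 k) mD1)
  (measurableI _ _ (mE2 k) mD2) (P1_lty (measurableI _ _ (mE1 k) mD1))
  (Th1 k) (Th2 k) (run_theta run1 k) (run_theta run2 k) (hs D mD) _ B mB.
rewrite /agree_on -!setIA; apply => s.
have [s0|s0] := ltP s 0.
  rewrite (_ : [set w | (s%:E < Th1 k w)%E] = setT); last first.
    by apply/seteqP; split=> // w _ /=; rewrite (lt_le_trans _ (run_ge0 run1 k w)) // lte_fin.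
  rewrite (_ : [set w | (s%:E < Th2 k w)%E] = setT); last first.
    by apply/seteqP; split=> // w _ /=; rewrite (lt_le_trans _ (run_ge0 run2 k w)) // lte_fin.
  by rewrite !setIT !setIA; exact: (hs D mD).
have hist1 : history X1 Th1 k k (legs X1 Th1 k `&` [set w | D (p1 k w)]).
  rewrite historyE; apply: measurableI; first by apply: history_legs.
  apply: (@measurable_fun_set _ _ (history_space X1 Th1 k k) _ (p1 k)) => //.
  apply: measurable_fun_pair; first exact: history_start_time.
  exact: history_xi.
have hist2 : history X2 Th2 k k (legs X2 Th2 k `&` [set w | D (p2 k w)]).
  rewrite historyE; apply: measurableI; first by apply: history_legs.
  apply: (@measurable_fun_set _ _ (history_space X2 Th2 k k) _ (p2 k)) => //.
  apply: measurable_fun_pair; first exact: history_start_time.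
  exact: history_xi.
have r1 := run_theta_law run1 s0 hist1; have r2 := run_theta_law run2 s0 hist2.
rewrite /E1 /E2 !setIA in r1 r2 *.
transitivity (a%:E * \int[P2]_(w in G2 `&` legs X2 Th2 k `&` [set w | D (p2 k w)])
  survivalr c s (X2 k w))%E; last by congr (_ * _)%E; exact/esym.
etransitivity; first exact: r1.
(* Both runs integrate the same function of the start of the leg, so agreement at the start
   transfers to the holding time. *)
pose phi (p : R * V) := if p \in D then survivalr c s p.2 else 0%E.
have mphi : measurable_fun setT phi.
  apply: measurable_if_set => //; apply: measurableT_comp; last exact: measurable_snd.
  exact: measurable_survivalr.
have phi0 p : (0 <= phi p)%E by rewrite /phi; case: ifP => // _; exact: survivalr_ge0.
have := agree_integral a0 (mE1 k) (mE2 k) (mp1 k) (mp2 k) hs mphi phi0.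
by rewrite !integral_mkcondr.
Qed.

(** The law of the next position is the integral of one and the same function of leg [k] for both
    runs, and on that leg they agree. *)
Lemma same_start_next k : same_leg k -> same_start k.+1.
Proof.
move=> hl; have mX1 := run_xi run1; have mX2 := run_xi run2.
have mT1 := run_theta run1; have mT2 := run_theta run2.
apply: (agree_prod a0 (mE1 k.+1) (mE2 k.+1)) => //.
- exact: P1_lty.
- exact: measurable_start_time run1 k.+1.
- exact: measurable_start_time run2 k.+1.
move=> A B mA mB.
have E1S : E1 k.+1 `&` [set w | A (start_time Th1 k.+1 w) /\ B (X1 k.+1 w)] =
    G1 `&` (legs X1 Th1 k.+1 `&` [set w | A (start_time Th1 k.+1 w)]) `&`
    [set w | (Th1 k w < +oo)%E] `&` X1 k.+1 @^-1` B.
  apply/seteqP; split=> w /=; rewrite /E1 /=; last by tauto.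
  by move=> [[? hw] [? ?]]; have [_ []] := (legs_survivedS _ _ _ w).1 hw; tauto.
have E2S : E2 k.+1 `&` [set w | A (start_time Th2 k.+1 w) /\ B (X2 k.+1 w)] =
    G2 `&` (legs X2 Th2 k.+1 `&` [set w | A (start_time Th2 k.+1 w)]) `&`
    [set w | (Th2 k w < +oo)%E] `&` X2 k.+1 @^-1` B.
  apply/seteqP; split=> w /=; rewrite /E2 /=; last by tauto.
  by move=> [[? hw] [? ?]]; have [_ []] := (legs_survivedS _ _ _ w).1 hw; tauto.
have hist1 : history X1 Th1 k k.+1 (legs X1 Th1 k.+1 `&` [set w | A (start_time Th1 k.+1 w)]).
  rewrite historyE; apply: measurableI; first by apply: history_legs.
  apply: (@measurable_fun_set _ _ (history_space X1 Th1 k k.+1) _ (start_time Th1 k.+1)) => //.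
  exact: history_start_time.
have hist2 : history X2 Th2 k k.+1 (legs X2 Th2 k.+1 `&` [set w | A (start_time Th2 k.+1 w)]).
  rewrite historyE; apply: measurableI; first by apply: history_legs.
  apply: (@measurable_fun_set _ _ (history_space X2 Th2 k k.+1) _ (start_time Th2 k.+1)) => //.
  exact: history_start_time.
rewrite {}E1S {}E2S; apply: (etrans (run_xi_law run1 mB hist1)).
apply: (etrans _ (esym (congr1 (fun y => a%:E * y)%E (run_xi_law run2 mB hist2)))).
(* In terms of leg [k]: it ends by a jump, no later than the flow leaves [W], and the jump falls in
   [A]. *)
pose D : set (R * V * \bar R) := [set q | ((q.2 < +oo)%E /\ (q.2 <= hit q.1.2)%E) /\
  A (q.1.1 + fine q.2)].
have mD : measurable D.
  have m2 : measurable_fun setT (snd : R * V * \bar R -> \bar R) by exact: measurable_snd.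
  have m11 : measurable_fun setT (fun q : R * V * \bar R => q.1.1).
    by apply: measurableT_comp; exact: measurable_fst.
  have m12 : measurable_fun setT (fun q : R * V * \bar R => q.1.2).
    by apply: measurableT_comp; [exact: measurable_snd|exact: measurable_fst].
  apply: mset_and; first apply: mset_and.
  - by apply: mset_lte => //; exact: measurable_cst.
  - by apply: mset_lee => //; apply: measurableT_comp => //; exact: measurable_hit.
  - apply: (@measurable_fun_set _ _ _ _ (fun q : R * V * \bar R => q.1.1 + fine q.2)) => //.
    by apply: measurable_funD => //; exact: measurableT_comp.
pose phi (q : R * V * \bar R) :=
  if q \in D then jump c (flow c (Num.max (fine q.2) 0) q.1.2) B else 0%E.
have mphi : measurable_fun setT phi.
  apply: measurable_if_set => //.
  apply: (measurableT_comp (measurable_kernel (jump c) B mB)).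
  apply: measurable_flow_random_time.
  - by apply: measurable_maxr => //; apply: measurableT_comp => //; exact: measurable_snd.
  - by apply: measurableT_comp; [exact: measurable_snd|exact: measurable_fst].
  - by move=> q; rewrite le_max lexx orbT.
have phi0 q : (0 <= phi q)%E by rewrite /phi; case: ifP.
have agr := agree_integral a0 (mE1 k) (mE2 k) (measurable_fun_pair (mp1 k) (mT1 k))
  (measurable_fun_pair (mp2 k) (mT2 k)) hl mphi phi0.
have step d (T : measurableType d) (P : probability T R) G0 X Th (hr : run c P G0 X Th) :
   (\int[P]_(w in G0 `&` (legs X Th k.+1 `&` [set w | A (start_time Th k.+1 w)]) `&`
      [set w | (Th k w < +oo)%E]) jump c (flow c (fine (Th k w)) (X k w)) B =
    \int[P]_(w in G0 `&` legs X Th k) phi (start_time Th k w, X k w, Th k w))%E.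
  rewrite (_ : G0 `&` _ `&` _ = (G0 `&` legs X Th k) `&`
      [set w | D (start_time Th k w, X k w, Th k w)]).
    rewrite integral_mkcondr; apply: eq_integral => w _; rewrite /patch /phi.
    rewrite /= max_l //; exact: fine_ge0 (run_ge0 hr k w).
  apply/seteqP; split=> w /=.
    move=> [[g [h1 h2]] h3]; have [l1 [_ l3]] := (legs_survivedS _ _ _ w).1 h1.
    by do !split=> //=; rewrite -(start_timeS hr l1).
  move=> [[g l1] [[l2 l3] l4]]; split=> //; split=> //; split.
    by apply/legs_survivedS.
  by rewrite (start_timeS hr l1).
by rewrite (step _ _ _ _ _ _ run1) (step _ _ _ _ _ _ run2).
Qed.

Lemma same_starts k : same_start k.
Proof.
elim: k => [|k /same_leg_start/same_start_next//].
apply: (agree_prod a0 (mE1 0) (mE2 0)) => //.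
- exact: P1_lty.
- exact: measurable_start_time run1 0.
- exact: measurable_start_time run2 0.
- exact: run_xi run1 0.
- exact: run_xi run2 0.
move=> A B mA mB.
(* The start time of leg 0 is 0, so [A] enters only through whether it contains 0. *)
have [A0|A0] := pselect (A 0).
  rewrite (_ : E1 0 `&` _ = G1 `&` X1 0%N @^-1` B); last first.
    by apply/seteqP; split=> [w [[? _] [_ ?]]|w [? ?]]; do !split=> //=; rewrite jump_time0.
  rewrite (_ : E2 0 `&` _ = G2 `&` X2 0%N @^-1` B); first exact: init.
  by apply/seteqP; split=> [w [[? _] [_ ?]]|w [? ?]]; do !split=> //=; rewrite jump_time0.
rewrite (_ : E1 0 `&` _ = set0); last first.
  by apply/seteqP; split=> w //= [_ [+ _]]; rewrite jump_time0.
rewrite (_ : E2 0 `&` _ = set0); last first.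
  by apply/seteqP; split=> w //= [_ [+ _]]; rewrite jump_time0.
by rewrite !measure0 mule0.
Qed.

Definition exit_on_leg_event {d} {T : measurableType d} (G0 : set T) X Th
    (B : set (R * V)) (k : nat) : set T :=
  G0 `&` [set w | exits_on_leg c X Th w W k /\
    B (fine (exit_time W (pdmp_path c X Th) w), exit_pos W (pdmp_path c X Th) w)].

Lemma measurable_exit_on_leg_event d (T : measurableType d) (P : probability T R) G0 X Th B k :
  run c P G0 X Th -> measurable B -> measurable (exit_on_leg_event G0 X Th B k).
Proof.
move=> hr mB; apply: measurableI; first exact: run_event hr.
have mp := measurable_path c (run_xi hr) (run_theta hr) (run_ge0 hr).
have pf w : piecewise_flow c ((pdmp_path c X Th)^~ w).
  by apply: piecewise_flow_path => i; exact: run_ge0 hr i w.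
apply: mset_and; first exact: measurable_exits_on_leg (run_xi hr) (run_theta hr) k.
apply: measurable_fun_set mB; apply: measurable_fun_pair.
  by apply: measurableT_comp => //; exact: measurable_exit_time pf.
exact: measurable_exit_pos pf.
Qed.

Lemma run_exit_on_leg B k : measurable B ->
  P1 (exit_on_leg_event G1 X1 Th1 B k) = (a%:E * P2 (exit_on_leg_event G2 X2 Th2 B k))%E.
Proof.
move=> mB.
pose D : set (R * V * \bar R) := [set q | (hit q.1.2 < q.2)%E /\
  B (q.1.1 + fine (hit q.1.2), exit_pos W (flow c) q.1.2)].
have mD : measurable D.
  have m11 : measurable_fun setT (fun q : R * V * \bar R => q.1.1).
    by apply: measurableT_comp; exact: measurable_fst.
  have m12 : measurable_fun setT (fun q : R * V * \bar R => q.1.2).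
    by apply: measurableT_comp; [exact: measurable_snd|exact: measurable_fst].
  have mh : measurable_fun setT (fun q : R * V * \bar R => hit q.1.2).
    by apply: measurableT_comp => //; exact: measurable_hit.
  apply: mset_and; first by apply: mset_lte => //; exact: measurable_snd.
  apply: (@measurable_fun_set _ _ _ _ (fun q : R * V * \bar R => (q.1.1 + fine (hit q.1.2), exit_pos W (flow c) q.1.2))) => //.
  apply: measurable_fun_pair; last by apply: measurableT_comp => //; exact: measurable_hit_pos.
  by apply: measurable_funD => //; exact: measurableT_comp.
have eventE d (T : measurableType d) (P : probability T R) G0 X Th (hr : run c P G0 X Th) :
    exit_on_leg_event G0 X Th B k =
    G0 `&` legs X Th k `&` [set w | D (start_time Th k w, X k w, Th k w)].
  have key w : exits_on_leg c X Th w W k ->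
      fine (exit_time W (pdmp_path c X Th) w) = start_time Th k w + fine (hit (X k w)) /\
      exit_pos W (pdmp_path c X Th) w = exit_pos W (flow c) (X k w).
    move=> hw; have [] := exits_on_legE (fun i => run_ge0 hr i w) oW hw.
    move=> -> ->; split=> //; have [l1 l2] := hw; rewrite fineD // ge0_fin_numE.
    - exact: legs_lty l1.
    - by apply: jump_time_ge0 => i; exact: run_ge0 hr i w.
    - exact: lt_le_trans l2 (leey _).
    - exact: exit_time_ge0.
  apply/seteqP; split=> w /=.
    by move=> [g [hw]]; have [-> ->] := key w hw; case: hw => l1 l2 hB; split; split.
  move=> [[g l1] [l2 hB]]; have hw : exits_on_leg c X Th w W k by [].
  by split=> //; split=> //; have [-> ->] := key w hw.
rewrite (eventE _ _ _ _ _ _ run1) (eventE _ _ _ _ _ _ run2).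
exact: (same_leg_start (same_starts k) mD).
Qed.

Definition exit_event {d} {T : measurableType d} (G0 : set T) X Th (B : set (R * V)) : set T :=
  G0 `&` [set w | (exists k, exits_on_leg c X Th w W k) /\
    B (fine (exit_time W (pdmp_path c X Th) w), exit_pos W (pdmp_path c X Th) w)].

Lemma exit_eventE d (T : measurableType d) (P : probability T R) G0 X Th B :
  run c P G0 X Th -> measurable B ->
  P (exit_event G0 X Th B) = (\sum_(k <oo) P (exit_on_leg_event G0 X Th B k))%E.
Proof.
move=> hr mB; have mE k := measurable_exit_on_leg_event k hr mB.
rewrite -measure_semi_bigcup //.
- congr (P _); apply/seteqP; split=> w /=.
    by move=> [g [[k hk] hB]]; exists k.
  by move=> [k _ [g [hk hB]]]; split=> //; split=> //; exists k.
- apply/trivIsetP => i j _ _; apply: contraNeq => /set0P[w [[_ [hi _]] [_ [hj _]]]].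
  by rewrite (exits_on_leg_uniq hi hj).
- exact: bigcup_measurable.
Qed.

Lemma run_exit B : measurable B ->
  P1 (exit_event G1 X1 Th1 B) = (a%:E * P2 (exit_event G2 X2 Th2 B))%E.
Proof.
move=> mB; rewrite (exit_eventE run1 mB) (exit_eventE run2 mB) -nneseriesZl //.
by apply: eq_eseriesr => k _; exact: run_exit_on_leg.
Qed.

End run_uniqueness.

Section partition_integral.
Context {R : realType} {d} {T : measurableType d} (P : probability T R).

(** Lets a conditional law of the restarted process be checked separately for each leg on which [t]
    may fall. *)
Lemma measure_partition_integral (L : nat -> set T) (A B : set T) (f : T -> \bar R) :
  (forall k, measurable (L k)) -> trivIset setT L ->
  measurable A -> measurable B -> A `<=` \bigcup_k L k -> B `<=` \bigcup_k L k ->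
  measurable_fun setT f -> (forall w, 0 <= f w)%E ->
  (forall k, P (A `&` L k) = \int[P]_(w in B `&` L k) f w)%E ->
  (P A = \int[P]_(w in B) f w)%E.
Proof.
move=> mL tL mA mB AL BL mf f0 h.
have AE : A = \bigcup_k (A `&` L k) by rewrite -setI_bigcupr setIidl.
have BE : B = \bigcup_k (B `&` L k) by rewrite -setI_bigcupr setIidl.
have tI C : trivIset setT (fun k => C `&` L k) by exact: trivIset_setIl.
rewrite [in LHS]AE measure_semi_bigcup //; last 2 first.
- by move=> i; exact: measurableI.
- by apply: bigcup_measurable => i _; exact: measurableI.
rewrite [in RHS]BE ge0_integral_bigcup //.
- by apply: eq_eseriesr => k _; exact: h.
- by move=> i; exact: measurableI.
- exact: measurable_funS mf.
Qed.

End partition_integral.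

(** * Restarting a run at a fixed time *)

Section restart.
Context {R : realType} {n : nat} (c : pdmp R n) (W : set 'rV[R]_n) (oW : open W).
Local Notation V := 'rV[R]_n.
Local Notation hit := (exit_time W (flow c)).
Context {d} {T : measurableType d} (P : probability T R)
  (xi : nat -> T -> V) (theta : nat -> T -> \bar R).
Hypothesis hrun : run c P setT xi theta.
Variables (t : R) (t0 : 0 <= t).
Let mxi := run_xi hrun.
Let mtheta := run_theta hrun.
Let theta0 := run_ge0 hrun.
Local Notation Z := (pdmp_path c xi theta).
Local Notation J k w := (jump_time theta k w).

(** The default 0 concerns paths whose jumps accumulated before [t]; they lie outside
    [restart_event]. *)
Definition leg_index (w : T) : nat := xget 0%N [set k | on_leg theta w k t].

Definition restart_xi (k : nat) (w : T) : V :=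
  if k is k'.+1 then xi (leg_index w + k'.+1) w else Z t w.

(** On a leg the difference is positive; the maximum with 0 keeps the holding time nonnegative
    elsewhere, as a [run] demands. *)
Definition restart_theta (k : nat) (w : T) : \bar R :=
  if k is k'.+1 then theta (leg_index w + k'.+1) w
  else maxe 0%E (theta (leg_index w) w - (t - fine (J (leg_index w) w))%:E)%E.

Definition restart_event : set T :=
  [set w | (exists k, on_leg theta w k t) /\ (t%:E < exit_time W Z w)%E].

Let elapsed k (w : T) : R := Num.max (t - fine (J k w)) 0.

Lemma leg_indexE k w : on_leg theta w k t -> leg_index w = k.
Proof.
move=> h; apply: (@on_leg_uniq _ _ _ theta w (fun i => theta0 i w) _ _ t) => //.
exact: (@xgetPex _ 0%N [set k | on_leg theta w k t]) (ex_intro _ k h).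
Qed.

Lemma on_leg_elapsed k w : on_leg theta w k t -> elapsed k w = t - fine (J k w).
Proof.
move=> /andP[h1 h2]; rewrite /elapsed max_l // subr_ge0 -lee_fin.
by rewrite (jump_time_fineK (fun i => theta0 i w) h1).
Qed.

(** The elapsed time reads only the holding times before [k], so being on leg [k] is a past event
    together with a lower bound on [theta k]. *)
Lemma on_legE k w : on_leg theta w k t <->
  (J k w <= t%:E)%E /\ ((elapsed k w)%:E < theta k w)%E.
Proof.
have th0 i := theta0 i w.
rewrite /on_leg jump_timeS; split=> [/andP[h1 h2]|[h1 h2]].
  split=> //; rewrite on_leg_elapsed /on_leg ?jump_timeS ?h1 //.
  move: h2; rewrite -(jump_time_fineK th0 h1); case: (theta k w) => [r| |] //=.
    by rewrite !lte_fin ltrBlDl.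
  by move=> _; rewrite ltry.
rewrite h1 /=; move: h2; have J0 := jump_time_fineK th0 h1.
have -> : elapsed k w = t - fine (J k w).
  by rewrite /elapsed max_l // subr_ge0 -lee_fin J0.
rewrite -J0 /=; case: (theta k w) => [r| |] //=.
  by rewrite !lte_fin ltrBlDl.
by move=> _; rewrite ltry.
Qed.

Lemma restart_xi0 k w : on_leg theta w k t ->
  restart_xi 0 w = flow c (elapsed k w) (xi k w).
Proof.
move=> h; rewrite /= (on_leg_path c xi (fun i => theta0 i w) h).
by rewrite (on_leg_elapsed h).
Qed.

Lemma restart_theta0 k w : on_leg theta w k t ->
  restart_theta 0 w = (theta k w - (elapsed k w)%:E)%E.
Proof.
move=> h; rewrite /= (leg_indexE h) -(on_leg_elapsed h) max_r //.
have [_ /ltW] := (on_legE k w).1 h. by rewrite EFinN sube_ge0.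
Qed.

Lemma measurable_leg_index k : measurable [set w | leg_index w = k].
Proof.
apply: (@mset_ext _ _ (fun w => on_leg theta w k t \/
  ((forall i, ~ on_leg theta w i t) /\ k = 0%N))).
  move=> w; split=> [[/leg_indexE//|[h ->]]|<-].
    by apply: xgetPN => i /h.
  have [[i h]|h] := pselect (exists i, on_leg theta w i t).
    by left; rewrite (leg_indexE h).
  right; split=> [i hi|]; first by apply: h; exists i.
  by apply: xgetPN => i hi; apply: h; exists i.
have mleg i := measurable_on_leg mtheta i t.
apply: mset_or; first exact: mleg.
apply: mset_and; last exact: mset_cst.
by apply: mset_forall => i; apply: mset_not; exact: mleg.
Qed.

Let mZ s : measurable_fun setT (Z s) := measurable_path c mxi mtheta theta0 s.
Let pZ w : piecewise_flow c (Z^~ w).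
Proof. by apply: piecewise_flow_path => i; exact: theta0. Qed.

Lemma measurable_restart_xi k : measurable_fun setT (restart_xi k).
Proof.
case: k => [|k] /=; first exact: mZ.
apply: (measurable_select (i := leg_index) (X := fun i => xi (i + k.+1))) => //.
exact: measurable_leg_index.
Qed.

Lemma measurable_restart_theta k : measurable_fun setT (restart_theta k).
Proof.
case: k => [|k] /=; last first.
  apply: (measurable_select (i := leg_index) (X := fun i => theta (i + k.+1))) => //.
  exact: measurable_leg_index.
apply: (measurable_select (i := leg_index)
    (X := fun i w => maxe 0%E (theta i w - (t - fine (J i w))%:E)%E)).
  exact: measurable_leg_index.
move=> i; apply: measurable_maxe; first exact: measurable_cst.
apply: emeasurable_funB => //; apply/measurable_EFinP.
apply: measurable_funB => //; apply: measurableT_comp => //.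
exact: measurable_jump_time.
Qed.

Lemma restart_theta_ge0 k w : (0 <= restart_theta k w)%E.
Proof. by case: k => [|k] /=; rewrite ?le_max ?lexx. Qed.

Lemma measurable_restart_event : measurable restart_event.
Proof.
apply: mset_and.
  by apply: mset_exists => k; exact: measurable_on_leg.
apply: mset_lte; first exact: measurable_cst.
exact: measurable_exit_time pZ.
Qed.

(** The part of survival on leg [k] that does not read [theta k]; [restart_leg] adds the remaining
    condition. *)
Let past k : set T := [set w | legs_survived c xi theta w W k /\
  (J k w <= t%:E)%E /\ ((elapsed k w)%:E < hit (xi k w))%E].

Let restart_leg k : restart_event `&` [set w | on_leg theta w k t] =
  past k `&` [set w | ((elapsed k w)%:E < theta k w)%E].
Proof.
apply/seteqP; split=> w.
  move=> [[_ ht] hk]; have [h1 h2] := (on_legE k w).1 hk.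
  have [h3 h4] := (exit_time_on_leg c xi (fun i => theta0 i w) oW t0 hk).1 ht.
  by split=> //; split=> //; split=> //; rewrite (on_leg_elapsed hk).
move=> [[h3 [h1 h4]] h2]; have hk : on_leg theta w k t by apply/on_legE.
split=> //; split; first by exists k.
apply/(exit_time_on_leg c xi (fun i => theta0 i w) oW t0 hk); split=> //.
by rewrite -(on_leg_elapsed hk).
Qed.

Let HS := history_space xi theta.

Let history_elapsed m i k : (k <= i)%N ->
  measurable_fun [set: HS m i] (elapsed k : HS m i -> R).
Proof.
move=> ki; apply: measurable_maxr => //; apply: measurable_funB => //.
exact: history_start_time.
Qed.

Let history_past m i k : (k <= m)%N -> (k <= i)%N ->
  measurable (past k : set (HS m i)).
Proof.
move=> km ki; apply: mset_and.
  exact: (history_legs c oW ki (leqW km)).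
have mJ : measurable_fun [set: HS m i] (jump_time theta k : HS m i -> \bar R).
  apply: (@measurable_jump_time _ _ (HS m i)) => j jk.
  by apply: history_theta; rewrite (leq_trans jk).
apply: mset_and; first by apply: mset_lee => //; exact: measurable_cst.
apply: mset_lte; first by apply/measurable_EFinP; exact: history_elapsed.
by apply: measurableT_comp; [exact: measurable_hit|exact: history_xi].
Qed.

(* On a fixed leg, the past of the restarted process is part of the past of
   the original one. *)
Let history_restart m i k H : history restart_xi restart_theta m i H ->
  exists2 H' : set (HS (k + m) (k + i)), measurable H' &
    forall w, on_leg theta w k t -> H w <-> H' w.
Proof.
pose F := [set H : set T | exists2 H' : set (HS (k + m) (k + i)), measurable H' &
  forall w, on_leg theta w k t -> H w <-> H' w].
(* The sets with such a representation form a sigma-algebra, so it is enough to represent the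
   generators. *)
have sF : sigma_algebra setT F.
  split.
  - by exists set0.
  - move=> A [A' mA' hA]; exists (~` A'); first exact: measurableC.
    by move=> w /hA hw; split=> [[_ nA] /hw|nA]; [|split=> // /hw].
  - move=> A hA; have /choice[A' hA'] : forall j, exists A' : set (HS (k + m) (k + i)),
        measurable A' /\ forall w, on_leg theta w k t -> A j w <-> A' w.
      by move=> j; have [A' ? ?] := hA j; exists A'.
    exists (\bigcup_j A' j).
      by apply: bigcup_measurable => j _; have [] := hA' j.
    by move=> w hw; split=> -[j _ h]; exists j => //; have [_ /(_ w hw) [h1 h2]] := hA' j; auto.
apply: (smallest_sub sF) => _ [|] [j ji [B mB <-]]; rewrite setTI.
- case: j ji => [|j] ji.
    exists [set w : HS (k + m) (k + i) | B (flow c (elapsed k w) (xi k w))].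
      apply: measurable_fun_set => //; apply: measurable_flow_random_time.
      + by apply: history_elapsed; rewrite leq_addr.
      + by apply: history_xi; rewrite leq_addr.
      + by move=> w; rewrite le_max lexx orbT.
    by move=> w hw; rewrite /preimage /= -(restart_xi0 hw).
  exists [set w : HS (k + m) (k + i) | B (xi (k + j.+1) w)].
    by apply: measurable_fun_set => //; apply: history_xi; rewrite leq_add2l.
  by move=> w hw; rewrite /preimage /= (leg_indexE hw).
- case: j ji => [|j] ji.
    exists [set w : HS (k + m) (k + i) | B (theta k w - (elapsed k w)%:E)%E].
      apply: (@measurable_fun_set _ _ _ _ (fun w : HS (k + m) (k + i) =>
        (theta k w - (elapsed k w)%:E)%E)) => //.
      apply: emeasurable_funB.
        by apply: history_theta; rewrite -[X in (X < _)%N]addn0 ltn_add2l.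
      by apply/measurable_EFinP; apply: history_elapsed; rewrite leq_addr.
    move=> w hw; change (B (restart_theta 0 w) <-> B (theta k w - (elapsed k w)%:E)%E).
    by rewrite (restart_theta0 hw).
  exists [set w : HS (k + m) (k + i) | B (theta (k + j.+1) w)].
    by apply: measurable_fun_set => //; apply: history_theta; rewrite ltn_add2l.
  by move=> w hw; rewrite /preimage /= (leg_indexE hw).
Qed.

Let mleg k : measurable [set w | on_leg theta w k t] := measurable_on_leg mtheta k t.

Let tleg : trivIset setT (fun k => [set w | on_leg theta w k t]).
Proof.
apply/trivIsetP => i j _ _; apply: contraNeq => /set0P[w [hi hj]].
by apply/eqP; rewrite -(leg_indexE hi) -(leg_indexE hj).
Qed.

Let restart_sub H : restart_event `&` H `<=` \bigcup_k [set w | on_leg theta w k t].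
Proof. by move=> w [[[k hk] _] _]; exists k. Qed.

Let mH m i H : history restart_xi restart_theta m i H -> measurable H.
Proof. exact: (history_measurable measurable_restart_xi measurable_restart_theta). Qed.

Let elapsed0 k w : 0 <= elapsed k w.
Proof. by rewrite le_max lexx orbT. Qed.

(** [holding_time_integral] is used at two random times: at [elapsed k w + s] for the left side, and
    at [elapsed k w], weighted by [survivalr c s] at the restart position, for the right side.
    [survivalrD] equates the results. *)
Let restart_theta_law0 s H k : 0 <= s -> history restart_xi restart_theta 0 0 H ->
  P (restart_event `&` H `&` [set w | (s%:E < restart_theta 0 w)%E] `&`
     [set w | on_leg theta w k t]) =
  (\int[P]_(w in restart_event `&` H `&` [set w | on_leg theta w k t])
     survivalr c s (restart_xi 0 w))%E.
Proof.
move=> s0 /(history_restart k)[H' mH']; rewrite addn0 in H' mH' *; move=> HH'.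
pose E := HS k k; pose D : set E := past k `&` H'.
have mD : measurable D by apply: measurableI => //; exact: history_past.
have mid := measurable_history_space mxi mtheta (k := k) (m := k).
have mxk : measurable_fun [set: E] (xi k : E -> V) by exact: history_xi.
have law (D' : set E) (s' : R) : measurable D' -> 0 <= s' ->
    P (id @^-1` D' `&` [set w | (s'%:E < theta k w)%E]) =
    (\int[P]_(w in id @^-1` D') survivalr c s' (xi k w))%E.
  by move=> mD' s'0; have := run_theta_law hrun s'0 mD'; rewrite !setTI.
have hold := holding_time_integral mid mxk (mtheta k) (theta0 k) law mD.
have mel : measurable_fun [set: E] (elapsed k : E -> R) by exact: history_elapsed.
have leg_restr : restart_event `&` H `&` [set w | on_leg theta w k t] =
    D `&` [set w | ((elapsed k w)%:E < theta k w)%E].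
  rewrite setIAC restart_leg /D; apply/seteqP; split=> w.
    move=> [[hp ht] hH]; split=> //; split=> //.
    by apply/HH' => //; apply/on_legE; split=> //; case: hp => _ [].
  move=> [[hp hH] ht]; split=> //; apply/HH' => //.
  by apply/on_legE; split=> //; case: hp => _ [].
have -> : restart_event `&` H `&` [set w | (s%:E < restart_theta 0 w)%E] `&`
    [set w | on_leg theta w k t] =
    D `&` [set w | ((elapsed k w + s)%:E < theta k w)%E].
  rewrite setIAC leg_restr; apply/seteqP; split=> w.
    move=> [[hD ht] hs]; split=> //; have hk : on_leg theta w k t.
      by apply/on_legE; split=> //; case: hD => -[_ []].
    move: hs; rewrite /mkset (restart_theta0 hk).
    case: (theta k w) => [r| |] //=; last by move=> _; rewrite ltry.
    by rewrite !lte_fin ltrBrDl.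
  move=> [hD hs]; have ht : ((elapsed k w)%:E < theta k w)%E.
    by apply: le_lt_trans hs; rewrite lee_fin lerDl.
  have hk : on_leg theta w k t by apply/on_legE; split=> //; case: hD => -[_ []].
  split=> //; rewrite /mkset (restart_theta0 hk).
  move: hs; rewrite /mkset; case: (theta k w) => [r| |] //=; last by move=> _; exact: ltry.
  by rewrite !lte_fin ltrBrDl.
rewrite leg_restr.
have mflow : measurable_fun [set: E] (fun w : E => flow c (elapsed k w) (xi k w)).
  exact: measurable_flow_random_time.
have h1 := hold (fun w : E => elapsed k w + s) (cst 1%E)
  (measurable_funD mel (measurable_cst s)) (fun w => addr_ge0 (elapsed0 k w) s0)
  (measurable_cst _) (fun _ => lee01).
have h2 := hold (elapsed k) (fun w => survivalr c s (flow c (elapsed k w) (xi k w)))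
  mel (elapsed0 k) (measurableT_comp (measurable_survivalr c s) mflow)
  (fun _ => survivalr_ge0 _ _ _).
transitivity (\int[P]_(w in D) survivalr c (elapsed k w + s) (xi k w))%E.
  transitivity (\int[P]_(w in D `&` [set w | ((elapsed k w + s)%:E < theta k w)%E]) cst 1%E w)%E.
    rewrite integral_cst ?mul1e //.
    apply: measurableI; first exact: history_measurable mD.
    apply: mset_lte => //; apply/measurable_EFinP; apply: measurable_funD => //.
    by have := measurableT_comp mel mid.
  by apply: (etrans h1); apply: eq_integral => w _; rewrite mul1e.
apply: esym; apply: (etrans _ (etrans h2 _)).
  apply: eq_integral => w /set_mem [hD ht].
  have hk : on_leg theta w k t by apply/on_legE; split=> //; case: hD => -[_ []].
  by rewrite (restart_xi0 hk).
by apply: eq_integral => w _; rewrite survivalrD // muleC.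
Qed.

(** For a later holding time the condition on [theta k] already belongs to the past, so on a fixed
    leg the law is that of the original run with index shifted by [k]. *)
Let restart_theta_law m s H k : 0 <= s -> history restart_xi restart_theta m m H ->
  P (restart_event `&` H `&` [set w | (s%:E < restart_theta m w)%E] `&`
     [set w | on_leg theta w k t]) =
  (\int[P]_(w in restart_event `&` H `&` [set w | on_leg theta w k t])
     survivalr c s (restart_xi m w))%E.
Proof.
case: m => [|m]; first exact: restart_theta_law0.
move=> s0 /(history_restart k)[H' mH' HH'].
pose E := HS (k + m.+1) (k + m.+1).
pose D : set E := past k `&` [set w | ((elapsed k w)%:E < theta k w)%E] `&` H'.
have kk : (k < k + m.+1)%N by rewrite addnS ltnS leq_addr.
have mD : measurable D.
  apply: measurableI => //; apply: measurableI; first by apply: history_past; exact: ltnW.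
  apply: mset_lte; last exact: history_theta.
  by apply/measurable_EFinP; apply: history_elapsed; exact: ltnW.
have DE : restart_event `&` H `&` [set w | on_leg theta w k t] = D.
  rewrite setIAC restart_leg; apply/seteqP; split=> w.
    move=> [hp hH]; split=> //; apply/HH' => //.
    by apply/on_legE; split=> //; case: hp => -[_ []].
  move=> [hp hH]; split=> //; apply/HH' => //.
  by apply/on_legE; split=> //; case: hp => -[_ []].
have legD w : D w -> on_leg theta w k t by rewrite -DE => -[].
have := run_theta_law hrun s0 mD; rewrite !setTI => law.
rewrite DE [LHS](_ : _ = P (D `&` [set w | (s%:E < theta (k + m.+1) w)%E])).
  apply: (etrans law); apply: eq_integral => w /set_mem /legD hk.
  by rewrite /= (leg_indexE hk).
congr (P _); rewrite setIAC DE; apply/seteqP; split=> w [hD].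
  by rewrite /mkset /= (leg_indexE (legD w hD)).
by rewrite /mkset /= => h; split=> //=; rewrite (leg_indexE (legD w hD)).
Qed.

Let restart_xi_law m B H k : measurable B -> history restart_xi restart_theta m m.+1 H ->
  P (restart_event `&` H `&` [set w | (restart_theta m w < +oo)%E] `&`
     restart_xi m.+1 @^-1` B `&` [set w | on_leg theta w k t]) =
  (\int[P]_(w in restart_event `&` H `&` [set w | (restart_theta m w < +oo)%E] `&`
      [set w | on_leg theta w k t])
     jump c (flow c (fine (restart_theta m w)) (restart_xi m w)) B)%E.
Proof.
move=> mB /(history_restart k)[H' mH' HH'].
pose E := HS (k + m) (k + m.+1).
pose D : set E := past k `&` [set w | ((elapsed k w)%:E < theta k w)%E] `&` H'.
have kk : (k < k + m.+1)%N by rewrite addnS ltnS leq_addr.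
have mD : measurable D.
  apply: measurableI => //; apply: measurableI.
    by apply: history_past; [exact: leq_addr|exact: ltnW].
  apply: mset_lte; last exact: history_theta.
  by apply/measurable_EFinP; apply: history_elapsed; exact: ltnW.
have DE : restart_event `&` H `&` [set w | on_leg theta w k t] = D.
  rewrite setIAC restart_leg; apply/seteqP; split=> w.
    move=> [hp hH]; split=> //; apply/HH' => //.
    by apply/on_legE; split=> //; case: hp => -[_ []].
  move=> [hp hH]; split=> //; apply/HH' => //.
  by apply/on_legE; split=> //; case: hp => -[_ []].
have legD w : D w -> on_leg theta w k t by rewrite -DE => -[].
have mD' : history xi theta (k + m) (k + m).+1 D.
  by move: (mD); rewrite /D /E addnS.
have := run_xi_law hrun mB mD'; rewrite !setTI => law.
have finE w : D w -> (restart_theta m w < +oo)%E <-> (theta (k + m) w < +oo)%E.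
  move=> /legD hk; case: (m) => [|m'] /=; last by rewrite (leg_indexE hk).
  rewrite -/(restart_theta 0 w) (restart_theta0 hk) addn0.
  by case: (theta k w) => [r| |] //=; rewrite ?ltry.
have fin_set : restart_event `&` H `&` [set w | (restart_theta m w < +oo)%E] `&`
    [set w | on_leg theta w k t] = D `&` [set w | (theta (k + m) w < +oo)%E].
  rewrite setIAC DE; apply/seteqP; split=> w [hD] /= h; split=> //=; exact/finE.
rewrite (setIAC _ (restart_xi m.+1 @^-1` B)) fin_set.
rewrite [LHS](_ : _ = P (D `&` [set w | (theta (k + m) w < +oo)%E] `&`
    xi (k + m).+1 @^-1` B)).
  apply: (etrans law); apply: eq_integral => w /set_mem [hD ht].
  have hk := legD w hD; congr (jump c _ B).
  (* For [m = 0] the flow runs for the elapsed time and then for the remaining one; the group law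
     merges them into the whole holding time. *)
  case: (m) ht => [|m'] ht /=; last by rewrite (leg_indexE hk).
  rewrite -/(restart_theta 0 w) (restart_theta0 hk) -/(restart_xi 0 w) (restart_xi0 hk).
  rewrite addn0 in ht *; rewrite -flowD; congr (flow c _ _).
  move: ht; rewrite /mkset; have := theta0 k w; case: (theta k w) => [r| |] //= _ _.
  by rewrite subrK.
congr (P _); apply/seteqP; split=> w [[hD ht]].
  by rewrite /preimage /mkset /= (leg_indexE (legD w hD)) addnS.
by rewrite /preimage /mkset /= => h; split=> //=; rewrite /preimage /mkset /= (leg_indexE (legD w hD)) addnS.
Qed.

Lemma run_restart : run c P restart_event restart_xi restart_theta.
Proof.
split.
- exact: measurable_restart_event.
- exact: measurable_restart_xi.
- exact: measurable_restart_theta.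
- exact: restart_theta_ge0.
- move=> m s H s0 hH.
  apply: (measure_partition_integral (L := fun k => [set w | on_leg theta w k t])) => //.
  + apply: measurableI; first by apply: measurableI (mH hH); exact: measurable_restart_event.
    by apply: mset_lte; [exact: measurable_cst|exact: measurable_restart_theta].
  + by apply: measurableI (mH hH); exact: measurable_restart_event.
  + by apply: subset_trans (@subIsetl _ _ _) _; exact: restart_sub.
  + by apply: measurableT_comp; [exact: measurable_survivalr|exact: measurable_restart_xi].
  + by move=> w; exact: survivalr_ge0.
  + by move=> k; exact: restart_theta_law.
- move=> m B H mB hH.
  have mlt : measurable [set w | (restart_theta m w < +oo)%E].
    by apply: mset_lte; [exact: measurable_restart_theta|exact: measurable_cst].
  have mE : measurable (restart_event `&` H `&` [set w | (restart_theta m w < +oo)%E]).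
    by apply: measurableI => //; apply: measurableI (mH hH); exact: measurable_restart_event.
  apply: (measure_partition_integral (L := fun k => [set w | on_leg theta w k t])) => //.
  + by apply: measurableI => //; exact: measurable_fun_set (measurable_restart_xi _) mB.
  + by do 2 apply: subset_trans (@subIsetl _ _ _) _; exact: restart_sub.
  + by apply: subset_trans (@subIsetl _ _ _) _; exact: restart_sub.
  + apply: (measurableT_comp (measurable_kernel (jump c) B mB)).
    apply: measurable_flow_random_time; last by move=> w; rewrite fine_ge0 // restart_theta_ge0.
      by apply: measurableT_comp => //; exact: measurable_restart_theta.
    exact: measurable_restart_xi.
  + by move=> k; exact: restart_xi_law.
Qed.

End restart.

Section restart_paths.
Context {R : realType} {n : nat} (c : pdmp R n) (W : set 'rV[R]_n) (oW : open W).
Local Notation V := 'rV[R]_n.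
Context {d} {T : measurableType d} (xi : nat -> T -> V) (theta : nat -> T -> \bar R).
Variables (t : R) (t0 : 0 <= t) (w : T).
Hypothesis theta0 : forall k w, (0 <= theta k w)%E.
Local Notation Z := (pdmp_path c xi theta).
Local Notation xi' := (restart_xi c xi theta t).
Local Notation theta' := (restart_theta theta t).
Local Notation J k := (jump_time theta k w).
Variables (k : nat) (hk : on_leg theta w k t).

Let th0 i : (0 <= theta i w)%E := theta0 i w.

Let leg : leg_index theta t w = k.
Proof.
apply: (@on_leg_uniq _ _ _ theta w th0 _ _ t) => //.
exact: (@xgetPex _ 0%N [set k | on_leg theta w k t]) (ex_intro _ k hk).
Qed.

Let Jk : (fine (J k))%:E = J k.
Proof. by have /andP[h _] := hk; rewrite (jump_time_fineK th0 h). Qed.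

(** Stated from the first jump on: at index 0 the restarted clock shows 0, whereas [J k - t] may be
    negative. *)
Lemma restart_jump_time j : jump_time theta' j.+1 w = (J (k + j.+1) - t%:E)%E.
Proof.
elim: j => [|j IH]; last first.
  rewrite jump_timeS IH /= leg (addnS k j.+1) [in RHS]jump_timeS.
  by rewrite -[LHS]addeA -[RHS]addeA; congr (_ + _)%E; rewrite addeC.
have /andP[h1 h2] := hk.
rewrite jump_timeS jump_time0 add0e /= leg addn1 jump_timeS -Jk.
rewrite max_r; last first.
  rewrite EFinN sube_ge0 //; move: h2; rewrite jump_timeS -Jk.
  case: (theta k w) => [r| |] //; last by move=> _; rewrite leey.
  by rewrite -EFinD !lte_fin lee_fin => h; rewrite lerBlDl ltW.
case: (theta k w) (theta0 k w) => [r| |] //= _.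
by rewrite -!EFinD; congr EFin; ring.
Qed.

Lemma on_leg_restart j u : 0 <= u ->
  on_leg theta' w j u <-> on_leg theta w (k + j) (t + u).
Proof.
move=> u0; rewrite /on_leg; case: j => [|j].
  rewrite jump_time0 restart_jump_time lee_fin u0 addn0 addn1 lteBrDl // -EFinD.
  have /andP[h1 _] := hk; split=> [/= h|/andP[]//]; apply/andP; split=> //.
  by apply: le_trans h1 _; rewrite lee_fin lerDl.
by rewrite !restart_jump_time -addnS lteBrDl // leeBlDl // -EFinD.
Qed.

Let theta'0 i : (0 <= theta' i w)%E.
Proof. by case: i => [|i] /=; rewrite ?le_max ?lexx. Qed.

Lemma restart_path u : 0 <= u -> pdmp_path c xi' theta' u w = Z (t + u) w.
Proof.
move=> u0; have tu0 : 0 <= t + u by rewrite addr_ge0.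
have [[i hi]|h] := on_legVexploded theta w tu0; last first.
  rewrite [RHS]no_leg_path; last first.
    by move=> i /andP[_]; rewrite ltNge h.
  by apply: no_leg_path => j /(on_leg_restart _ u0) /andP[_]; rewrite ltNge h.
have ki : (k <= i)%N.
  have /andP[k1 _] := hk; have /andP[_ i2] := hi.
  rewrite leqNgt; apply/negP => ik.
  have := lt_le_trans i2 (jump_time_mono th0 ik).
  by move=> /lt_le_trans /(_ k1); rewrite lte_fin ltNge lerDl u0.
move: hi; rewrite -(subnKC ki); move: (i - k)%N => j hj {ki}.
have hj' := (on_leg_restart j u0).2 hj.
rewrite (on_leg_path c xi' theta'0 hj') (on_leg_path c xi th0 hj).
case: j hj hj' => [|j] hj hj'.
  rewrite addn0 jump_time0 subr0 /= (on_leg_path c xi th0 hk).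
  by rewrite -flowD; congr (flow c _ _); ring.
have /andP[j1 _] := hj; rewrite restart_jump_time /= leg.
rewrite -(jump_time_fineK th0 j1) -EFinB /=.
by congr (flow c _ _); ring.
Qed.

Lemma restart_exit_time : (t%:E < exit_time W Z w)%E ->
  exit_time W (pdmp_path c xi' theta') w = (exit_time W Z w - t%:E)%E.
Proof.
move=> h; rewrite -(exit_time_shift t0 h); apply: eq_exit_time.
exact: restart_path.
Qed.

Lemma restart_exit_pos : (t%:E < exit_time W Z w < +oo)%E ->
  exit_pos W (pdmp_path c xi' theta') w = exit_pos W Z w.
Proof.
move=> h; rewrite -(exit_pos_shift t0 h); apply: eq_exit_pos.
exact: restart_path.
Qed.

Lemma restart_exit_event (B : set (R * V)) : (forall s : R, exists k, (s%:E < J k)%E) ->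
  exit_event c W (restart_event c W xi theta t) xi' theta' B w <->
  [/\ (t%:E < exit_time W Z w)%E, (exit_time W Z w < +oo)%E &
    B (fine (exit_time W Z w) - t, exit_pos W Z w)].
Proof.
move=> noexpl; have fineB' : (exit_time W Z w < +oo)%E ->
    fine (exit_time W Z w - t%:E)%E = fine (exit_time W Z w) - t.
  by move=> h; rewrite fineB // ge0_fin_numE // exit_time_ge0.
split.
  move=> [[_ ht] [[j hj] hB]].
  have toy : (exit_time W Z w < +oo)%E.
    have [h1 h2] := exits_on_legE theta'0 oW hj.
    have : (exit_time W (pdmp_path c xi' theta') w < +oo)%E.
      rewrite h1; have [l1 l2] := hj.
      apply: lte_add_pinfty; first exact: legs_survived_jump_time l1.
      exact: lt_le_trans l2 (leey _).
    rewrite restart_exit_time //; case: (exit_time W Z w) => [r| |] //= _.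
    by rewrite ltry.
  by split=> //; move: hB; rewrite restart_exit_time // restart_exit_pos ?ht // fineB'.
move=> [ht toy hB]; split; first by split=> //; exists k.
split; last by rewrite restart_exit_time // restart_exit_pos ?ht // fineB'.
apply: (exits_on_leg_exists theta'0 oW); last first.
  rewrite restart_exit_time //; move: toy; case: (exit_time W Z w) => [r| |] //= _.
  by rewrite ltry.
(* The restarted clock at [i.+1] is the original one at [k + i.+1] minus [t], and monotonicity puts
   the latter above the bound reached at [i]. *)
move=> s; have [i hi] := noexpl (t + Num.max s 0); exists i.+1; rewrite restart_jump_time.
rewrite lteBrDl //; apply: le_lt_trans (lt_le_trans hi _).
  by rewrite lee_fin lerD2l le_max lexx.
by apply: (jump_time_mono th0); rewrite -addSnnS leq_addl.
Qed.

End restart_paths.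

Lemma nonexplosive_jump_time {R : realType} {d} {T : measurableType d}
    (theta : nat -> T -> \bar R) w : (forall k, (0 <= theta k w)%E) ->
  (\sum_(0 <= i <oo) theta i w = +oo)%E -> forall s : R, exists k, (s%:E < jump_time theta k w)%E.
Proof.
move=> th0 sumoo s; apply: contrapT => h.
have : (\sum_(0 <= i <oo) theta i w <= s%:E)%E.
  apply: lime_le; first by apply: is_cvg_nneseries.
  apply: nearW => k; rewrite big_mkord leNgt; apply/negP => hk; apply: h; by exists k.
by rewrite sumoo.
Qed.

(** * Exit from the quasistationary distribution *)

Lemma exits_on_leg_lty {R : realType} {n : nat} (c : pdmp R n) (W : set 'rV[R]_n)
    {d} {T : measurableType d} xi theta (w : T) k : open W ->
  (forall i, (0 <= theta i w)%E) -> exits_on_leg c xi theta w W k ->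
  (exit_time W (pdmp_path c xi theta) w < +oo)%E.
Proof.
move=> oW th0 hk; have [-> _] := exits_on_legE th0 oW hk; have [l1 l2] := hk.
apply: lte_add_pinfty; first exact: legs_survived_jump_time l1.
exact: lt_le_trans l2 (leey _).
Qed.

Lemma measurable_exit_event {R : realType} {n : nat} (c : pdmp R n) (W : set 'rV[R]_n)
    {d} {T : measurableType d} (P : probability T R) G0 xi theta (B : set (R * 'rV[R]_n)) :
  open W -> run c P G0 xi theta -> measurable B -> measurable (exit_event c W G0 xi theta B).
Proof.
move=> oW hr mB; rewrite (_ : exit_event _ _ _ _ _ _ =
    \bigcup_k exit_on_leg_event c W G0 xi theta B k).
  by apply: bigcup_measurable => k _; exact: measurable_exit_on_leg_event hr mB.
apply/seteqP; split=> w /=; first by move=> [g [[k hk] hB]]; exists k.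
by move=> [k _ [g [hk hB]]]; split=> //; split=> //; exists k.
Qed.

Section law_at_exit.
Context {R : realType} {n : nat} (c : pdmp R n) (W : set 'rV[R]_n) (oW : open W).
Local Notation V := 'rV[R]_n.

Section pdmp_law_paths.
Context {d} {T : measurableType d} (P : probability T R)
  (nu : probability 'rV[R]_n R) (Z : R -> T -> V).
Hypothesis hZ : pdmp_law c P nu Z.

Lemma pdmp_law_measurable t : 0 <= t -> measurable_fun setT (Z t).
Proof.
have [xi [theta [sk ZE]]] := hZ => t0; rewrite (_ : Z t = pdmp_path c xi theta t).
  apply: measurable_path; [exact: measurable_xi sk|exact: measurable_theta sk|].
  exact: theta_ge0 sk.
by apply/funext => w; exact: ZE.
Qed.

Lemma pdmp_law_piecewise_flow w : piecewise_flow c (Z^~ w).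
Proof.
have [xi [theta [sk ZE]]] := hZ => t t0.
have [[e e0 h]|h] := piecewise_flow_path c xi (fun i => theta_ge0 sk i w) t0.
  left; exists e => // u /andP[tu ue]; rewrite !ZE ?(le_trans t0) //.
  by apply: h; rewrite tu.
by right=> u tu; rewrite ZE ?(le_trans t0) // h.
Qed.

Lemma pdmp_law_right_continuous w : right_continuous (Z^~ w).
Proof. exact: piecewise_flow_right_continuous (pdmp_law_piecewise_flow w). Qed.

Lemma pdmp_law_measurable_exit_time : measurable_fun setT (exit_time W Z).
Proof. exact: (measurable_exit_time oW pdmp_law_measurable pdmp_law_piecewise_flow). Qed.

Lemma pdmp_law_measurable_exit_pos : measurable_fun setT (exit_pos W Z).
Proof. exact: (measurable_exit_pos oW pdmp_law_measurable pdmp_law_piecewise_flow). Qed.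

Lemma pdmp_law_measurable_exit :
  measurable_fun setT (fun w => (fine (exit_time W Z w), exit_pos W Z w)).
Proof.
apply: measurable_fun_pair; last exact: pdmp_law_measurable_exit_pos.
by apply: measurableT_comp => //; exact: pdmp_law_measurable_exit_time.
Qed.

Lemma measurable_exited (t : R) (B : set (R * V)) : measurable B ->
  measurable [set w | [/\ (t%:E < exit_time W Z w)%E, (exit_time W Z w < +oo)%E &
    B (fine (exit_time W Z w) - t, exit_pos W Z w)]].
Proof.
move=> mB; have mt := pdmp_law_measurable_exit_time.
apply: (@mset_ext _ _ (fun w => (t%:E < exit_time W Z w)%E /\ ((exit_time W Z w < +oo)%E /\
    B (fine (exit_time W Z w) - t, exit_pos W Z w)))).
  by move=> w; split=> [[? []]|[]].
apply: mset_and; first by apply: mset_lte => //; exact: measurable_cst.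
apply: mset_and; first by apply: mset_lte => //; exact: measurable_cst.
apply: (@measurable_fun_set _ _ _ _ (fun w => (fine (exit_time W Z w) - t, exit_pos W Z w))) => //.
apply: measurable_fun_pair; last exact: pdmp_law_measurable_exit_pos.
by apply: measurable_funB => //; exact: measurableT_comp.
Qed.

Lemma measurable_alive (t : R) : measurable [set w | (t%:E < exit_time W Z w)%E].
Proof.
by apply: mset_lte; [exact: measurable_cst|exact: pdmp_law_measurable_exit_time].
Qed.

End pdmp_law_paths.

Lemma ae_eq_prob {d} {T : measurableType d} (P : probability T R) (A B : set T) :
  measurable A -> measurable B -> {ae P, forall w, A w <-> B w} -> P A = P B.
Proof.
move=> mA mB [N [mN N0 subN]].
have PD C : measurable C -> P C = P (C `\` N).
  move=> mC; rewrite measureD //=; last by rewrite (le_lt_trans (probability_le1 _ mC)) ?ltry.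
  have CN0 : P (C `&` N) = 0%E.
    exact: (subset_measure0 (measurableI _ _ mC mN) mN (@subIsetr _ _ _) N0).
  by rewrite [X in (_ - X)%E]CN0 sube0.
rewrite PD // [RHS]PD //; congr (P _); apply/seteqP; split=> w [h nN]; split=> //.
  by apply: contrapT => nB; apply: nN; apply: subN => /= -[AB _]; exact/nB/AB.
by apply: contrapT => nA; apply: nN; apply: subN => /= -[_ BA]; exact/nA/BA.
Qed.

Lemma probability_setI1 {d} {T : measurableType d} (P : probability T R) (A B : set T) :
  measurable A -> measurable B -> P A = 1%E -> P (B `&` A) = P B.
Proof.
move=> mA mB PA; have A0 : P (~` A) = 0%E by rewrite probability_setC // PA subee.
have D0 : P (B `\` A) = 0%E.
  apply: (subset_measure0 (measurableD mB mA) (measurableC mA) _ A0).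
  by move=> w [].
by rewrite [RHS](measureDI P mB mA) [X in (X + _)%E]D0 add0e.
Qed.

Hypothesis hc : nonexplosive c.

Lemma nonexplosive_ae {d} {T : measurableType d} (P : probability T R) nu xi theta :
  pdmp_skeleton c P xi theta nu ->
  {ae P, forall w, forall s : R, exists k, (s%:E < jump_time theta k w)%E}.
Proof.
move=> sk; have [N [mN N0 subN]] := hc sk; exists N; split=> // w /= nh; apply: subN => /= h.
by apply: nh => s; exact: nonexplosive_jump_time (fun i => theta_ge0 sk i w) h s.
Qed.

Context (mu : probability 'rV[R]_n R) (hmu : the_qsd c W mu).

Let muW : mu W = 1%E. Proof. by have [[]] := hmu. Qed.

Let mW : measurable W. Proof. exact: open_measurable_rV. Qed.

(** Two almost sure facts suffice: the start is in [W] because [mu W = 1], and [theta 0] is positive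
    because [survival] is 1 at time 0. *)
Lemma alive0 d (T : measurableType d) (P : probability T R) (Z : R -> T -> V) :
  pdmp_law c P mu Z -> P [set w | (0%:E < exit_time W Z w)%E] = 1%E.
Proof.
move=> hZ; have [xi [theta [sk ZE]]] := hZ.
have mx := measurable_xi sk; have mt := measurable_theta sk.
have m1 : measurable [set w | W (xi 0%N w)] by exact: measurable_fun_set.
have m2 : measurable [set w | (0%:E < theta 0%N w)%E].
  by apply: mset_lte => //; exact: measurable_cst.
have P1 : P [set w | W (xi 0%N w)] = 1%E by rewrite -muW -(xi0_law sk).
have P2 : P [set w | (0%:E < theta 0%N w)%E] = 1%E.
  have hT : history xi theta 0 0 setT by rewrite historyE; exact: measurableT.
  have := theta_law sk (lexx 0) hT; rewrite setTI => ->.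
  rewrite (eq_integral (cst 1%E)); last by move=> w _; rewrite survival0.
  by rewrite integral_cst // mul1e; exact: probability_setT.
apply/eqP; rewrite eq_le probability_le1; last exact: measurable_alive hZ 0.
have PI : P ([set w | W (xi 0%N w)] `&` [set w | (0%:E < theta 0%N w)%E]) = 1%E.
  by rewrite probability_setI1.
rewrite -PI le_measure // ?inE; [exact: measurableI|exact: measurable_alive hZ 0|].
move=> w [/= h1 h2].
have leg : on_leg theta w 0 0 by rewrite /on_leg jump_timeS jump_time0 add0e lexx.
rewrite (eq_exit_time W (Z' := pdmp_path c xi theta) (w' := w)); last by move=> t; exact: ZE.
apply/(exit_time_on_leg c xi (fun i => theta_ge0 sk i w) oW (lexx 0) leg); split=> //.
rewrite jump_time0 subr0; apply/exit_time_gtP => //.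
  exact: flow_right_continuous.
by move=> s /le_anti <-; rewrite flow0.
Qed.

(** Quasistationarity with the denominator cleared and [A] not confined to [W]: a live path is in
    [W], [mu] charges only [W], and if survival is a null event both sides are 0. *)
Lemma qsd_alive d (T : measurableType d) (P : probability T R) (Z : R -> T -> V) t A :
  pdmp_law c P mu Z -> 0 <= t -> measurable A ->
  P ([set w | (t%:E < exit_time W Z w)%E] `&` Z t @^-1` A) =
  (mu A * P [set w | (t%:E < exit_time W Z w)%E])%E.
Proof.
move=> hZ t0 mA; have [[_ _ /(_ _ _ _ _ hZ t _ t0) hq] _ _] := hmu.
set alive := [set w | _]; have mal : measurable alive := measurable_alive hZ t.
have mZA : measurable (Z t @^-1` A).
  by apply: measurable_fun_set => //; exact: pdmp_law_measurable hZ t t0.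
have Pfin C : measurable C -> P C \is a fin_num.
  by move=> mC; rewrite fin_num_measure.
have -> : alive `&` Z t @^-1` A = Z t @^-1` (A `&` W) `&` alive.
  apply/seteqP; split=> w /=; last by move=> [[]].
  move=> [h hA]; split=> //; split=> //.
  have rZ : right_continuous (Z^~ w) by apply: piecewise_flow_right_continuous; exact: pdmp_law_piecewise_flow hZ w.
  have /(_ t) := (exit_time_gtP oW rZ t0).1 h.
  by apply; rewrite t0 lexx.
have mAW : measurable (A `&` W) by exact: measurableI.
rewrite -(probability_setI1 mW mA muW).
have [Pa0|Pa0] := eqVneq (P alive) 0%E.
  rewrite Pa0 mule0; apply: (subset_measure0 _ mal (@subIsetr _ _ _) Pa0).
  by apply: measurableI => //; apply: measurable_fun_set => //; exact: pdmp_law_measurable hZ t t0.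
have := hq (A `&` W) mAW (@subIsetr _ _ _); rewrite -/alive => <-; last first.
  by rewrite lt0e Pa0 measure_ge0.
rewrite /cond_prob EFinM fineK; last first.
  by apply: Pfin; apply: measurableI => //; apply: measurable_fun_set => //; exact: pdmp_law_measurable hZ t t0.
rewrite -{2}(fineK (Pfin alive mal)) -muleA -EFinM mulVf ?mule1 //.
by rewrite fine_eq0 ?Pfin.
Qed.

(** By [qsd_alive] the restarted run of [Z1] starts like [Z2] up to the factor [P1 (tau > t)], which
    [run_exit] carries to the exit. Two probability spaces are allowed so that one reference process
    serves for all copies. *)
Lemma renewal d1 d2 (T1 : measurableType d1) (T2 : measurableType d2)
    (P1 : probability T1 R) (P2 : probability T2 R) (Z1 : R -> T1 -> V) (Z2 : R -> T2 -> V)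
    t (B : set (R * V)) :
  pdmp_law c P1 mu Z1 -> pdmp_law c P2 mu Z2 -> 0 <= t -> measurable B ->
  P1 [set w | [/\ (t%:E < exit_time W Z1 w)%E, (exit_time W Z1 w < +oo)%E &
    B (fine (exit_time W Z1 w) - t, exit_pos W Z1 w)]] =
  (P1 [set w | (t%:E < exit_time W Z1 w)%E] *
   P2 [set w | (exit_time W Z2 w < +oo)%E /\ B (fine (exit_time W Z2 w), exit_pos W Z2 w)])%E.
Proof.
move=> hZ1 hZ2 t0 mB.
have [xi1 [theta1 [sk1 ZE1]]] := hZ1; have [xi2 [theta2 [sk2 ZE2]]] := hZ2.
have mal : measurable [set w | (t%:E < exit_time W Z1 w)%E] := measurable_alive hZ1 t.
have run1 := run_restart oW (run_of_skeleton sk1) t0.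
have run2 := run_of_skeleton sk2.
have e1 w : exit_time W (pdmp_path c xi1 theta1) w = exit_time W Z1 w.
  by apply: eq_exit_time => s s0; rewrite ZE1.
have p1 w : exit_pos W (pdmp_path c xi1 theta1) w = exit_pos W Z1 w.
  by apply: eq_exit_pos => s s0; rewrite ZE1.
have e2 w : exit_time W (pdmp_path c xi2 theta2) w = exit_time W Z2 w.
  by apply: eq_exit_time => s s0; rewrite ZE2.
have p2 w : exit_pos W (pdmp_path c xi2 theta2) w = exit_pos W Z2 w.
  by apply: eq_exit_pos => s s0; rewrite ZE2.
have aE : (fine (P1 [set w | (t%:E < exit_time W Z1 w)%E]))%:E =
    P1 [set w | (t%:E < exit_time W Z1 w)%E] by rewrite fineK // fin_num_measure.
have a0 : 0 <= fine (P1 [set w | (t%:E < exit_time W Z1 w)%E]) by rewrite fine_ge0.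
have init A : measurable A ->
    P1 (restart_event c W xi1 theta1 t `&` restart_xi c xi1 theta1 t 0%N @^-1` A) =
    ((fine (P1 [set w | (t%:E < exit_time W Z1 w)%E]))%:E * P2 (setT `&` xi2 0%N @^-1` A))%E.
  move=> mA; rewrite setTI aE (xi0_law sk2 mA) muleC -(qsd_alive hZ1 t0 mA).
  apply: ae_eq_prob.
  - apply: measurableI; first exact: run_event run1.
    by apply: measurable_fun_set => //; exact: run_xi run1 0%N.
  - apply: measurableI => //; apply: measurable_fun_set => //.
    exact: pdmp_law_measurable hZ1 t t0.
  have [N [mN N0 subN]] := nonexplosive_ae sk1; exists N; split=> // w nh.
  apply: subN => /= h; apply: nh.
  rewrite /preimage /restart_event /mkset /= e1 ZE1 //; split=> [[[_ ?] ?]//|[h1 h2]].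
  split=> //; split=> //; have [//|h'] := on_legVexploded theta1 w t0.
  by have [k] := h t; rewrite ltNge h'.
have mE1 := run_exit oW run1 run2 a0 init mB.
(* The exit events of runs ask for a leg on which the exit happens; outside the null set of
   explosions this is finiteness of the exit time. *)
rewrite -aE -[LHS](@ae_eq_prob _ _ P1 (exit_event c W (restart_event c W xi1 theta1 t)
    (restart_xi c xi1 theta1 t) (restart_theta theta1 t) B)).
- rewrite mE1; congr (_ * _)%E; apply: ae_eq_prob.
  + exact: measurable_exit_event run2 mB.
  + apply: mset_and; first apply: mset_lte => //.
      exact: pdmp_law_measurable_exit_time hZ2.
    exact: measurable_fun_set (pdmp_law_measurable_exit hZ2) mB.
  have [N [mN N0 subN]] := nonexplosive_ae sk2; exists N; split=> // w nh.
  apply: subN => /= h; apply: nh.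
  have th0 i := theta_ge0 sk2 i w.
  rewrite /exit_event setTI /mkset e2 p2; split=> [[[k hk] hB]|[toy hB]]; split=> //.
    by rewrite -e2; exact: (exits_on_leg_lty oW th0 hk).
  by apply: (exits_on_leg_exists th0 oW h); rewrite e2.
- exact: measurable_exit_event run1 mB.
- exact: measurable_exited hZ1 t _ mB.
- have [N [mN N0 subN]] := nonexplosive_ae sk1; exists N; split=> // w nh.
  apply: subN => /= h; apply: nh; rewrite /mkset -e1 -p1.
  have [[k hk]|h'] := on_legVexploded theta1 w t0; last first.
    by have [k] := h t; rewrite ltNge h'.
  by apply: (restart_exit_event _ _ _ _ _ hk) => // i w0; exact: theta_ge0 sk1 i w0.
Qed.

End law_at_exit.

(** * Geometric survival in steps of length [dt] *)

Section exit_in_steps.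
Context {R : realType} {n : nat} (c : pdmp R n) (W : set 'rV[R]_n) (oW : open W).
Local Notation V := 'rV[R]_n.
Hypothesis hc : nonexplosive c.
Context (mu : probability 'rV[R]_n R) (hmu : the_qsd c W mu).
Context {d0} {T0 : measurableType d0} (P0 : probability T0 R) (Z0 : R -> T0 -> V).
Hypothesis hZ0 : pdmp_law c P0 mu Z0.
Hypothesis htau : {ae P0, forall w, (exit_time W Z0 w < +oo)%E}.
Variables (dt : R) (dt0 : 0 < dt).

Definition exit_law (B : set (R * V)) : \bar R :=
  P0 [set w | (exit_time W Z0 w < +oo)%E /\ B (fine (exit_time W Z0 w), exit_pos W Z0 w)].

Definition survival_step : R := fine (exit_law [set p | dt < p.1]).

(** The unnormalised law of an exit within the first step; by renewal each later step reproduces it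
    with a power of [survival_step] in front. *)
Definition exit_step (B : set (R * V)) : R :=
  fine (exit_law [set p | p.1 <= dt /\ B p]).

Let m0 := pdmp_law_measurable_exit oW hZ0.
Let mt0 := pdmp_law_measurable_exit_time oW hZ0.

Let mlaw B : measurable B -> measurable
  [set w | (exit_time W Z0 w < +oo)%E /\ B (fine (exit_time W Z0 w), exit_pos W Z0 w)].
Proof.
move=> mB; apply: mset_and; first by apply: mset_lte.
exact: (measurable_fun_set m0 mB).
Qed.

Lemma exit_law_setT : exit_law setT = 1%E.
Proof.
rewrite /exit_law -(@probability_setT _ _ _ P0); apply: ae_eq_prob => //; first exact: mlaw.
have [N [mN N0 subN]] := htau; exists N; split=> // w nh; apply: subN => /= h.
by apply: nh; split.
Qed.

Let exit_law_fin B : measurable B -> exit_law B \is a fin_num.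
Proof. by move=> mB; rewrite fin_num_measure //; exact: mlaw. Qed.

Let mgt : measurable [set p : R * V | dt < p.1].
Proof. by apply: mset_ltr; [exact: measurable_cst|exact: measurable_fst]. Qed.

Let mle B : measurable B -> measurable [set p : R * V | p.1 <= dt /\ B p].
Proof.
by move=> mB; apply: mset_and => //; apply: mset_ler; [exact: measurable_fst|exact: measurable_cst].
Qed.

Lemma survival_stepE : (survival_step%:E = exit_law [set p | (dt < p.1)%R])%E.
Proof. by rewrite fineK // exit_law_fin. Qed.

Lemma exit_stepE B : measurable B ->
  ((exit_step B)%:E = exit_law [set p | (p.1 <= dt)%R /\ B p])%E.
Proof. by move=> mB; rewrite fineK // exit_law_fin //; exact: mle. Qed.

Lemma survival_step_ge0 : 0 <= survival_step. Proof. exact: fine_ge0. Qed.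
Lemma exit_step_ge0 B : 0 <= exit_step B. Proof. exact: fine_ge0. Qed.

Section copy.
Context {d} {T : measurableType d} (P : probability T R) (Z : R -> T -> V).
Hypothesis hZ : pdmp_law c P mu Z.
Local Notation tau w := (exit_time W Z w).
Local Notation Y w := (exit_pos W Z w).

Let mtau : measurable_fun setT (exit_time W Z) := pdmp_law_measurable_exit_time oW hZ.

Lemma exit_time_finite : P [set w | (0 < tau w)%E /\ (tau w < +oo)%E] = 1%E.
Proof.
have := renewal oW hc hmu hZ hZ0 (lexx 0) (@measurableT _ (R * V)%type).
rewrite -/(exit_law setT) exit_law_setT (alive0 oW hmu hZ) mule1 => <-.
by congr (P _); apply/seteqP; split=> w /= [].
Qed.

Lemma exit_time_finite_ae : {ae P, forall w, (0 < tau w)%E /\ (tau w < +oo)%E}.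
Proof.
have mA : measurable [set w | (0 < tau w)%E /\ (tau w < +oo)%E].
  by apply: mset_and; apply: mset_lte => //; exact: measurable_cst.
exists (~` [set w | (0 < tau w)%E /\ (tau w < +oo)%E]); split=> //.
- exact: measurableC.
- by rewrite probability_setC // exit_time_finite subee.
Qed.

Lemma exit_law_copy B : measurable B -> P [set w | B (fine (tau w), Y w)] = exit_law B.
Proof.
move=> mB; have := renewal oW hc hmu hZ hZ0 (lexx 0) mB.
rewrite -/(exit_law B) (alive0 oW hmu hZ) mul1e => <-; apply: ae_eq_prob.
- exact: (measurable_fun_set (pdmp_law_measurable_exit oW hZ) mB).
- exact: (measurable_exited oW hZ 0 mB).
have [N [mN N0 subN]] := exit_time_finite_ae; exists N; split=> // w nh; apply: subN => /= h.
by apply: nh; rewrite /mkset subr0; case: h => h1 h2; split=> [|[]].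
Qed.

Lemma alive_pow k : P [set w | ((k%:R * dt)%:E < tau w)%E] = (survival_step ^+ k)%:E.
Proof.
elim: k => [|k IH]; first by rewrite mul0r expr0; exact: (alive0 oW hmu hZ).
have kdt : 0 <= k%:R * dt by rewrite mulr_ge0 // ltW.
have := renewal oW hc hmu hZ hZ0 kdt mgt.
rewrite -/(exit_law _) IH -survival_stepE -EFinM -exprSr => <-.
apply: ae_eq_prob; [exact: (measurable_alive oW hZ)|exact: (measurable_exited oW hZ _ mgt)|].
have [N [mN N0 subN]] := exit_time_finite_ae; exists N; split=> // w nh; apply: subN => /= -[h1 h2].
apply: nh; rewrite /mkset /=.
have tE : (fine (tau w))%:E = tau w by rewrite fineK // ge0_fin_numE // ltW.
rewrite -tE !lte_fin -natr1 mulrDl mul1r /= ltrBrDl; split=> [h|[_ _]//].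
by split=> //; [apply: lt_trans h; rewrite ltrDl|rewrite ltry].
Qed.

Lemma exit_step_pow k B : measurable B ->
  P [set w | [/\ ((k%:R * dt)%:E < tau w)%E, (tau w <= (k.+1%:R * dt)%:E)%E &
    B (fine (tau w) - k%:R * dt, Y w)]] = (survival_step ^+ k * exit_step B)%:E.
Proof.
move=> mB; have kdt : 0 <= k%:R * dt by rewrite mulr_ge0 // ltW.
have := renewal oW hc hmu hZ hZ0 kdt (mle mB).
rewrite -/(exit_law _) alive_pow -exit_stepE // -EFinM => <-.
congr (P _); apply/seteqP; split=> w.
  move=> [h1 h2 h3].
  have toy : (tau w < +oo)%E by rewrite (le_lt_trans h2) // ltry.
  split=> //; split=> //=; rewrite lerBlDl; move: h2.
  rewrite -[tau w](@fineK _ (tau w)) ?ge0_fin_numE ?exit_time_ge0 // lee_fin.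
  by rewrite -natr1 mulrDl mul1r.
move=> [h1 h2 [/= h3 h4]]; split=> //; move: h3; rewrite lerBlDl.
rewrite -{2}[tau w](@fineK _ (tau w)) ?ge0_fin_numE ?exit_time_ge0 // lee_fin.
by rewrite -natr1 mulrDl mul1r.
Qed.

End copy.

Lemma exit_law_steps B : measurable B -> exit_law B =
  (\sum_(k <oo) (survival_step ^+ k * exit_step [set p | B ((p.1 + k%:R * dt)%R, p.2)])%:E)%E.
Proof.
move=> mB.
have mBk k : measurable [set p : R * V | B (p.1 + k%:R * dt, p.2)].
  apply: (@measurable_fun_set _ _ _ _ (fun p : R * V => (p.1 + k%:R * dt, p.2))) => //.
  apply: measurable_fun_pair; last exact: measurable_snd.
  by apply: measurable_funD => //; exact: measurable_fst.
pose A k := [set w | [/\ ((k%:R * dt)%:E < exit_time W Z0 w)%E,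
  (exit_time W Z0 w <= (k.+1%:R * dt)%:E)%E &
  B (fine (exit_time W Z0 w), exit_pos W Z0 w)]].
have mA k : measurable (A k).
  apply: (@mset_ext _ _ (fun w => ((k%:R * dt)%:E < exit_time W Z0 w)%E /\
    ((exit_time W Z0 w <= (k.+1%:R * dt)%:E)%E /\
    B (fine (exit_time W Z0 w), exit_pos W Z0 w)))).
    by move=> w; split=> [[? []]|[]].
  apply: mset_and; first by apply: mset_lte => //; exact: measurable_cst.
  apply: mset_and; first by apply: mset_lee => //; exact: measurable_cst.
  exact: (measurable_fun_set m0 mB).
transitivity (P0 (\bigcup_k A k)).
  apply: ae_eq_prob; [exact: mlaw|exact: bigcup_measurable|].
  have [N [mN N0 subN]] := exit_time_finite_ae hZ0; exists N; split=> // w nh; apply: subN => /= -[h1 h2].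
  apply: nh; split=> [[_ hB]|[k _ []]//].
  have tE : (fine (exit_time W Z0 w))%:E = exit_time W Z0 w by rewrite fineK // ge0_fin_numE // ltW.
  have t0 : 0 < fine (exit_time W Z0 w) by rewrite -lte_fin tE.
  (* The least [k] with [tau <= k dt] is positive because [tau] is, and its predecessor numbers the
     step of the exit. *)
  have ex : exists k : nat, fine (exit_time W Z0 w) <= k%:R * dt.
    exists (Num.truncn (fine (exit_time W Z0 w) / dt)).+1.
    rewrite -ler_pdivrMr // ltW //.
    by have /truncn_itv/andP[] : 0 <= fine (exit_time W Z0 w) / dt by rewrite divr_ge0 // ltW.
  case: (ex_minnP ex) => -[|k] hk kmin; first by move: hk; rewrite mul0r leNgt t0.
  exists k => //; split=> //; rewrite -tE ?lee_fin // lte_fin ltNge.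
  by apply/negP => /kmin; rewrite ltnn.
rewrite measure_semi_bigcup //; last 2 first.
- apply/trivIsetP => i j _ _; apply: contraNeq => /set0P[w [[i1 i2 _] [j1 j2 _]]].
  have key a b : ((a%:R * dt)%:E < exit_time W Z0 w)%E ->
      (exit_time W Z0 w <= (b.+1%:R * dt)%:E)%E -> (a <= b)%N.
    move=> h1 h2; have := lt_le_trans h1 h2; rewrite lte_fin ltr_pM2r // ltr_nat.
    by rewrite ltnS.
  by apply/eqP/anti_leq; rewrite !key.
- exact: bigcup_measurable.
apply: eq_eseriesr => k _; rewrite -(exit_step_pow hZ0 k (mBk k)).
by congr (P0 _); apply/seteqP; split=> w /= [h1 h2]; rewrite subrK.
Qed.

(** Were the ratio 1, no exit would fall in any step, and the series of [exit_law_steps] for the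
    full space would sum to 0 instead of 1. *)
Lemma survival_step_lt1 : survival_step < 1.
Proof.
rewrite ltNge; apply/negP => s1.
have s1' : survival_step = 1.
  apply/eqP; rewrite eq_le s1 andbT -lee_fin survival_stepE.
  by apply: probability_le1; exact: mlaw.
have := exit_law_steps (@measurableT _ (R * V)%type).
rewrite exit_law_setT eseries0; first by move/eqP; rewrite onee_eq0.
move=> k _ _; rewrite /exit_step; congr EFin; apply/eqP; rewrite mulf_eq0 s1' expr1n oner_eq0 /=.
have := @probability_setC _ _ _ P0 [set w | (exit_time W Z0 w < +oo)%E /\
  dt < fine (exit_time W Z0 w)] (mlaw mgt).
have e1 : P0 [set w | (exit_time W Z0 w < +oo)%E /\ dt < fine (exit_time W Z0 w)] = 1%E.
  by rewrite -[LHS]/(exit_law [set p | dt < p.1]) -survival_stepE s1'.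
have mT : measurable [set p : R * V | [set: R * V] (p.1 + k%:R * dt, p.2)].
  exact: measurableT.
rewrite e1 subee // => C0; rewrite fine_eq0; last by apply: exit_law_fin; exact: mle mT.
apply/eqP; apply: subset_measure0 C0.
- by apply: mlaw; exact: mle mT.
- by apply: measurableC; exact: mlaw mgt.
- by move=> w [_ [/= h _]] [_]; rewrite ltNge h.
Qed.

(** The exit time is at most [dt] times the number of [k] with [k dt < tau], and the mean of that
    number is a geometric series. *)
Lemma exit_time_integrable : (\int[P0]_w (fine (exit_time W Z0 w))%:E < +oo)%E.
Proof.
pose h (k : nat) w : \bar R := (dt * \1_[set w | ((k%:R * dt)%:E < exit_time W Z0 w)%E] w)%:E.
have mset k : measurable [set w | ((k%:R * dt)%:E < exit_time W Z0 w)%E].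
  exact: (measurable_alive oW hZ0).
have mh k : measurable_fun setT (h k).
  by apply/measurable_EFinP; apply: measurable_funM => //; exact: measurable_indic.
have h0 k w : (0 <= h k w)%E by rewrite lee_fin mulr_ge0 // ltW.
have le_series w : ((fine (exit_time W Z0 w))%:E <= \sum_(k <oo) h k w)%E.
  have t0 : 0 <= fine (exit_time W Z0 w) by rewrite fine_ge0 // exit_time_ge0.
  (* [fine] sends an infinite exit time to 0, so the bound is trivial there. *)
  have [toy|toy] := eqVneq (exit_time W Z0 w) +oo%E.
    by rewrite toy /=; apply: nneseries_ge0.
  have tE : (fine (exit_time W Z0 w))%:E = exit_time W Z0 w.
    by rewrite fineK // ge0_fin_numE ?exit_time_ge0 // lt_neqAle toy leey.
  have ex : exists k : nat, fine (exit_time W Z0 w) <= k%:R * dt.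
    exists (Num.truncn (fine (exit_time W Z0 w) / dt)).+1.
    rewrite -ler_pdivrMr // ltW //.
    by have /truncn_itv/andP[] : 0 <= fine (exit_time W Z0 w) / dt by rewrite divr_ge0 // ltW.
  case: (ex_minnP ex) => k hk kmin.
  apply: le_trans (nneseries_lim_ge k _) => //.
  rewrite (@eq_big_nat _ _ _ 0%N k _ (fun=> dt%:E)); last first.
    move=> i /andP[_ ik]; rewrite /h indicE mem_set ?mulr1 //= -tE lte_fin ltNge.
    by apply/negP => /kmin; rewrite leqNgt ik.
  by rewrite sumEFin lee_fin big_const_nat iter_addr_0 subn0 -mulr_natl.
apply: (@le_lt_trans _ _ (\int[P0]_w (\sum_(k <oo) h k w))%E).
  apply: ge0_le_integral => //.
  - by move=> w _; rewrite lee_fin fine_ge0 // exit_time_ge0.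
  - by apply/measurable_EFinP; exact: measurableT_comp.
  - by apply: ge0_emeasurable_sum.
rewrite integral_nneseries //.
rewrite (eq_eseriesr (g := fun k => (dt * survival_step ^+ k)%:E)); last first.
  move=> k _; rewrite /h; under eq_integral do rewrite EFinM.
  rewrite ge0_integralZl_EFin ?(ltW dt0) //; last first.
    by apply/measurable_EFinP; exact: measurable_indic.
  by rewrite integral_indic // setIT [X in (_ * X)%E](alive_pow hZ0 k) EFinM.
apply: (@le_lt_trans _ _ (dt / (1 - survival_step))%:E); last by rewrite ltry.
apply: lime_le.
  apply: is_cvg_nneseries => k _ _; rewrite lee_fin mulr_ge0 ?exprn_ge0 ?survival_step_ge0 //.
  exact: ltW.
apply: nearW => k; rewrite sumEFin lee_fin.
have := geometric_seriesE dt (negbT (lt_eqF survival_step_lt1)) => /(congr1 (fun u => u k)).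
rewrite /series /geometric /= => ->.
rewrite ler_pM2r ?invr_gt0 ?subr_gt0 ?survival_step_lt1 //.
by rewrite ler_piMr ?(ltW dt0) // gerBl exprn_ge0 // survival_step_ge0.
Qed.

End exit_in_steps.

(** * Occupation integrals up to the exit *)

Section occupation.
Context {R : realType} {n : nat} (W : set 'rV[R]_n).
Local Notation V := 'rV[R]_n.
Local Notation leb := (@lebesgue_measure R).
Context {d} {T : measurableType d} (Z : R -> T -> V).
Hypothesis mZ : forall t, 0 <= t -> measurable_fun setT (Z t).
Hypothesis rZ : forall w, right_continuous (Z^~ w).
Hypothesis mtau : measurable_fun setT (exit_time W Z).

(** Joint measurability in path and time, needed for Fubini, comes from right continuity; clipping
    at 0 avoids negative times, about which nothing is known. *)
Lemma measurable_process :
  measurable_fun setT (fun p : T * measurableTypeR R => Z (Num.max p.2 0) p.1).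
Proof.
apply: (@measurable_random_time _ _ _ (T * measurableTypeR R)%type
  (fun t p => Z t p.1) (fun p => Num.max p.2 0)).
- by move=> t t0; apply: (measurableT_comp (mZ t0)); exact: measurable_fst.
- by move=> p t s t0 ts st; exact: rZ t0 ts st.
- by apply: measurable_maxr => //; exact: measurable_snd.
- by move=> p; rewrite le_max lexx orbT.
Qed.

(** The restriction to times before the exit turns the integrand at a fixed [t] into [g (Z t)] on
    the event of survival, where quasistationarity applies. *)
Definition occupation (g : V -> \bar R) (I : set R) (w : T) : \bar R :=
  (\int[leb]_(t in I `&` [set t | (t%:E < exit_time W Z w)%E]) g (Z t w))%E.

Variables (g : V -> \bar R) (mg : measurable_fun setT g) (g0 : forall z, (0 <= g z)%E).
Variables (I : set (measurableTypeR R)) (mI : measurable I) (I0 : forall t, I t -> 0 <= t).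

Let TR : measurableType _ := (T * measurableTypeR R)%type.
Let G (p : TR) := g (Z (Num.max p.2 0) p.1).
Let mG : measurable_fun setT G.
Proof. by apply: measurableT_comp => //; exact: measurable_process. Qed.
Let D : set TR := [set p | I p.2 /\ (p.2%:E < exit_time W Z p.1)%E].
Let mD : measurable D.
Proof.
apply: mset_and; first by apply: measurable_fun_set => //; exact: measurable_snd.
apply: mset_lte; first by apply/measurable_EFinP; exact: measurable_snd.
by apply: measurableT_comp => //; exact: measurable_fst.
Qed.

Let occE w : occupation g I w = (\int[leb]_(t in [set t | D (w, t)]) G (w, t))%E.
Proof.
apply: eq_integral => t /set_mem [/I0 t0 _].
by rewrite /G /= max_l.
Qed.

Lemma measurable_occupation : measurable_fun setT (occupation g I).
Proof.
rewrite (_ : occupation g I = fun w => (\int[leb]_(t in [set t | D (w, t)]) G (w, t))%E).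
  by apply: measurable_integral_param => // p; exact: g0.
by apply/funext => w; exact: occE.
Qed.

Lemma occupation_ge0 w : (0 <= occupation g I w)%E.
Proof. by apply: integral_ge0 => t _; exact: g0. Qed.

Context (P : probability T R) (mu : probability V R) (X : set T) (mX : measurable X).
Hypothesis hX : forall t A, 0 <= t -> measurable A ->
  P (X `&` [set w | (t%:E < exit_time W Z w)%E] `&` Z t @^-1` A) =
  (mu A * P (X `&` [set w | (t%:E < exit_time W Z w)%E]))%E.

(** The hypothesis [hX] is quasistationarity on an extra event [X]: the full space for a single
    process, [others_alive] for a copy inside the parallel step. *)
Lemma integral_alive t : 0 <= t ->
  (\int[P]_(w in X `&` [set w | (t%:E < exit_time W Z w)%E]) g (Z t w) =
   (\int[mu]_z g z) * P (X `&` [set w | (t%:E < exit_time W Z w)%E]))%E.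
Proof.
move=> t0; set E := X `&` _.
have mE : measurable E.
  by apply: measurableI => //; apply: mset_lte => //; exact: measurable_cst.
have aE : (fine (P E))%:E = P E by rewrite fineK // fin_num_measure.
have a0 : 0 <= fine (P E) by exact: fine_ge0.
rewrite (@agree_integral _ _ _ _ T V V P mu (fine (P E)) E (Z t) setT id a0 mE measurableT (mZ t0) _ g).
- by rewrite aE muleC.
- exact: measurable_id.
- by move=> B mB; rewrite /agree_on aE setTI muleC; exact: hX.
- exact: mg.
- exact: g0.
Qed.

Lemma integral_occupation :
  (\int[P]_(w in X) occupation g I w =
   \int[leb]_(t in I) ((\int[mu]_z g z) * P (X `&` [set w | (t%:E < exit_time W Z w)%E])))%E.
Proof.
pose H (p : TR) := if p \in [set p | X p.1 /\ D p] then G p else 0%E.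
have mH : measurable_fun setT H.
  apply: measurable_if_set => //; apply: mset_and => //.
  by apply: measurable_fun_set => //; exact: measurable_fst.
have H0 p : (0 <= H p)%E by rewrite /H; case: ifP => // _; exact: g0.
transitivity (\int[P]_w \int[leb]_t H (w, t))%E.
  rewrite integral_mkcond; apply: eq_integral => w _; rewrite patchE.
  have [h|h] := boolP (w \in X); last first.
    rewrite integral0_eq // => t _; rewrite /H ifN //.
    by apply: contraNN h => /set_mem[hX' _]; exact/mem_set.
  rewrite occE integral_mkcond; apply: eq_integral => t _; rewrite /H /patch.
  congr (if _ then _ else _); apply/idP/idP => /set_mem h'; apply/mem_set.
    by split=> //; exact: set_mem h.
  by case: h'.
rewrite (@fubini_tonelli _ _ T (measurableTypeR R) R P leb H mH H0).
rewrite [RHS]integral_mkcond; apply: eq_integral => t _; rewrite patchE.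
have [h|h] := boolP (t \in I); last first.
  rewrite integral0_eq // => w _; rewrite /H ifN //.
  by apply: contraNN h => /set_mem[_ [h _]]; exact/mem_set.
have It := set_mem h; rewrite -(integral_alive (I0 It)).
rewrite [RHS]integral_mkcond; apply: eq_integral => w _; rewrite /H /patch /G /= max_l ?I0 //.
congr (if _ then _ else _); apply/idP/idP => /set_mem h'; apply/mem_set.
  by case: h' => ? [].
by case: h'.
Qed.

Lemma measurable_alive_prob :
  measurable_fun setT (fun t : measurableTypeR R => P (X `&` [set w | (t%:E < exit_time W Z w)%E])).
Proof.
pose A : set TR := [set p | X p.1 /\ (p.2%:E < exit_time W Z p.1)%E].
have mA : measurable A.
  apply: mset_and; first by apply: measurable_fun_set => //; exact: measurable_fst.
  apply: mset_lte; first by apply/measurable_EFinP; exact: measurable_snd.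
  by apply: measurableT_comp => //; exact: measurable_fst.
have := measurable_fun_ysection P mA; apply: eq_measurable_fun => t _ /=.
by congr (P _); apply/seteqP; split=> w; rewrite /ysection /= inE.
Qed.

End occupation.

(** After Fubini the integral of [g] against [mu] is a factor that does not depend on the time; with
    [g] equal to 1 the remainder is identified as the mean duration. *)
Lemma integral_occupation_factor {R : realType} {n : nat} (W : set 'rV[R]_n)
    {d} {T : measurableType d} (Z : R -> T -> 'rV[R]_n)
    (g : 'rV[R]_n -> \bar R) (I : set (measurableTypeR R))
    (P : probability T R) (mu : probability 'rV[R]_n R) (X : set T) :
  (forall t, 0 <= t -> measurable_fun setT (Z t)) ->
  (forall w, right_continuous (Z^~ w)) ->
  measurable_fun setT (exit_time W Z) ->
  measurable_fun setT g -> (forall z, 0 <= g z)%E ->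
  measurable I -> (forall t, I t -> 0 <= t) -> measurable X ->
  (forall t A, 0 <= t -> measurable A ->
    P (X `&` [set w | (t%:E < exit_time W Z w)%E] `&` Z t @^-1` A) =
    (mu A * P (X `&` [set w | (t%:E < exit_time W Z w)%E]))%E) ->
  (\int[P]_(w in X) occupation W Z g I w =
   (\int[mu]_z g z) * \int[P]_(w in X) occupation W Z (cst 1) I w)%E.
Proof.
move=> mZ rZ mtau mg g0 mI I0 mX hX.
rewrite (integral_occupation mZ rZ mtau mg g0 mI I0 mX hX).
rewrite (integral_occupation (g := cst 1%E) mZ rZ mtau _ _ mI I0 mX hX) //.
have one : (\int[mu]_z cst 1%E z = 1)%E.
  by rewrite integral_cst // mul1e; exact: probability_setT.
rewrite ge0_integralZl //.
- by congr (_ * _)%E; apply: eq_integral => t _; rewrite [X in (X * _)%E]one mul1e.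
- exact: measurable_funS (measurable_alive_prob mtau P mX).
- by apply: integral_ge0.
Qed.

(** * Order of the asynchronous steps *)

Section wall_orders.
Context {R : realType} {p : nat}.
Local Notation A := ('I_p.+1 * nat)%type.

Section pointwise.
Context {T : Type} (twall : 'I_p.+1 -> nat -> T -> R) (w : T).
Local Notation tw a := (twall a.1 a.2 w).

Section order.
Variables (s : nat -> A) (hs : is_wall_order twall w s).

Lemma wall_order_mono i j : (i < j)%N -> tw (s i) < tw (s j).
Proof.
move=> /subnKC <-; elim: (j - i.+1)%N => [|m IH]; first by rewrite addn0; exact: hs.2.
by apply: lt_trans IH _; rewrite addnS; exact: hs.2.
Qed.

Lemma wall_order_lt i j : (tw (s i) < tw (s j)) = (i < j)%N.
Proof.
have [ij|ji|->] := ltngtP i j; first exact: wall_order_mono.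
  by apply/negbTE; rewrite -leNgt ltW // wall_order_mono.
by rewrite ltxx.
Qed.

Lemma wall_order_inj : injective s.
Proof.
move=> i j ij; have [h|h|//] := ltngtP i j.
  by have := wall_order_mono h; rewrite ij ltxx.
by have := wall_order_mono h; rewrite ij ltxx.
Qed.

Lemma wall_order_surj a : exists k, s k = a.
Proof.
have [k _ <-] : range s a by rewrite hs.1.
by exists k.
Qed.

Lemma wall_order_tw_inj a b : tw a = tw b -> a = b.
Proof.
have [i <-] := wall_order_surj a; have [j <-] := wall_order_surj b => e.
have [h|h|-> //] := ltngtP i j.
  by have := wall_order_mono h; rewrite e ltxx.
by have := wall_order_mono h; rewrite e ltxx.
Qed.

End order.

(** The position of a fragment, expressed by the finite list of the fragments before it. Lists are
    countable and sequences are not, so this form gives measurability of the order. *)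
Definition wall_rank (a : A) (k : nat) := exists l : seq A,
  [/\ uniq l, size l = k & forall b, (b \in l) = (tw b < tw a)].

Lemma wall_order_rank s k : is_wall_order twall w s -> wall_rank (s k) k.
Proof.
move=> hs; exists (map s (iota 0 k)); split.
- by rewrite map_inj_uniq ?iota_uniq //; exact: wall_order_inj hs.
- by rewrite size_map size_iota.
move=> b; have [j <-] := wall_order_surj hs b.
rewrite mem_map; last exact: wall_order_inj hs.
by rewrite mem_iota /= add0n (wall_order_lt hs).
Qed.

Lemma wall_rank_lt a b i j : wall_rank a i -> wall_rank b j -> tw a < tw b -> (i < j)%N.
Proof.
move=> [la [ua <- ha]] [lb [ub <- hb]] ab.
have : (size (a :: la) <= size lb)%N.
  apply: uniq_leq_size; first by rewrite /= ua ha ltxx.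
  by move=> x; rewrite inE hb => /predU1P[->//|]; rewrite ha => /lt_trans; apply.
by [].
Qed.

(** Replaces a quantifier over sequences by countably many conditions on ranks. For the converse,
    [s k] is chosen as a fragment with exactly [k] predecessors. *)
Lemma is_wall_orderP : (exists s, is_wall_order twall w s) <->
  [/\ forall a b : A, a <> b -> tw a <> tw b, forall a, exists k, wall_rank a k
    & forall k, exists a, wall_rank a k].
Proof.
split=> [[s hs]|[inj rk sj]].
  split.
  - by move=> a b ab /(wall_order_tw_inj hs).
  - by move=> a; have [k <-] := wall_order_surj hs a; exists k; exact: wall_order_rank.
  - by move=> k; exists (s k); exact: wall_order_rank.
have /choice[s hs] := sj.
have cmp a b i j : wall_rank a i -> wall_rank b j -> (i < j)%N -> tw a < tw b.
  move=> ha hb ij; have [//|ba|e] := ltgtP (tw a) (tw b).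
    by have := wall_rank_lt hb ha ba; rewrite ltnNge ltnW.
  have [ab|ab] := pselect (a = b); last by have := inj _ _ ab.
  move: ha hb => [la [ua sa ha]] [lb [ub sb hb]].
  have : perm_eq la lb by apply: uniq_perm => // x; rewrite ha hb ab.
  by move/perm_size; rewrite sa sb => ee; rewrite ee ltnn in ij.
exists s; split; last by move=> k; exact: cmp (hs k) (hs k.+1) (ltnSn k).
apply/seteqP; split=> // a _; have [k ak] := rk a; exists k => //.
apply: contrapT => sa; have := inj _ _ sa.
have [lt|lt|//] := ltgtP (tw (s k)) (tw a).
  by have := wall_rank_lt (hs k) ak lt; rewrite ltnn.
by have := wall_rank_lt ak (hs k) lt; rewrite ltnn.
Qed.

Lemma wall_orderP : (exists s, is_wall_order twall w s) ->
  is_wall_order twall w (wall_order twall w).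
Proof. exact: xgetPex. Qed.

Lemma wall_order_eq k a : (exists s, is_wall_order twall w s) ->
  wall_order twall w k = a <-> wall_rank a k.
Proof.
move=> ex; have hs := wall_orderP ex; split=> [<-|ak]; first exact: wall_order_rank.
have [j ja] := wall_order_surj hs a; have := wall_order_rank j hs; rewrite ja => aj.
have [[l [ul sl hl]] [l' [ul' sl' hl']]] := (aj, ak).
have /perm_size : perm_eq l l' by apply: uniq_perm => // x; rewrite hl hl'.
by rewrite sl sl' => jk; rewrite -jk.
Qed.

End pointwise.

Lemma measurable_wall_order {d} {T : measurableType d} (twall : 'I_p.+1 -> nat -> T -> R) k a :
  (forall r m, measurable_fun setT (twall r m)) ->
  measurable [set w | wall_order twall w k = a].
Proof.
move=> mtw.
have mrank b i : measurable [set w | wall_rank twall w b i].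
  apply: mset_exists => l.
  apply: (@mset_ext _ _ (fun w => (uniq l /\ size l = i) /\
    forall b', (b' \in l) = (twall b'.1 b'.2 w < twall b.1 b.2 w))).
    by move=> w; split=> [[[? ?] ?]|[? ?]].
  apply: mset_and; first exact: mset_cst.
  apply: mset_forall => b'; case: (b' \in l).
    by apply: (mset_ext _ (mset_ltr (mtw b'.1 b'.2) (mtw b.1 b.2))) => w; split=> /esym.
  apply: (mset_ext _ (mset_not (mset_ltr (mtw b'.1 b'.2) (mtw b.1 b.2)))) => w.
  by split=> [/negP/negbTE ->//|<-].
have mex : measurable [set w | exists s, is_wall_order twall w s].
  apply: (@mset_ext _ _ (fun w => (forall a b : A, a <> b -> twall a.1 a.2 w <> twall b.1 b.2 w) /\
    ((forall a, exists k, wall_rank twall w a k) /\ (forall k, exists a, wall_rank twall w a k)))).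
    by move=> w; rewrite is_wall_orderP; split=> [[? []]|[]].
  apply: mset_and.
    apply: mset_forall => b; apply: mset_forall => b'; apply: mset_imply; first exact: mset_cst.
    apply: mset_not; apply: (@mset_ext _ _ (fun w =>
      twall b.1 b.2 w <= twall b'.1 b'.2 w /\ twall b'.1 b'.2 w <= twall b.1 b.2 w)).
      by move=> w; split=> [[h1 h2]|->] //; apply/eqP; rewrite eq_le h1.
    by apply: mset_and; exact: mset_ler.
  by apply: mset_and; apply: mset_forall => i; apply: mset_exists.
apply: (@mset_ext _ _ (fun w => ((exists s, is_wall_order twall w s) /\ wall_rank twall w a k) \/
  (~ (exists s, is_wall_order twall w s) /\ (ord0, 0%N) = a))).
  move=> w; split=> [[[ex /wall_order_eq ->//]|[nex <-]]|ka].
    by rewrite /wall_order xgetPN // => s hs; apply: nex; exists s.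
  have [ex|nex] := pselect (exists s, is_wall_order twall w s); [left|right].
    by split=> //; apply/wall_order_eq.
  by split=> //; rewrite -ka /wall_order xgetPN // => s hs; apply: nex; exists s.
apply: mset_or; first exact: mset_and.
by apply: mset_and; [exact: mset_not|exact: mset_cst].
Qed.

End wall_orders.

(** * Independence of one copy from the clocks and the other copies *)

Section independence.
Context {R : realType} {n p : nat} {d} {T : measurableType d} (P : probability T R).
Local Notation V := 'rV[R]_n.
Variables (Z : 'I_p.+1 -> R -> T -> V) (twall : 'I_p.+1 -> nat -> T -> R).
Hypothesis mZ : forall r t, 0 <= t -> measurable_fun setT (Z r t).
Hypothesis mtw : forall r m, measurable_fun setT (twall r m).
Hypothesis hind : mutually_independent P (fun r => generated_sigma [set t : R | 0 <= t] (Z r)).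
Hypothesis htwind : independent_classes P
  (generated_sigma setT (fun rm => twall rm.1 rm.2))
  (generated_sigma [set rt : 'I_p.+1 * R | 0 <= rt.2] (fun rt => Z rt.1 rt.2)).

Definition copy_space r := g_sigma_algebraType (preimages [set t : R | 0 <= t] (Z r)).

Definition clock_space :=
  g_sigma_algebraType (preimages setT (fun rm : 'I_p.+1 * nat => twall rm.1 rm.2)).

(** A pi-system for the clocks together with the copies other than [r]. On rectangles of this kind
    the two independence hypotheses give a product formula. *)
Definition rest_rect r : set (set T) := [set X | exists (C : set clock_space) (E : 'I_p.+1 -> set T),
  [/\ measurable C, forall i, measurable (E i : set (copy_space i)) &
     X = C `&` \bigcap_(i in [set i | i != r]) E i]].

Definition rest_space r := g_sigma_algebraType (rest_rect r).

Let mcopyT r : measurable ([set: T] : set (copy_space r)). Proof. exact: measurableT. Qed.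

Lemma clock_rest r k m : measurable_fun [set: rest_space r] (twall k m : rest_space r -> R).
Proof.
move=> _ B mB; apply: sub_sigma_algebra; exists (twall k m @^-1` B), (fun=> setT); split=> //.
  by apply: sub_sigma_algebra; exists (k, m) => //; exists B => //; rewrite setTI.
by rewrite (_ : \bigcap_(i in _) _ = setT) ?setIT //; apply/seteqP; split.
Qed.

Lemma copy_rest r i t : i != r -> 0 <= t ->
  measurable_fun [set: rest_space r] (Z i t : rest_space r -> V).
Proof.
move=> ir t0 _ B mB; apply: sub_sigma_algebra.
exists setT, (fun j => if j == i then Z i t @^-1` B else setT); split; first exact: measurableT.
  move=> j; case: eqP => [->|_]; last exact: mcopyT.
  by apply: sub_sigma_algebra; exists t => //; exists B => //; rewrite setTI.
rewrite !setTI; apply/seteqP; split=> w.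
  by move=> h j _; case: eqP.
by move=> /(_ i ir); rewrite eqxx.
Qed.

Lemma copy_self r t : 0 <= t ->
  measurable_fun [set: copy_space r] (Z r t : copy_space r -> V).
Proof. by move=> t0 _ B mB; apply: sub_sigma_algebra; exists t => //; exists B. Qed.

Lemma copy_measurable r (Y : set (copy_space r)) : measurable Y -> measurable (Y : set T).
Proof.
apply: (smallest_sub (sigma_algebra_measurable T)).
by move=> _ [t t0 [B mB <-]]; exact: mZ.
Qed.

Lemma clock_measurable (C : set clock_space) : measurable C -> measurable (C : set T).
Proof.
apply: (smallest_sub (sigma_algebra_measurable T)).
by move=> _ [t t0 [B mB <-]]; exact: mtw.
Qed.

Let copy_all r (Y : set (copy_space r)) : measurable Y ->
  generated_sigma [set rt : 'I_p.+1 * R | 0 <= rt.2] (fun rt => Z rt.1 rt.2) Y.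
Proof.
apply: sub_sigma_algebra2 => _ [t t0 [B mB <-]].
by exists (r, t) => //; exists B.
Qed.

Let all_space := g_sigma_algebraType
  (preimages [set rt : 'I_p.+1 * R | 0 <= rt.2] (fun rt => Z rt.1 rt.2)).

Let copy_bigcap (D : set 'I_p.+1) (E : 'I_p.+1 -> set T) :
  (forall i, measurable (E i : set (copy_space i))) ->
  measurable (\bigcap_(i in D) E i : set all_space).
Proof.
move=> mE; apply: fin_bigcap_measurable; first exact: finite_finset.
by move=> i _; exact: copy_all (mE i).
Qed.

Let all_measurable (Y : set all_space) : measurable Y -> measurable (Y : set T).
Proof.
apply: (smallest_sub (sigma_algebra_measurable T)).
by move=> _ [t t0 [B mB <-]]; exact: mZ.
Qed.

Let rect_prob (C : set clock_space) (E : 'I_p.+1 -> set T) (J : {set 'I_p.+1}) :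
  measurable C -> (forall i, measurable (E i : set (copy_space i))) ->
  P (C `&` \bigcap_(i in [set` J]) E i) = (P C * \prod_(i in J) P (E i))%E.
Proof.
move=> mC mE; rewrite htwind //; last exact: copy_bigcap.
by rewrite hind // => i _; exact: mE.
Qed.

Lemma rest_measurable r (X : set (rest_space r)) : measurable X -> measurable (X : set T).
Proof.
apply: (smallest_sub (sigma_algebra_measurable T)) => _ [C [E [mC mE ->]]].
apply: measurableI; first exact: clock_measurable.
by apply: all_measurable; exact: copy_bigcap.
Qed.

(** With [Y] fixed, both sides are finite measures in [X], so the product formula on rectangles is
    enough. *)
Lemma rest_independent r (X : set (rest_space r)) (Y : set (copy_space r)) :
  measurable X -> measurable Y -> P (X `&` Y) = (P X * P Y)%E.
Proof.
move=> mX mY; have mYT := copy_measurable mY.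
have aE : (fine (P Y))%:E = P Y by rewrite fineK // fin_num_measure.
have a0 : 0 <= fine (P Y) by exact: fine_ge0.
have mid : measurable_fun setT (id : T -> rest_space r).
  by move=> _ B mB; rewrite setTI; exact: (rest_measurable mB).
have PYoo : (P Y < +oo)%E by rewrite -aE ltry.
suff key : agree_on P P (fine (P Y)) Y (id : T -> rest_space r) setT (id : T -> rest_space r) X.
  by rewrite setIC; apply: (etrans key); rewrite muleC aE; congr (P _ * _)%E; exact: setTI.
apply: (@agree_pi _ _ _ _ T T (rest_space r) P P (fine (P Y)) Y id setT id a0 mYT
  measurableT mid mid (rest_rect r)) => //.
- move=> _ _ [C [E [mC mE ->]]] [C' [E' [mC' mE' ->]]].
  exists (C `&` C'), (fun i => E i `&` E' i); split; first exact: measurableI.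
    by move=> i; apply: measurableI.
  by rewrite bigcapI setIACA.
- exists setT, (fun=> setT); split; [exact: measurableT|by move=> i; exact: mcopyT|].
  by apply/esym; rewrite setTI; apply/seteqP; split.
- move=> _ [C [E [mC mE ->]]]; rewrite /agree_on aE [X in (_ * P X)%E]setTI.
  (* [Y] takes the free place [r], so that [Y] and the rectangle together form a rectangle over all
     copies. *)
  pose E' i : set T := if i == r then Y else E i.
  have mE' i : measurable (E' i : set (copy_space i)).
    by rewrite /E'; case: eqP => [->|_].
  have -> : Y `&` (C `&` \bigcap_(i in [set i | i != r]) E i) =
      C `&` \bigcap_(i in [set` [set: 'I_p.+1]%SET]) E' i.
    apply/seteqP; split=> w.
      by move=> [hY [hC hE]]; split=> // i _; rewrite /E'; case: eqP => [//|/eqP ir]; exact: hE i ir.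
    move=> [hC hE]; split; first by have := hE r; rewrite /E' eqxx; apply; rewrite /= inE.
    by split=> // i ir; have := hE i; rewrite /E' (negbTE ir); apply; rewrite /= inE.
  have -> : C `&` \bigcap_(i in [set i | i != r]) E i =
      C `&` \bigcap_(i in [set` [set~ r]%SET]) E' i.
    apply/seteqP; split=> w [hC hE]; split=> // i /=; rewrite ?inE => ir.
      by rewrite /E' (negbTE ir); exact: hE.
    by have := hE i; rewrite /E' (negbTE ir); apply; rewrite /= !inE.
  apply: (etrans (rect_prob _ mC mE')).
  apply/esym; transitivity (P Y * (P C * \prod_(i in [set~ r]%SET) P (E' i)))%E.
    by congr (_ * _)%E; exact: rect_prob.
  apply/esym.
  rewrite (bigD1 r) ?inE //= {1}/E' eqxx muleCA; congr (_ * (_ * _))%E.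
  by apply: eq_bigl => i; rewrite !inE.
Qed.

End independence.

(** * Path integrals over random intervals *)

Section path_integrals.
Context {R : realType} {n : nat}.
Local Notation V := 'rV[R]_n.
Local Notation leb := (@lebesgue_measure R).
Context {d} {T : measurableType d} (Z : R -> T -> V).
Hypothesis mZ : forall t, 0 <= t -> measurable_fun setT (Z t).
Hypothesis rZ : forall w, right_continuous (Z^~ w).

Lemma measurable_path_itv (f : V -> R) w (a b : R) : measurable_fun setT f -> 0 <= a ->
  measurable_fun (`[a, b]%classic : set (measurableTypeR R)) (fun t => f (Z t w)).
Proof.
move=> mf a0.
have h : measurable_fun (`[a, b]%classic : set (measurableTypeR R)) (fun t => f (Z (Num.max t 0) w)).
  apply: measurableT_comp => //.
  apply: measurable_funS (measurableT_comp (measurable_process mZ rZ) (pair1_measurable w)) => //.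
apply: eq_measurable_fun h => t /set_mem /=; rewrite in_itv /= => /andP[at_ _].
by rewrite max_l // (le_trans a0).
Qed.

Lemma integrable_path (f : V -> R) w (a b M : R) : measurable_fun setT f ->
  (forall z, `|f z| <= M) -> 0 <= a ->
  leb.-integrable `[a, b] (EFin \o (fun t => f (Z t w))).
Proof.
move=> mf fM a0; apply: measurable_bounded_integrable => //.
- have lab : (leb `[a, b]%classic < +oo)%E.
    by rewrite lebesgue_measure_itv /=; case: ifP => // _; rewrite -EFinB ltry.
  exact: lab.
- exact: (@measurable_path_itv f w a b mf a0).
- exists M; split; first exact: num_real.
  by move=> y My t _ /=; apply: le_trans (fM _) (ltW My).
Qed.

Lemma path_intE (f : V -> R) w (a b M : R) : measurable_fun setT f ->
  (forall z, `|f z| <= M) -> 0 <= a ->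
  (path_int f Z w a b)%:E = (\int[leb]_(t in `[a, b]) (f (Z t w))%:E)%E.
Proof.
move=> mf fM a0; rewrite /path_int /Rintegral fineK //.
exact: integrable_fin_num (integrable_path w b mf fM a0).
Qed.

Lemma path_int1 w (a b : R) : a <= b -> path_int (cst 1) Z w a b = b - a.
Proof.
move=> ab; have lab : leb `[a, b]%classic = (b - a)%:E.
  rewrite lebesgue_measure_itv /= lte_fin; case: ltP => // ba.
  by have -> : a = b; [apply/eqP; rewrite eq_le ab|rewrite subrr].
by rewrite /path_int Rintegral_cst // mul1r [X in fine X](_ : _ = (b - a)%:E).
Qed.

Lemma path_intD (f : V -> R) w (a b M : R) : measurable_fun setT f ->
  (forall z, `|f z| <= M) -> 0 <= a ->
  path_int (fun z => f z + M) Z w a b = path_int f Z w a b + M * path_int (cst 1) Z w a b.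
Proof.
move=> mf fM a0; rewrite /path_int RintegralD //; first last.
- have := @integrable_path (cst M) w a b `|M| (measurable_cst _) (fun=> lexx _) a0.
  by apply: eq_integrable.
- exact: integrable_path mf fM a0.
by rewrite !Rintegral_cst // mul1r.
Qed.

(** Nonnegative integrands go through Fubini on the region between [a] and [b w]. A function bounded
    by [M] becomes nonnegative after adding [M], at the cost of [M] times the integral of 1. *)
Lemma measurable_path_int (f : V -> R) (a M : R) (b : T -> R) : measurable_fun setT f ->
  (forall z, `|f z| <= M) -> 0 <= a -> measurable_fun setT b ->
  measurable_fun setT (fun w => path_int f Z w a (b w)).
Proof.
move=> mf fM a0 mb.
have main (g : V -> R) N : measurable_fun setT g -> (forall z, 0 <= g z) ->
    (forall z, `|g z| <= N) -> measurable_fun setT (fun w => path_int g Z w a (b w)).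
  move=> mg g0 gN; apply/measurable_EFinP => /=.
  pose TR : measurableType _ := (T * measurableTypeR R)%type.
  pose D : set TR := [set p | a <= p.2 /\ p.2 <= b p.1].
  have mD : measurable D.
    have msnd : measurable_fun setT (fun p : TR => p.2 : R) by exact: measurable_snd.
    apply: mset_and; first by apply: mset_ler => //; exact: measurable_cst.
    by apply: mset_ler => //; apply: measurableT_comp => //; exact: measurable_fst.
  rewrite (_ : _ \o _ = fun w => (\int[leb]_(t in [set t | D (w, t)]) (g (Z (Num.max t 0) w))%:E)%E).
    apply: (@measurable_integral_param _ _ _ _ (fun p : TR => (g (Z (Num.max p.2 0) p.1))%:E)) => //.
      apply/measurable_EFinP; apply: measurableT_comp => //; exact: measurable_process.
    by move=> p; rewrite lee_fin.
  apply/funext => w /=; rewrite (path_intE w (b w) mg gN a0).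
  have -> : [set t | D (w, t)] = `[a, b w]%classic.
    by apply/seteqP; split=> t; rewrite /D /= in_itv /= => /andP.
  apply: eq_integral => t /set_mem /=; rewrite in_itv /= => /andP[at_ _].
  by rewrite max_l // (le_trans a0).
rewrite (_ : (fun w => _) = fun w => path_int (fun z => f z + M) Z w a (b w) -
    M * path_int (cst 1) Z w a (b w)); last first.
  by apply/funext => w; rewrite (path_intD w _ mf fM) // addrK.
apply: measurable_funB.
  apply: (main _ (M + M)).
  - by apply: measurable_funD => //; exact: measurable_cst.
  - by move=> z; have := fM z; rewrite ler_norml => /andP[h _]; rewrite -lerBlDr sub0r.
  - move=> z; apply: le_trans (ler_normD _ _) _; apply: lerD => //.
    by rewrite ger0_norm // (le_trans (normr_ge0 _) (fM 0)).
apply: measurable_funM; first exact: measurable_cst.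
by apply: (main _ 1) => // z; rewrite normr1.
Qed.

End path_integrals.

Lemma leastP (A : set nat) k : (exists n, A n) ->
  least A = k <-> A k /\ forall j, (j < k)%N -> ~ A j.
Proof.
move=> exA; have ex : exists n, A n /\ forall m, A m -> (n <= m)%N.
  have exb : exists n, `[< A n >] by have [n An] := exA; exists n; exact/asboolP.
  case: (ex_minnP exb) => m /asboolP Am lem; exists m; split=> // j /asboolP; exact: lem.
have [Al lel] : [set n | A n /\ forall m, A m -> (n <= m)%N] (least A) by exact: xgetPex.
split=> [<-|[Ak kle]]; first by split=> // j; rewrite ltnNge => /negP h /lel.
apply/eqP; rewrite eqn_leq lel //= leqNgt; apply/negP => /kle; exact.
Qed.

Lemma least0 (A : set nat) : ~ (exists n, A n) -> least A = 0%N.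
Proof. by move=> h; rewrite /least xgetPN // => k [Ak _]; apply: h; exists k. Qed.

Lemma measurable_least {d} {T : measurableType d} (Q : nat -> T -> Prop) k :
  (forall j, measurable [set w | Q j w]) -> measurable [set w | least [set j | Q j w] = k].
Proof.
move=> mQ; have mE : measurable [set w | exists j, Q j w] by exact: mset_exists.
apply: (@mset_ext _ _ (fun w => ((exists j, Q j w) /\
    (Q k w /\ forall j, (j < k)%N -> ~ Q j w)) \/ (~ (exists j, Q j w) /\ k = 0%N))).
  move=> w; have [ex|nex] := pselect (exists j, Q j w).
    rewrite (leastP (A := [set j | Q j w]) k ex); split=> [[[_ //]|[//]]|h]; by left.
  rewrite (least0 (A := [set j | Q j w]) nex); split=> [[[//]|[_ ->//]]|<-]; by right.
apply: mset_or; apply: mset_and => //; last by apply: mset_cst.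
  apply: mset_and => //; apply: mset_forall => j; apply: mset_imply; first exact: mset_cst.
  exact: mset_not.
exact: mset_not.
Qed.

Section path_occupation.
Context {R : realType} {n : nat} (W : set 'rV[R]_n) {d} {T : measurableType d}.
Context (Z : R -> T -> 'rV[R]_n).
Hypothesis mZ : forall t, 0 <= t -> measurable_fun setT (Z t).
Hypothesis rZ : forall w, right_continuous (Z^~ w).
Variables (g : 'rV[R]_n -> R) (M : R).
Hypotheses (mg : measurable_fun setT g) (gM : forall z, `|g z| <= M).
Local Notation leb := (@lebesgue_measure R).
Local Notation tau w := (exit_time W Z w).

Lemma path_int_before w (a b : R) : 0 <= a -> (b%:E < tau w)%E ->
  (path_int g Z w a b)%:E = occupation W Z (EFin \o g) `[a, b] w.
Proof.
move=> a0 bt; rewrite (path_intE mZ rZ w b mg gM a0) /occupation setIidl //.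
by move=> t /=; rewrite in_itv /= => /andP[_ tb]; apply: le_lt_trans bt; rewrite lee_fin.
Qed.

(** The path integral includes the exit instant and the occupation does not, which is a difference
    of measure 0. [I] may be any set that looks like a half-line from [a] until the exit. *)
Lemma path_int_at_exit w (a : R) (I : set R) : 0 <= a -> (tau w < +oo)%E ->
  (forall t, I t -> a <= t) -> (forall t, a <= t -> (t%:E < tau w)%E -> I t) ->
  (path_int g Z w a (fine (tau w)))%:E = occupation W Z (EFin \o g) I w.
Proof.
move=> a0 toy Ia aI; have tE : (fine (tau w))%:E = tau w.
  by rewrite fineK // ge0_fin_numE // exit_time_ge0.
rewrite (path_intE mZ rZ w _ mg gM a0) /occupation.
have -> : I `&` [set t | (t%:E < tau w)%E] = `[a, fine (tau w)[%classic.
  apply/seteqP; split=> t /=; rewrite in_itv /= -lte_fin tE; first by move=> [/Ia -> ->].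
  by move=> /andP[at_ tt]; split=> //; exact: aI.
symmetry; apply: (@integral_itv_bndo_bndc R (BLeft a) (fine (tau w)) (fun t => (g (Z t w))%:E)).
apply/measurable_EFinP.
have := @measurable_path_itv _ _ _ _ Z mZ rZ g w a (fine (tau w)) mg a0.
apply: measurable_funS; first exact: measurable_itv.
by move=> t /=; rewrite !in_itv /= => /andP[-> /ltW].
Qed.

End path_occupation.

(** * The asynchronous step along one outcome *)

Section async_steps.
Context {R : realType} {n p : nat} (W : set 'rV[R]_n) (dt : R) (dt0 : 0 < dt) {d} {T : measurableType d}
  (Z : 'I_p.+1 -> R -> T -> 'rV[R]_n) (twall : 'I_p.+1 -> nat -> T -> R).
Local Notation A := ('I_p.+1 * nat)%type.
Local Notation V := 'rV[R]_n.
Local Notation leb := (@lebesgue_measure R).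
Local Notation tau r w := (exit_time W (Z r) w).
Local Notation s w := (wall_order twall w).
Local Notation tw a w := (twall a.1 a.2 w).

Definition survived (a : A) (w : T) : Prop := ((a.2.+1%:R * dt)%:E < tau a.1 w)%E.

Definition alive_before k w := forall j, (j < k)%N -> survived (s w j) w.

(** Earlier fragments of the copy [a.1] itself are left out, so the condition reads only the clocks
    and the other copies. *)
Definition others_survived (a : A) w :=
  forall b : A, b.1 <> a.1 -> tw b w < tw a w -> survived b w.

Definition regular w := [/\ exists s, is_wall_order twall w s,
  forall r i j, (i <= j)%N -> twall r i w <= twall r j w &
  forall r, (0 < tau r w)%E /\ (tau r w < +oo)%E].

Definition step_itv (m : nat) : set R := `[m%:R * dt, m.+1%:R * dt]%classic.

(* Summed over k, this is async_fpar without reference to the random index async_K. *)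
Definition step_occupation (g : V -> \bar R) k w : \bar R :=
  if w \in [set w | alive_before k w]
  then occupation W (Z (s w k).1) g (step_itv (s w k).2) w else 0%E.

Variable w : T.
Hypothesis hw : regular w.

Let hs : is_wall_order twall w (s w). Proof. by apply: wall_orderP; case: hw. Qed.

Let tauE r : (fine (tau r w))%:E = tau r w.
Proof. by have [_ _ /(_ r)[? ?]] := hw; rewrite fineK // ge0_fin_numE // ltW. Qed.

(** The clock of one copy is monotone, so its earlier fragments are those with smaller number;
    surviving all of them amounts to being alive when the current one starts. *)
Lemma alive_before_at k a : s w k = a ->
  alive_before k w <-> others_survived a w /\ ((a.2%:R * dt)%:E < tau a.1 w)%E.
Proof.
have [_ mono fin] := hw; move=> ka; split=> [al|[oth start] j jk].
  have before b : tw b w < tw a w -> survived b w.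
    have [j <-] := wall_order_surj hs b.
    by rewrite -ka (wall_order_lt hs) => /al.
  split; first by move=> b _; exact: before.
  (* Fragment 0 starts at time 0 and needs [tau > 0]. Otherwise the preceding fragment ends where
     this one starts, and its clock is strictly smaller since equal clocks would identify the
     two. *)
  case: a ka before => r [|m] ka before /=; first by rewrite mul0r; case: (fin r).
  apply: (before (r, m)) => /=; rewrite lt_neqAle mono // andbT.
  apply/eqP => e; have := @wall_order_tw_inj _ _ _ _ _ _ hs (r, m) (r, m.+1) e.
  by case=> /eqP; rewrite eqn_leq ltnn andbF.
have := wall_order_mono hs jk; rewrite ka => lt.
have [e|ne] := pselect ((s w j).1 = a.1); last exact: oth.
rewrite /survived e; apply: le_lt_trans start.
rewrite lee_fin ler_pM2r // ler_nat ltnNge; apply/negP => h.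
by have := mono a.1 _ _ h; rewrite -{2}e leNgt lt.
Qed.

Lemma exists_exit : exists k, ~ survived (s w k) w.
Proof.
have [_ _ fin] := hw; have [t0 _] := fin ord0.
(* By this choice the exit time of copy 0 is below [m.+1%:R * dt], so its fragment [m] is not
   survived. *)
pose m := Num.truncn (fine (tau ord0 w) / dt).
have [k ke] := wall_order_surj hs (ord0, m); exists k; rewrite ke /survived /=.
apply/negP; rewrite -leNgt -tauE lee_fin -ler_pdivrMr // ltW //.
by apply: truncnS_gt.
Qed.

Lemma async_KP k : async_K W dt Z twall w = k <-> alive_before k w /\ ~ survived (s w k) w.
Proof.
have E j : (tau (s w j).1 w <= ((s w j).2.+1%:R * dt)%:E)%E <-> ~ survived (s w j) w.
  by rewrite /survived leNgt; split=> /negP.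
rewrite /async_K leastP /=; last by have [j /E hj] := exists_exit; exists j.
split=> [[/E h1 h2]|[h1 h2]]; split=> //; last 2 first.
- exact/E.
- by move=> j jk /E; apply; exact: h1.
by move=> j /h2 h; apply: contrapT => /E.
Qed.

Lemma survived_start k : alive_before k w -> (((s w k).2%:R * dt)%:E < tau (s w k).1 w)%E.
Proof. by move=> /(alive_before_at erefl)[]. Qed.

(** Each completed fragment lasts [dt] whatever its copy, so only their number and the last fragment
    count. *)
Lemma async_Tpar k : async_K W dt Z twall w = k ->
  async_fpar W dt Z twall (cst 1) w =
  k%:R * dt + (fine (tau (s w k).1 w) - (s w k).2%:R * dt).
Proof.
move=> Kk; have [al _] := (async_KP k).1 Kk.
rewrite /async_fpar Kk path_int1; last first.
  by rewrite -lee_fin tauE ltW // survived_start.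
congr (_ + _); rewrite (eq_bigr (fun=> dt)).
  by rewrite sumr_const card_ord mulr_natl.
move=> i _; rewrite path_int1; first by rewrite -natr1; ring.
by rewrite ler_pM2r // ler_nat.
Qed.

Hypothesis mZ : forall r t, 0 <= t -> measurable_fun setT (Z r t).
Hypothesis rZ : forall r w, right_continuous ((Z r)^~ w).
Variables (g : V -> R) (M : R).
Hypotheses (mg : measurable_fun setT g) (g0 : forall z, 0 <= g z) (gM : forall z, `|g z| <= M).

Lemma step_occupation_ge0 k : (0 <= step_occupation (EFin \o g) k w)%E.
Proof.
rewrite /step_occupation; case: ifP => // _; apply: occupation_ge0 => z.
by rewrite lee_fin.
Qed.

(** Terms after [K] vanish because step [K] is not survived, and in the term [K] the occupation
    stops at the exit by itself. *)
Lemma async_fpar_occupation :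
  (async_fpar W dt Z twall g w)%:E = (\sum_(0 <= k <oo) step_occupation (EFin \o g) k w)%E.
Proof.
have [_ _ fin] := hw.
have mdt m : 0 <= m%:R * dt by rewrite mulr_ge0 // ltW.
set K := async_K W dt Z twall w; have [al dead] := (async_KP K).1 erefl.
rewrite (nneseries_split 0 K.+1); last by move=> k _; exact: step_occupation_ge0.
rewrite add0n [X in (_ + X)%E]eseries0 ?adde0; last first.
  move=> k Kk _; rewrite /step_occupation ifN //.
  by apply/negP => /set_mem /(_ K Kk).
rewrite big_mkord big_ord_recr /= /async_fpar -/K EFinD -sumEFin; congr (_ + _)%E.
  apply: eq_bigr => k _; have kal : alive_before k w.
    by move=> j jk; apply: al; exact: ltn_trans jk (ltn_ord k).
  rewrite /step_occupation ifT; last exact/mem_set.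
  apply: (path_int_before (@mZ (s w k).1) (@rZ (s w k).1) mg gM) => //.
  exact: al (ltn_ord k).
rewrite /step_occupation ifT; last exact/mem_set.
apply: (path_int_at_exit (@mZ (s w K).1) (@rZ (s w K).1) mg gM) => //.
- by case: (fin (s w K).1).
- by move=> t; rewrite /step_itv /= in_itv /= => /andP[].
move=> t ta tt; rewrite /step_itv /= in_itv /= ta -lee_fin ltW //=.
by apply: lt_le_trans tt _; move: dead => /negP; rewrite -leNgt.
Qed.

End async_steps.

(** * Law and expectation of the asynchronous step *)

Section fibers.
Context {R : realType} {d} {T : measurableType d} (P : probability T R).
Context {A : countType} (kappa : T -> A) (u v : T -> \bar R) (x : R).
Hypothesis mk : forall a, measurable [set w | kappa w = a].
Hypotheses (mesu : measurable_fun setT u) (mv : measurable_fun setT v).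
Hypotheses (u0 : forall w, (0 <= u w)%E) (v0 : forall w, (0 <= v w)%E).

(** Numbering the values of [kappa] by [pickle] turns the fibers into a sequence of disjoint
    sets. *)
Let G (k : nat) : set T := [set w | pickle (kappa w) = k].

Let GE k : G k = if unpickle k is Some a then
  (if pickle a == k then [set w | kappa w = a] else set0) else set0.
Proof.
apply/seteqP; split=> w; rewrite /G /=; first by move=> <-; rewrite pickleK eqxx.
case: (@unpickle A k) => //= a; case: eqP => //= e h.
by rewrite h.
Qed.

Let mG k : measurable (G k).
Proof. by rewrite GE; case: (unpickle k) => [a|] //; case: ifP. Qed.

Let integral_G (f : T -> \bar R) : measurable_fun setT f -> (forall w, (0 <= f w)%E) ->
  (\int[P]_w f w = \sum_(0 <= k <oo) \int[P]_(w in G k) f w)%E.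
Proof.
move=> mf f0; rewrite -[X in integral _ X](_ : \bigcup_k G k = setT).
  rewrite ge0_integral_bigcup //; first exact: measurable_funTS.
  by move=> i j _ _ [w [/= <- <-]].
by apply/seteqP; split=> // w _; exists (pickle (kappa w)).
Qed.

Lemma eq_integral_fibers : (0 <= x)%R ->
  (forall a, \int[P]_(w in [set w | kappa w = a]) u w =
     x%:E * \int[P]_(w in [set w | kappa w = a]) v w)%E ->
  (\int[P]_w u w = x%:E * \int[P]_w v w)%E.
Proof.
move=> x0 h; rewrite integral_G // [X in (_ * X)%E]integral_G // -nneseriesZl; last first.
  by move=> k _; exact: integral_ge0.
apply: eq_eseriesr => k _; rewrite GE; case: (unpickle k) => [a|]; last by rewrite !integral_set0 mule0.
by case: ifP => // _; rewrite !integral_set0 mule0.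
Qed.

End fibers.

Lemma eq_prob_fibers {R : realType} {d} {T : measurableType d} (P : probability T R)
    {A : countType} (kappa : T -> A) (E F : set T) (x : R) :
  (forall a, measurable [set w | kappa w = a]) -> measurable E -> measurable F -> (0 <= x)%R ->
  (forall a, P (E `&` [set w | kappa w = a]) = x%:E * P (F `&` [set w | kappa w = a]))%E ->
  (P E = x%:E * P F)%E.
Proof.
move=> mk mE mF x0 h.
have := @eq_integral_fibers _ _ _ P A kappa (EFin \o \1_E) (EFin \o \1_F) x mk.
rewrite !integral_indic // !setIT; apply => //.
- by apply/measurable_EFinP; exact: measurable_indic.
- by apply/measurable_EFinP; exact: measurable_indic.
- by move=> w; rewrite lee_fin.
- by move=> w; rewrite lee_fin.
by move=> a; rewrite !integral_indic //; exact: h.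
Qed.

(* Adding M to a function bounded by M reduces expectations of signed path integrals to nonnegative
   ones, of common ratio x to the mean duration F1. *)
Lemma expectation_shift {R : realType} {d} {T : measurableType d} (P : probability T R)
    (F Fg F1 : T -> R) (M x : R) :
  (forall w, F w = Fg w - M * F1 w) -> measurable_fun setT Fg -> measurable_fun setT F1 ->
  (forall w, 0 <= Fg w) -> (forall w, 0 <= F1 w) ->
  (\int[P]_w (Fg w)%:E = x%:E * \int[P]_w (F1 w)%:E)%E -> (\int[P]_w (F1 w)%:E < +oo)%E ->
  ('E_P[F] = (x - M)%:E * \int[P]_w (F1 w)%:E)%E.
Proof.
move=> FE mg m1 g0 p0 eg i1.
have e1 : (\int[P]_w (F1 w)%:E)%E \is a fin_num.
  by rewrite ge0_fin_numE //; apply: integral_ge0 => w _; rewrite lee_fin.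
have int (h : T -> R) : measurable_fun setT h -> (forall w, 0 <= h w) ->
    (\int[P]_w (h w)%:E < +oo)%E -> P.-integrable setT (EFin \o h).
  move=> mh h0 hoo; apply/integrableP; split; first exact/measurable_EFinP.
  by under eq_integral do rewrite /= ger0_norm //.
have I1 := int _ m1 p0 i1.
have Ig : P.-integrable setT (EFin \o Fg).
  by apply: int => //; rewrite eg -(fineK e1) -EFinM ltry.
rewrite unlock (_ : F = fun w => Fg w - M * F1 w); last exact/funext.
transitivity (\int[P]_w ((Fg w)%:E - M%:E * (F1 w)%:E))%E.
  by apply: eq_integral => w _; rewrite /= EFinB EFinM.
rewrite (integralB measurableT Ig (integrableZl measurableT M I1)).
rewrite (integralZl measurableT I1) eg -(fineK e1) -!EFinM -EFinB; congr (_%:E); ring.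
Qed.

Section async_law.
Context {R : realType} {n : nat} (c : pdmp R n) (W : set 'rV[R]_n) (oW : open W).
Local Notation V := 'rV[R]_n.
Local Notation leb := (@lebesgue_measure R).
Hypothesis hc : nonexplosive c.
Context (mu : probability 'rV[R]_n R) (hmu : the_qsd c W mu).
Context {d0} {T0 : measurableType d0} (P0 : probability T0 R) (Z0 : R -> T0 -> V).
Hypothesis hZ0 : pdmp_law c P0 mu Z0.
Hypothesis htau : {ae P0, forall w, (exit_time W Z0 w < +oo)%E}.
Variables (dt : R) (dt0 : 0 < dt).
Context {p : nat} {d1} {T : measurableType d1} (P : probability T R).
Variables (Z : 'I_p.+1 -> R -> T -> V) (twall : 'I_p.+1 -> nat -> T -> R).
Hypothesis hZ : forall r, pdmp_law c P mu (Z r).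
Hypothesis hind : mutually_independent P
  (fun r => generated_sigma [set t : R | 0 <= t] (Z r)).
Hypothesis mtw : forall r m, measurable_fun setT (twall r m).
Hypothesis htwind : independent_classes P
  (generated_sigma setT (fun rm => twall rm.1 rm.2))
  (generated_sigma [set rt : 'I_p.+1 * R | 0 <= rt.2] (fun rt => Z rt.1 rt.2)).
Hypothesis htwmono : {ae P, forall w, forall r m n, (m <= n)%N ->
  twall r m w <= twall r n w}.
Hypothesis htword : {ae P, forall w, exists! s, is_wall_order twall w s}.
Local Notation A := ('I_p.+1 * nat)%type.
Local Notation tau r w := (exit_time W (Z r) w).
Local Notation s w := (wall_order twall w).
Local Notation alpha := (survival_step W P0 Z0 dt).
Local Notation beta := (exit_step W P0 Z0 dt).

Let mZ r t (t0 : 0 <= t) : measurable_fun setT (Z r t) := pdmp_law_measurable (hZ r) t0.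
Let pZ r w : piecewise_flow c ((Z r)^~ w) := pdmp_law_piecewise_flow (hZ r) w.
Let rZ r w : right_continuous ((Z r)^~ w).
Proof. exact: (pdmp_law_right_continuous (hZ r)). Qed.
Let mtau r : measurable_fun setT (exit_time W (Z r)) := pdmp_law_measurable_exit_time oW (hZ r).
Let ms k a : measurable [set w | s w k = a] := measurable_wall_order k a mtw.
Let reg w := regular W Z twall w.

Lemma regular_ae : {ae P, forall w, reg w}.
Proof.
have fin : {ae P, forall w, forall r, (0 < tau r w)%E /\ (tau r w < +oo)%E}.
  apply: filter_forall => r; exact: (exit_time_finite_ae oW hc hmu hZ0 htau (hZ r)).
move: htwmono htword fin; apply: filterS3 => w mono [so [hso _]] fin.
by split=> //; exists so.
Qed.

(* That a.1 itself is still alive is not required, which makes this event independent of the copy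
   a.1. *)
Definition others_alive (k : nat) (a : A) : set T :=
  [set w | s w k = a /\ others_survived W dt Z twall a w].

Lemma measurable_others_alive k a :
  measurable (others_alive k a : set (rest_space Z twall a.1)).
Proof.
have mtwr r m : measurable_fun [set: rest_space Z twall a.1] (twall r m).
  exact: clock_rest.
apply: mset_and; first exact: (measurable_wall_order k a mtwr).
apply: mset_forall => b; have [e|e] := pselect (b.1 = a.1).
  by apply: (@mset_ext _ _ (fun=> True)); [move=> w; split|exact: mset_cst].
do 2 (apply: mset_imply; [try exact: mset_cst|]); first exact: mset_ltr.
apply: mset_lte; first exact: measurable_cst.
apply: (measurable_exit_time oW (Z := Z b.1 : R -> rest_space Z twall a.1 -> V) _ (@pZ b.1)).
by move=> t t0; apply: copy_rest => //; exact/eqP.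
Qed.

(** Once step [k] is known to be [a], the event splits, up to irregular outcomes, into one on the
    clocks and the other copies and one on the copy [a.1]; these are independent. *)
Lemma prob_at_step k a (E : set T) (Y : set (copy_space Z a.1)) :
  measurable E -> measurable Y ->
  (forall w, reg w -> s w k = a -> E w <-> others_survived W dt Z twall a w /\ Y w) ->
  (P (E `&` [set w | s w k = a]) = P (others_alive k a) * P Y)%E.
Proof.
move=> mE mY h; have mO := @measurable_others_alive k a.
rewrite -(rest_independent mZ mtw hind htwind mO mY); apply: ae_eq_prob.
- exact: measurableI.
- apply: measurableI; first exact: (rest_measurable mZ mtw mO).
  exact: (copy_measurable mZ mY).
apply: filterS regular_ae => w rw; rewrite /others_alive /=; split.
  by move=> [Ew sa]; have [? ?] := (h w rw sa).1 Ew.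
by move=> [[sa oth] Yw]; split=> //; apply/(h w rw sa).
Qed.

(** The law of the order of the steps is never computed: it enters both sides through the same
    factor [P (others_alive k a)], and the ratio [x] is the same for all [a]. *)
Lemma prob_step_ratio k (E F : set T) (Y Y' : forall a : A, set (copy_space Z a.1)) x :
  measurable E -> measurable F -> 0 <= x ->
  (forall a, measurable (Y a)) -> (forall a, measurable (Y' a)) ->
  (forall a, P (Y a) = x%:E * P (Y' a))%E ->
  (forall a w, reg w -> s w k = a -> E w <-> others_survived W dt Z twall a w /\ Y a w) ->
  (forall a w, reg w -> s w k = a -> F w <-> others_survived W dt Z twall a w /\ Y' a w) ->
  (P E = x%:E * P F)%E.
Proof.
move=> mE mF x0 mY mY' YY' hE hF.
apply: (@eq_prob_fibers _ _ _ P _ (fun w => s w k)) => // a.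
rewrite (prob_at_step mE (mY a) (hE a)) (prob_at_step mF (mY' a) (hF a)).
by rewrite [X in (_ * X)%E]YY' muleCA.
Qed.

Let mtau_copy r : measurable_fun [set: copy_space Z r] (exit_time W (Z r)).
Proof.
apply: (measurable_exit_time oW (Z := Z r : R -> copy_space Z r -> V) _ (@pZ r)).
by move=> t t0; exact: copy_self.
Qed.

Let mpos_copy r : measurable_fun [set: copy_space Z r] (exit_pos W (Z r)).
Proof.
apply: (measurable_exit_pos oW (Z := Z r : R -> copy_space Z r -> V) _ (@pZ r)).
by move=> t t0; exact: copy_self.
Qed.

Let malive_copy r t : measurable ([set w | (t%:E < tau r w)%E] : set (copy_space Z r)).
Proof. by apply: mset_lte => //; exact: measurable_cst. Qed.

Lemma measurable_at_step k (Q : A -> T -> Prop) :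
  (forall a, measurable [set w | Q a w]) -> measurable [set w | Q (s w k) w].
Proof.
move=> mQ; apply: (@mset_ext _ _ (fun w => exists a, s w k = a /\ Q a w)).
  by move=> w; split=> [[a [-> //]]|h]; exists (s w k).
by apply: mset_exists => a; exact: mset_and.
Qed.

Let msurvived a : measurable [set w | survived W dt Z a w].
Proof. by apply: mset_lte => //; exact: measurable_cst. Qed.

Let malive k : measurable [set w | alive_before W dt Z twall k w].
Proof.
apply: mset_forall => j; apply: mset_imply; first exact: mset_cst.
exact: measurable_at_step.
Qed.

Lemma alive_before_prob k : P [set w | alive_before W dt Z twall k w] = (alpha ^+ k)%:E.
Proof.
elim: k => [|k IH].
  rewrite expr0 -(@probability_setT _ _ _ P); congr (P _); apply/seteqP; split=> // w _ j.
rewrite exprS EFinM -IH.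
(* At step [a] the two events ask that the copy be alive at the end and at the start of its
   fragment; by [alive_pow] the ratio is [alpha] for every fragment number. *)
apply: (@prob_step_ratio k _ _
  (fun a => [set w | ((a.2.+1%:R * dt)%:E < tau a.1 w)%E])
  (fun a => [set w | ((a.2%:R * dt)%:E < tau a.1 w)%E])) => //.
- exact: survival_step_ge0.
- move=> a; rewrite (alive_pow oW hc hmu hZ0 htau dt0 (hZ a.1)).
  by rewrite [X in (_ * X)%E](alive_pow oW hc hmu hZ0 htau dt0 (hZ a.1)) -EFinM exprS.
- move=> a w rw sa; split=> [al|[oth sv]].
    have al' : alive_before W dt Z twall k w by move=> j jk; apply: al; exact: ltnW.
    have [oth _] := (alive_before_at dt0 rw sa).1 al'; split=> //.
    by have := al k (ltnSn k); rewrite sa.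
  move=> j; rewrite ltnS leq_eqVlt => /predU1P[->|]; first by rewrite sa.
  move: j; apply/(alive_before_at dt0 rw sa); split=> //; apply: le_lt_trans sv.
  by rewrite lee_fin ler_pM2r // ler_nat.
- by move=> a w rw sa; exact: alive_before_at.
Qed.

Definition exit_at_step (B : set (R * V)) k : set T :=
  [set w | alive_before W dt Z twall k w /\ (~ survived W dt Z (s w k) w /\
    B (fine (tau (s w k).1 w) - (s w k).2%:R * dt, exit_pos W (Z (s w k).1) w))].

Lemma measurable_exit_at_step B k : measurable B -> measurable (exit_at_step B k).
Proof.
move=> mB; apply: mset_and => //.
apply: (measurable_at_step k (Q := fun a w => ~ survived W dt Z a w /\
  B (fine (tau a.1 w) - a.2%:R * dt, exit_pos W (Z a.1) w))) => a.
apply: mset_and; first exact: mset_not.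
apply: (measurable_fun_set _ mB); apply: measurable_fun_pair.
  by apply: measurable_funB; [exact: measurableT_comp|exact: measurable_cst].
exact: (pdmp_law_measurable_exit_pos oW (hZ a.1)).
Qed.

Lemma exit_at_step_prob B k : measurable B ->
  P (exit_at_step B k) = (alpha ^+ k * beta B)%:E.
Proof.
move=> mB; rewrite mulrC EFinM -alive_before_prob.
apply: (@prob_step_ratio k _ _
  (fun a => [set w | [/\ ((a.2%:R * dt)%:E < tau a.1 w)%E,
      (tau a.1 w <= (a.2.+1%:R * dt)%:E)%E &
      B (fine (tau a.1 w) - a.2%:R * dt, exit_pos W (Z a.1) w)]])
  (fun a => [set w | ((a.2%:R * dt)%:E < tau a.1 w)%E])) => //.
- exact: measurable_exit_at_step.
- exact: exit_step_ge0.
- move=> a; apply: (@mset_ext _ _ (fun w : copy_space Z a.1 => ((a.2%:R * dt)%:E < tau a.1 w)%E /\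
      ((tau a.1 w <= (a.2.+1%:R * dt)%:E)%E /\
      B (fine (tau a.1 w) - a.2%:R * dt, exit_pos W (Z a.1) w)))).
    by move=> w; split=> [[? []]|[]].
  apply: mset_and => //; apply: mset_and.
    by apply: mset_lee => //; exact: measurable_cst.
  apply: (measurable_fun_set _ mB); apply: measurable_fun_pair => //.
  by apply: measurable_funB; [exact: measurableT_comp|exact: measurable_cst].
- move=> a; rewrite (exit_step_pow oW hc hmu hZ0 htau dt0 (hZ a.1) _ mB).
  by rewrite [X in (_ * X)%E](alive_pow oW hc hmu hZ0 htau dt0 (hZ a.1)) -EFinM mulrC.
- move=> a w rw sa; rewrite /exit_at_step /= sa /survived.
  rewrite (alive_before_at dt0 rw sa) leNgt.
  by split=> [[[? ?] [/negP ? ?]]|[? [? /negP ? ?]]].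
- by move=> a w rw sa; exact: alive_before_at.
Qed.

Lemma measurable_async_K k : measurable [set w | async_K W dt Z twall w = k].
Proof.
apply: measurable_least => j; apply: (measurable_at_step j
  (Q := fun a w => (tau a.1 w <= (a.2.+1%:R * dt)%:E)%E)) => a.
by apply: mset_lee => //; exact: measurable_cst.
Qed.

Lemma measurable_async_Zpar : measurable_fun setT (async_Zpar W dt Z twall).
Proof.
apply: (measurable_select (X := fun k w => exit_pos W (Z (s w k).1) w) measurable_async_K) => k.
apply: (measurable_select (X := fun (a : A) w => exit_pos W (Z a.1) w) (ms k)) => a.
exact: (pdmp_law_measurable_exit_pos oW (hZ a.1)).
Qed.

Lemma measurable_async_fpar (f : V -> R) M : measurable_fun setT f -> (forall z, `|f z| <= M) ->
  measurable_fun setT (async_fpar W dt Z twall f).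
Proof.
move=> mf fM; have mdt m : 0 <= m%:R * dt by rewrite mulr_ge0 // ltW.
apply: (measurable_select (X := fun K w =>
  \sum_(k < K) path_int f (Z (s w k).1) w ((s w k).2%:R * dt) ((s w k).2.+1%:R * dt)
  + path_int f (Z (s w K).1) w ((s w K).2%:R * dt) (fine (tau (s w K).1 w))) measurable_async_K).
move=> K; apply: measurable_funD.
  apply: measurable_sum => k.
  apply: (measurable_select (X := fun (a : A) w =>
    path_int f (Z a.1) w (a.2%:R * dt) (a.2.+1%:R * dt)) (ms k)) => a.
  apply: (measurable_path_int (@mZ a.1) (@rZ a.1) mf fM) => //; exact: measurable_cst.
apply: (measurable_select (X := fun (a : A) w =>
  path_int f (Z a.1) w (a.2%:R * dt) (fine (tau a.1 w))) (ms K)) => a.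
by apply: (measurable_path_int (@mZ a.1) (@rZ a.1) mf fM) => //; exact: measurableT_comp.
Qed.

Lemma measurable_async_exit : measurable_fun setT
  (fun w => (async_fpar W dt Z twall (cst 1) w, async_Zpar W dt Z twall w)).
Proof.
apply: measurable_fun_pair measurable_async_Zpar.
by apply: (@measurable_async_fpar _ 1) => // z; rewrite normr1.
Qed.

(** When [K = k], the total time is [k dt] plus the time spent in the last fragment; the shifted
    sets [Bk k] then produce the series of [exit_law_steps] term by term. *)
Lemma async_law (B : set (R * V)) : measurable B ->
  P [set w | B (async_fpar W dt Z twall (cst 1) w, async_Zpar W dt Z twall w)] = exit_law W P0 Z0 B.
Proof.
move=> mB; set E := [set w | _].
have mE : measurable E := measurable_fun_set measurable_async_exit mB.
pose Bk k : set (R * V) := [set q | B (q.1 + k%:R * dt, q.2)].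
have mBk k : measurable (Bk k).
  apply: (measurable_fun_set _ mB); apply: measurable_fun_pair; last exact: measurable_snd.
  by apply: measurable_funD; [exact: measurable_fst|exact: measurable_cst].
have EE : E = \bigcup_k (E `&` [set w | async_K W dt Z twall w = k]).
  apply/seteqP; split=> w; last by move=> [k _ []].
  by move=> Ew; exists (async_K W dt Z twall w).
have mEk k : measurable (E `&` [set w | async_K W dt Z twall w = k]).
  by apply: measurableI => //; exact: measurable_async_K.
rewrite EE measure_semi_bigcup //; last 2 first.
- by move=> i j _ _ [w [[_ <-] [_ <-]]].
- by rewrite -EE.
rewrite (exit_law_steps oW hc hmu hZ0 htau dt0 mB); apply: eq_eseriesr => k _.
rewrite -/(Bk k) -(exit_at_step_prob k (mBk k)); apply: ae_eq_prob => //.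
  exact: measurable_exit_at_step.
apply: filterS regular_ae => w rw; rewrite /E /exit_at_step /Bk /=.
have KP := async_KP dt0 rw k; split=> [[Bw Kk]|[al [dead Bw]]].
  have [al dead] := KP.1 Kk; split=> //; split=> //.
  by move: Bw; rewrite (async_Tpar dt0 rw Kk) /async_Zpar Kk addrC.
have Kk := KP.2 (conj al dead); split=> //.
by rewrite (async_Tpar dt0 rw Kk) /async_Zpar Kk addrC.
Qed.

Lemma async_same_law : same_law P P0
  (fun w => (async_fpar W dt Z twall (cst 1) w, async_Zpar W dt Z twall w))
  (fun w => (fine (exit_time W Z0 w), exit_pos W Z0 w)).
Proof.
split; [exact: measurable_async_exit|exact: (pdmp_law_measurable_exit oW hZ0)|].
move=> B mB; have -> : (fun w => (async_fpar W dt Z twall (cst 1) w,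
    async_Zpar W dt Z twall w)) @^-1` B = [set w |
    B (async_fpar W dt Z twall (cst 1) w, async_Zpar W dt Z twall w)] by [].
by rewrite async_law // -(exit_law_copy oW hc hmu hZ0 htau hZ0 mB).
Qed.

Section expectation.
Variables (g : V -> R) (M : R).
Hypotheses (mg : measurable_fun setT g) (g0 : forall z, 0 <= g z) (gM : forall z, `|g z| <= M).
Local Notation step_occ g k w := (step_occupation W dt Z twall (EFin \o g) k w).

Let mI m : measurable (step_itv dt m : set (measurableTypeR R)).
Proof. exact: measurable_itv. Qed.

Let I0 m t : step_itv dt m t -> 0 <= t.
Proof. by rewrite /step_itv /= in_itv /= => /andP[+ _]; apply: le_trans; rewrite mulr_ge0 // ltW. Qed.

Lemma measurable_step_occupation (h : V -> R) k : measurable_fun setT h -> (forall z, 0 <= h z) ->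
  measurable_fun setT (step_occupation W dt Z twall (EFin \o h) k).
Proof.
move=> mh h0; apply: measurable_if_set => //.
apply: (measurable_select (X := fun (a : A) w =>
  occupation W (Z a.1) (EFin \o h) (step_itv dt a.2) w) (ms k)) => a.
apply: (measurable_occupation (@mZ a.1) (@rZ a.1)) => //; first exact/measurable_EFinP.
by move=> t; exact: I0.
Qed.

(** A copy that has exited before its fragment starts has occupation 0 there. Hence [alive_before]
    may be weakened to [others_alive], which is independent of the copy. *)
Let step_occupation_fiber (h : V -> R) k a : measurable_fun setT h -> (forall z, 0 <= h z) ->
  (\int[P]_(w in [set w | s w k = a]) step_occ h k w =
   \int[P]_(w in others_alive k a) occupation W (Z a.1) (EFin \o h) (step_itv dt a.2) w)%E.
Proof.
move=> mh h0; have h0' z : (0 <= (EFin \o h) z)%E by rewrite lee_fin.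
have mO : measurable (others_alive k a).
  exact: (rest_measurable mZ mtw (@measurable_others_alive k a)).
have mocc : measurable_fun setT (occupation W (Z a.1) (EFin \o h) (step_itv dt a.2)).
  apply: (measurable_occupation (@mZ a.1) (@rZ a.1)) => //; first exact/measurable_EFinP.
  by move=> t; exact: I0.
have patchE (D : set T) (u : T -> \bar R) : u \_ D = fun w => if w \in D then u w else 0%E.
  by apply/funext => w; rewrite patchE.
rewrite integral_mkcond [RHS]integral_mkcond !patchE; apply: ge0_ae_eq_integral => //.
- by apply: measurable_if_set => //; exact: measurable_step_occupation.
- exact: measurable_if_set.
- by move=> w _; case: ifP => // _; rewrite /step_occupation; case: ifP => // _; exact: occupation_ge0.
- by move=> w _; case: ifP => // _; exact: occupation_ge0.
apply: filterS regular_ae => w rw _ /=.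
have [sa|sa] := pselect (s w k = a); last first.
  by rewrite !ifN //; apply/negP => /set_mem; [case|].
rewrite ifT; last exact/mem_set.
rewrite /step_occupation sa; have AP := alive_before_at dt0 rw sa.
have [oth|noth] := pselect (others_survived W dt Z twall a w); last first.
  by rewrite !ifN //; apply/negP => /set_mem; [case|move=> /AP[]].
rewrite [RHS]ifT; last exact/mem_set.
have [st|nst] := pselect ((a.2%:R * dt)%:E < tau a.1 w)%E.
  by rewrite ifT //; apply/mem_set/AP.
rewrite ifN; last by apply/negP => /set_mem /AP[].
rewrite /occupation (_ : _ `&` _ = set0) ?integral_set0 //.
apply/seteqP; split=> // t [+ tt]; rewrite /step_itv /= in_itv /= => /andP[at_ _].
by apply: nst; apply: le_lt_trans tt; rewrite lee_fin.
Qed.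

Let mug0 : 0 <= fine (\int[mu]_z (g z)%:E)%E.
Proof. by apply/fine_ge0/integral_ge0 => z _; rewrite lee_fin. Qed.

Lemma qsd_mean_fin_num : (\int[mu]_z (g z)%:E)%E \is a fin_num.
Proof.
rewrite ge0_fin_numE; last by apply: integral_ge0 => z _; rewrite lee_fin.
apply: (@le_lt_trans _ _ (\int[mu]_z (cst M%:E z))%E).
  apply: ge0_le_integral => //.
  - by move=> z _; rewrite lee_fin.
  - exact/measurable_EFinP.
  - by move=> z _; rewrite lee_fin (le_trans (ler_norm _)).
by rewrite integral_cst // [X in (_ * X)%E]probability_setT mule1 ltry.
Qed.

(** On each fiber [others_alive] is independent of the copy, so the copy stays quasistationary when
    restricted to that event and [integral_occupation_factor] applies. *)
Lemma step_integral k :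
  (\int[P]_w step_occ g k w =
   (fine (\int[mu]_z (g z)%:E))%:E * \int[P]_w step_occ (cst 1%R) k w)%E.
Proof.
have c10 (z : V) : 0 <= cst 1 z :> R by [].
apply: (@eq_integral_fibers _ _ _ P _ (fun w => s w k)) => //.
- exact: measurable_step_occupation.
- exact: measurable_step_occupation.
- by move=> w; rewrite /step_occupation; case: ifP => // _; apply: occupation_ge0 => z; rewrite lee_fin.
- by move=> w; rewrite /step_occupation; case: ifP => // _; apply: occupation_ge0 => z; rewrite lee_fin.
move=> a; rewrite !step_occupation_fiber // fineK ?qsd_mean_fin_num //.
have mO := @measurable_others_alive k a.
have mOT : measurable (others_alive k a : set T) := rest_measurable mZ mtw mO.
apply: (integral_occupation_factor (@mZ a.1) (@rZ a.1) (mtau a.1)) => //.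
- exact/measurable_EFinP.
- by move=> t; exact: I0.
move=> t B t0 mB; rewrite -setIA.
have mB' : measurable ([set w | (t%:E < tau a.1 w)%E] `&` Z a.1 t @^-1` B : set (copy_space Z a.1)).
  apply: measurableI => //; rewrite -[X in measurable X]setTI; exact: copy_self.
rewrite (rest_independent mZ mtw hind htwind mO mB').
rewrite [X in (_ = _ * X)%E](rest_independent mZ mtw hind htwind mO (@malive_copy a.1 t)).
by rewrite [X in (_ * X = _)%E](qsd_alive oW hmu (hZ a.1) t0 mB) muleCA.
Qed.

Lemma async_fpar_integral_steps (h : V -> R) : measurable_fun setT h -> (forall z, 0 <= h z) ->
  (forall z, `|h z| <= M) ->
  (\int[P]_w (async_fpar W dt Z twall h w)%:E = \sum_(0 <= k <oo) \int[P]_w step_occ h k w)%E.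
Proof.
move=> mh h0 hM; rewrite -integral_nneseries //; last 2 first.
- by move=> k; exact: measurable_step_occupation.
- move=> k w _; rewrite /step_occupation; case: ifP => // _; apply: occupation_ge0 => z.
  by rewrite lee_fin.
have s0 k w : (0 <= step_occ h k w)%E.
  rewrite /step_occupation; case: ifP => // _; apply: occupation_ge0 => z.
  by rewrite lee_fin.
apply: ge0_ae_eq_integral => //.
- by apply/measurable_EFinP; exact: (measurable_async_fpar mh hM).
- apply: ge0_emeasurable_sum => [k w _ _|k _]; first exact: s0.
  exact: measurable_step_occupation.
- move=> w _; rewrite lee_fin /async_fpar addr_ge0 //.
    by apply: sumr_ge0 => k _; apply: Rintegral_ge0.
  exact: Rintegral_ge0.
- by move=> w _; exact: nneseries_ge0.
apply: filterS regular_ae => w rw _.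
exact: (async_fpar_occupation dt0 rw mZ rZ mh h0 hM).
Qed.

(** The factorisation of [step_integral] for a single process, with one interval from 0 to infinity
    in place of a fragment. *)
Lemma exit_path_int_factor :
  (\int[P0]_w (path_int g Z0 w 0 (fine (exit_time W Z0 w)))%:E =
   (fine (\int[mu]_z (g z)%:E))%:E * \int[P0]_w (fine (exit_time W Z0 w))%:E)%E.
Proof.
have mZ0 t (t0 : 0 <= t) := pdmp_law_measurable hZ0 t0.
have rZ0 := pdmp_law_right_continuous hZ0.
have mt0 := pdmp_law_measurable_exit_time oW hZ0.
have occ (h : V -> R) N : measurable_fun setT h -> (forall z, 0 <= h z) -> (forall z, `|h z| <= N) ->
    (\int[P0]_w (path_int h Z0 w 0 (fine (exit_time W Z0 w)))%:E =
     \int[P0]_w occupation W Z0 (EFin \o h) `[0%R, +oo[ w)%E.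
  move=> mh h0 hN; apply: ge0_ae_eq_integral => //.
  - apply/measurable_EFinP; apply: (measurable_path_int mZ0 rZ0 mh hN) => //.
    exact: measurableT_comp.
  - apply: (measurable_occupation mZ0 rZ0 mt0) => //; first exact/measurable_EFinP.
    by move=> t; rewrite /= in_itv /= andbT.
  - by move=> w _; rewrite lee_fin; exact: Rintegral_ge0.
  - by move=> w _; apply: occupation_ge0 => z; rewrite lee_fin.
  apply: filterS htau => w tw _; apply: (path_int_at_exit mZ0 rZ0 mh hN) => //.
    by move=> t; rewrite /= in_itv /= andbT.
  by move=> t t0 _; rewrite /= in_itv /= andbT.
rewrite (occ g M) // (integral_occupation_factor mZ0 rZ0 mt0 (mu := mu)) //.
- rewrite fineK ?qsd_mean_fin_num //; congr (_ * _)%E.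
  rewrite -(@occ (cst 1) 1) //; last by move=> z; rewrite normr1.
  by apply: eq_integral => w _; rewrite path_int1 ?subr0 // fine_ge0 // exit_time_ge0.
- exact/measurable_EFinP.
- by move=> t; rewrite /= in_itv /= andbT.
move=> t B t0 mB; rewrite setTI.
by rewrite (qsd_alive oW hmu hZ0 t0 mB).
Qed.

End expectation.

Lemma path_int_ge0 {T' : Type} (h : V -> R) (Y : R -> T' -> V) w a b :
  (forall z, 0 <= h z) -> 0 <= path_int h Y w a b.
Proof. by move=> h0; exact: Rintegral_ge0. Qed.

Lemma async_fpar_ge0 (h : V -> R) w : (forall z, 0 <= h z) -> 0 <= async_fpar W dt Z twall h w.
Proof.
move=> h0; rewrite /async_fpar addr_ge0 ?path_int_ge0 //.
by apply: sumr_ge0 => k _; exact: path_int_ge0.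
Qed.

(** Read off from equality in law; the absolute value makes the first coordinate a nonnegative test
    function on the whole product. *)
Lemma async_Tpar_mean :
  (\int[P]_w (async_fpar W dt Z twall (cst 1) w)%:E = \int[P0]_w (fine (exit_time W Z0 w))%:E)%E.
Proof.
have [mX mY XY] := async_same_law.
have mphi : measurable_fun setT (fun q : R * V => `|q.1|%:E).
  apply/measurable_EFinP; apply: measurableT_comp => //; exact: measurable_fst.
have phi0 (q : R * V) : (0 <= `|q.1|%:E)%E by rewrite lee_fin.
have := @agree_integral _ _ _ _ _ _ _ P P0 1 setT _ setT _ ler01 measurableT measurableT mX mY
  (fun q => `|q.1|%:E).
rewrite mul1e => E; transitivity (\int[P]_w (`|async_fpar W dt Z twall (cst 1) w|)%:E)%E.
  by apply: eq_integral => w _; rewrite ger0_norm // async_fpar_ge0.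
rewrite E //; last by move=> B mB; rewrite /agree_on !setTI mul1e; exact: XY.
by apply: eq_integral => w _; rewrite /= ger0_norm // fine_ge0 // exit_time_ge0.
Qed.

(** With [x] the [mu]-mean of the nonnegative function [g = f + M], both expectations equal [x - M]
    times the mean exit time, whose finiteness justifies subtracting. *)
Lemma async_expectation (f : V -> R) (M : R) : measurable_fun setT f -> (forall z, `|f z| <= M) ->
  ('E_P[async_fpar W dt Z twall f] =
   'E_P0[fun w => path_int f Z0 w 0 (fine (exit_time W Z0 w))])%E.
Proof.
move=> mf fM; pose g z := f z + M.
have mdt m : 0 <= m%:R * dt by rewrite mulr_ge0 // ltW.
have mg : measurable_fun setT g by apply: measurable_funD => //; exact: measurable_cst.
have g0 z : 0 <= g z by have := fM z; rewrite ler_norml => /andP[h _]; rewrite -lerBlDr sub0r.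
have gM z : `|g z| <= M + M.
  apply: le_trans (ler_normD _ _) _; apply: lerD => //.
  by rewrite ger0_norm // (le_trans (normr_ge0 _) (fM 0)).
(* The bound [M + M + 1] serves both for [g] and for the constant 1, as the series lemma has a
   single bound. *)
have c1 (z : V) : `|cst 1 z : R| <= M + M + 1.
  by rewrite normr1 lerDr (le_trans (normr_ge0 _) (gM 0)).
have gM' z : `|g z| <= M + M + 1 by rewrite (le_trans (gM z)) // lerDl.
have c0 (z : V) : 0 <= cst 1 z :> R by [].
set x := fine (\int[mu]_z (g z)%:E)%E.
have x0 : 0 <= x by apply/fine_ge0/integral_ge0 => z _; rewrite lee_fin.
have mZ0 t (t0 : 0 <= t) := pdmp_law_measurable hZ0 t0.
have rZ0 := pdmp_law_right_continuous hZ0.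
have mt0 := pdmp_law_measurable_exit_time oW hZ0.
have mft0 : measurable_fun setT (fun w => fine (exit_time W Z0 w)) by exact: measurableT_comp.
have soc0 k w : (0 <= step_occupation W dt Z twall (EFin \o cst 1%R) k w)%E.
  rewrite /step_occupation; case: ifP => // _; apply: occupation_ge0 => z.
  by rewrite lee_fin.
rewrite (@expectation_shift _ _ _ P _ (async_fpar W dt Z twall g)
  (async_fpar W dt Z twall (cst 1)) M x); first last.
- rewrite async_Tpar_mean; exact: (exit_time_integrable oW hc hmu hZ0 htau dt0).
- rewrite (async_fpar_integral_steps mg g0 gM').
  rewrite (async_fpar_integral_steps (h := cst 1) (measurable_cst _) c0 c1).
  rewrite -nneseriesZl; last by move=> k _; exact: integral_ge0.
  by apply: eq_eseriesr => k _; exact: (step_integral mg g0 gM).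
- by move=> w; exact: async_fpar_ge0.
- by move=> w; exact: async_fpar_ge0.
- exact: (measurable_async_fpar (measurable_cst _) c1).
- exact: (measurable_async_fpar mg gM).
- move=> w; apply/eqP; rewrite eq_sym subr_eq; apply/eqP.
  rewrite /async_fpar mulrDr mulr_sumr addrACA -big_split /=; congr (_ + _).
    by apply: eq_bigr => k _; rewrite (path_intD (@mZ _) (@rZ _) w _ mf fM).
  by rewrite (path_intD (@mZ _) (@rZ _) w _ mf fM).
rewrite async_Tpar_mean; symmetry.
apply: (@expectation_shift _ _ _ P0 _
  (fun w => path_int g Z0 w 0 (fine (exit_time W Z0 w)))) => //.
- move=> w; rewrite /g (path_intD mZ0 rZ0 w _ mf fM) //.
  by rewrite path_int1 ?subr0 ?addrK // fine_ge0 // exit_time_ge0.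
- exact: (measurable_path_int mZ0 rZ0 mg gM).
- by move=> w; exact: path_int_ge0.
- by move=> w; rewrite fine_ge0 // exit_time_ge0.
- exact: (exit_path_int_factor mg g0 gM).
- exact: (exit_time_integrable oW hc hmu hZ0 htau dt0).
Qed.

End async_law.

(** * The synchronous step *)

Section synchronous_clock.
Context {R : realType} {n p : nat} (W : set 'rV[R]_n) (dt : R) (dt0 : 0 < dt) {T : Type}
  (Z : 'I_p.+1 -> R -> T -> 'rV[R]_n).
Local Notation tau r w := (exit_time W (Z r) w).

(* With this clock the asynchronous step visits the fragments in the order of the synchronous sum. *)
Definition sync_clock (r : 'I_p.+1) (m : nat) (w : T) : R := (m * p.+1 + r)%:R.

Definition sync_order (k : nat) : 'I_p.+1 * nat := (inord (k %% p.+1), (k %/ p.+1)%N).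

Lemma sync_orderE m (r : 'I_p.+1) : sync_order (m * p.+1 + r) = (r, m).
Proof.
by rewrite /sync_order divnMDl // divn_small // addn0 modnMDl modn_small // inord_val.
Qed.

Lemma sync_order_wall w : is_wall_order sync_clock w sync_order.
Proof.
split=> [|k].
  apply/seteqP; split=> // -[r m] _; exists (m * p.+1 + r)%N => //.
  exact: sync_orderE.
rewrite /sync_clock ltr_nat /= !inordK ?ltn_mod //.
by rewrite -!divn_eq.
Qed.

Lemma sync_wall_order w : wall_order sync_clock w = sync_order.
Proof.
apply/funext => k; have ex : exists s, is_wall_order sync_clock w s.
  by exists sync_order; exact: sync_order_wall.
by apply/(wall_order_eq k (sync_order k) ex); exact: wall_order_rank (sync_order_wall w).
Qed.

Lemma sync_wall_order_uniq w : exists! s, is_wall_order sync_clock w s.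
Proof.
exists sync_order; split; first exact: sync_order_wall.
move=> s hs; rewrite -(sync_wall_order w); apply/funext => k.
have ex : exists s, is_wall_order sync_clock w s by exists s.
by apply/(wall_order_eq k (s k) ex); exact: wall_order_rank.
Qed.

(** The default values agree: without any exit, [N], [J] and [K] are all 0. The comparison with the
    asynchronous step then holds for every outcome, with no null set to discard. *)
Lemma sync_J0 w : sync_N W dt Z w = 0%N -> sync_J W dt Z w = ord0.
Proof.
move=> N0; have nex : ~ exists i, (0 < i)%N /\ exists r, (tau r w <= (i%:R * dt)%:E)%E.
  by move=> ex; have [[]] := (leastP _ ex).1 N0.
rewrite /sync_J N0 xgetPN // => r [Lr _]; apply: nex; exists 1%N; split=> //; exists r.
by apply: le_trans Lr _; rewrite lee_fin ler_pM2r // ler_nat.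
Qed.

(** The clock orders fragments by round, then by copy. Rounds count from 1 in [sync_N] and from 0 in
    the clock, hence the predecessor. *)
Lemma sync_async_steps w :
  (async_K W dt Z sync_clock w = (sync_N W dt Z w).-1 * p.+1 + sync_J W dt Z w)%N.
Proof.
pose L r m := (tau r w <= (m%:R * dt)%:E)%E.
rewrite /async_K /async_r /async_m sync_wall_order.
have [exN|nex] := pselect (exists i, (0 < i)%N /\ exists r, L r i); last first.
  have nL r i : (0 < i)%N -> ~ L r i by move=> i0 Lr; apply: nex; exists i; split=> //; exists r.
  have N0 : sync_N W dt Z w = 0%N by exact: least0.
  rewrite least0; last by move=> [k]; exact: nL.
  by rewrite sync_J0 // N0.
have [[N0 [r0 Lr0]] Nmin] := (leastP _ exN).1 (erefl (sync_N W dt Z w)).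
have exJ : exists r, L r (sync_N W dt Z w) /\
    forall r', L r' (sync_N W dt Z w) -> (r <= r')%N.
  have [r Lr rmin] := @arg_minnP _ r0 (L^~ (sync_N W dt Z w)) (fun r : 'I_p.+1 => nat_of_ord r) Lr0.
  by exists r.
have [LJ Jmin] : L (sync_J W dt Z w) (sync_N W dt Z w) /\
    forall r', L r' (sync_N W dt Z w) -> (sync_J W dt Z w <= r')%N by exact: (xgetPex ord0 exJ).
set N := sync_N W dt Z w in N0 Nmin LJ Jmin *; set J := sync_J W dt Z w in LJ Jmin *.
have LJ' : L (sync_order (N.-1 * p.+1 + J)).1 (sync_order (N.-1 * p.+1 + J)).2.+1.
  by rewrite sync_orderE prednK.
apply/leastP; first by exists (N.-1 * p.+1 + J)%N.
split=> // j jk Lj; pose r : 'I_p.+1 := inord (j %% p.+1); pose m := (j %/ p.+1)%N.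
have jE : j = (m * p.+1 + r)%N by rewrite {1}(divn_eq j p.+1) inordK // ltn_mod.
have {}Lj : L r m.+1 by [].
(* An exit in an earlier fragment contradicts the minimality of [N] if its round is earlier, and
   that of [J] if it is in the same round. *)
have [lt|ge] := ltnP m.+1 N; first by apply: (Nmin _ lt); split=> //; exists r.
have mN : (m <= N.-1)%N.
  rewrite -ltnS -(ltn_pmul2r (ltn0Sn p)) mulSnr.
  apply: leq_ltn_trans (leq_addr r _) _; rewrite -jE.
  by apply: ltn_trans jk _; rewrite ltn_add2l.
have mE : m.+1 = N by apply/eqP; rewrite eqn_leq ge -(prednK N0) ltnS mN.
have := Jmin r; rewrite -mE => /(_ Lj); apply/negP; rewrite -ltnNge.
by move: jk; rewrite jE -mE /= ltn_add2l.
Qed.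

(** Groups the linear order of the fragments into [M] full rounds and the beginning of the next. *)
Lemma sum_fragments (F : 'I_p.+1 -> nat -> R) M (J : 'I_p.+1) :
  \sum_(k < M * p.+1 + J) F (sync_order k).1 (sync_order k).2 =
  \sum_(1 <= n < M.+1) \sum_(r < p.+1) F r n.-1 + \sum_(r < p.+1 | (r < J)%N) F r M.
Proof.
have tail m j : (j <= p.+1)%N ->
    \sum_(k < m * p.+1 + j) F (sync_order k).1 (sync_order k).2 =
    \sum_(k < m * p.+1) F (sync_order k).1 (sync_order k).2 + \sum_(r < p.+1 | (r < j)%N) F r m.
  move=> jp; rewrite big_split_ord /=; congr (_ + _).
  rewrite (big_ord_widen _ (fun k => F (sync_order (m * p.+1 + k)).1 (sync_order (m * p.+1 + k)).2) jp).
  by apply: eq_bigr => r _; rewrite sync_orderE.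
rewrite tail ?(ltnW (ltn_ord J)) //; congr (_ + _).
rewrite big_add1 /= big_mkord; elim: M => [|M IH]; first by rewrite mul0n !big_ord0.
rewrite mulSnr tail // IH [RHS]big_ord_recr /=; congr (_ + _).
by apply: eq_bigl => r; rewrite ltn_ord.
Qed.

Lemma sync_async_fpar (f : 'rV[R]_n -> R) w :
  sync_fpar W dt Z f w = async_fpar W dt Z sync_clock f w.
Proof.
rewrite /async_fpar sync_async_steps /async_r /async_m sync_wall_order sync_orderE.
rewrite (sum_fragments (fun r m => path_int f (Z r) w (m%:R * dt) (m.+1%:R * dt))).
rewrite /sync_fpar /=; congr (_ + _ + _).
case: (sync_N W dt Z w) => [|N]; first by rewrite !big_geq.
apply: eq_big_nat => i /andP[i0 _]; by rewrite prednK.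
have [N0|] := posnP (sync_N W dt Z w); last by move/prednK => ->.
by rewrite sync_J0 // !big_pred0.
Qed.

Lemma sync_async_Zpar w : sync_Zpar W dt Z w = async_Zpar W dt Z sync_clock w.
Proof. by rewrite /async_Zpar sync_async_steps /async_r sync_wall_order sync_orderE. Qed.

End synchronous_clock.

(** Constants generate only the empty and the full event, so a deterministic clock is independent of
    the copies. *)
Lemma independent_classes_cst {R : realType} {d d'} {T : measurableType d} {T' : measurableType d'}
    (P : probability T R) (I : Type) (D : set I) (a : I -> T') (G : set (set T)) :
  independent_classes P (generated_sigma D (fun i (_ : T) => a i)) G.
Proof.
have sub : generated_sigma D (fun i (_ : T) => a i) `<=` [set A | A = set0 \/ A = setT].
  apply: smallest_sub.
    split; first by left.
      by move=> A [->|->]; [right; rewrite setD0|left; rewrite setDT].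
    move=> A hA; have [[i Ai]|nA] := pselect (exists i, A i = setT).
      by right; apply/seteqP; split=> // w _; exists i => //; rewrite Ai.
    left; apply/seteqP; split=> // w [i _]; have [->//|Ai] := hA i.
    by have := nA (ex_intro _ i Ai).
  move=> _ [i _ [B mB <-]]; rewrite setTI.
  have [Ba|Ba] := pselect (B (a i)); [right|left]; apply/seteqP; split=> //.
move=> A B /sub[->|->] _; first by rewrite set0I measure0 mul0e.
by rewrite setTI [X in (X * _)%E]probability_setT mul1e.
Qed.

Theorem theorem8p4 (R : realType) (d : nat) (c : pdmp R d)
  (hc : nonexplosive c)
  (W : set 'rV[R]_d) (hW : open W)
  (mu : probability 'rV[R]_d R) (hmu : the_qsd c W mu)
  (* the reference process Z *)
  (d0 : measure_display) (T0 : measurableType d0) (P0 : probability T0 R)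
  (Z0 : R -> T0 -> 'rV[R]_d) (hZ0 : pdmp_law c P0 mu Z0)
  (htau : {ae P0, forall w, (exit_time W Z0 w < +oo)%E})
  (f : 'rV[R]_d -> R) (hf : measurable_fun setT f)
  (hfb : exists M : R, forall z, `|f z| <= M)
  (dt : R) (hdt : 0 < dt)
  (* the p.+1 independent copies Z^r *)
  (p : nat) (d1 : measure_display) (T : measurableType d1)
  (P : probability T R) (Z : 'I_p.+1 -> R -> T -> 'rV[R]_d)
  (hZ : forall r, pdmp_law c P mu (Z r))
  (hind : mutually_independent P
     (fun r => generated_sigma [set t : R | 0 <= t] (Z r))) :
  [/\ 'E_P[sync_fpar W dt Z f]%E =
        'E_P0[fun w => path_int f Z0 w 0 (fine (exit_time W Z0 w))]%E
    & same_law P P0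
        (fun w => (sync_fpar W dt Z (cst 1) w, sync_Zpar W dt Z w))
        (fun w => (fine (exit_time W Z0 w), exit_pos W Z0 w))] /\
  (forall (twall : 'I_p.+1 -> nat -> T -> R)
     (htw : forall r m, measurable_fun setT (twall r m))
     (htw0 : forall r m w, 0 <= twall r m w)
     (htwind : independent_classes P
        (generated_sigma setT (fun rm => twall rm.1 rm.2))
        (generated_sigma [set rt : 'I_p.+1 * R | 0 <= rt.2]
           (fun rt => Z rt.1 rt.2)))
     (htwmono : {ae P, forall w, forall r m n, (m <= n)%N ->
        twall r m w <= twall r n w})
     (htword : {ae P, forall w, exists! s, is_wall_order twall w s}),
   [/\ 'E_P[async_fpar W dt Z twall f]%E =
         'E_P0[fun w => path_int f Z0 w 0 (fine (exit_time W Z0 w))]%E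
     & same_law P P0
         (fun w => (async_fpar W dt Z twall (cst 1) w, async_Zpar W dt Z twall w))
         (fun w => (fine (exit_time W Z0 w), exit_pos W Z0 w))]).
Proof.
have [M fM] := hfb; split=> [|twall htw _ htwind htwmono htword].
  have mclock r m : measurable_fun setT (@sync_clock R p T r m) by exact: measurable_cst.
  have ind : independent_classes P
      (generated_sigma setT (fun rm w => @sync_clock R p T rm.1 rm.2 w))
      (generated_sigma [set rt : 'I_p.+1 * R | 0 <= rt.2] (fun rt => Z rt.1 rt.2)).
    exact: independent_classes_cst.
  have mono : {ae P, forall w, forall r m n, (m <= n)%N ->
      @sync_clock R p T r m w <= sync_clock r n w}.
    by apply: aeW => w r m n mn; rewrite ler_nat leq_add2r leq_mul2r mn orbT.
  have order : {ae P, forall w, exists! s, is_wall_order (@sync_clock R p T) w s}.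
    by apply: aeW => w; exact: sync_wall_order_uniq.
  have E g : sync_fpar W dt Z g = async_fpar W dt Z (@sync_clock R p T) g.
    by apply/funext => w; exact: sync_async_fpar.
  have EZ : sync_Zpar W dt Z = async_Zpar W dt Z (@sync_clock R p T).
    by apply/funext => w; exact: sync_async_Zpar.
  rewrite !E EZ; split.
    exact: (async_expectation hW hc hmu hZ0 htau hdt hZ hind mclock ind mono order hf fM).
  exact: (async_same_law hW hc hmu hZ0 htau hdt hZ hind mclock ind mono order).
split.
  exact: (async_expectation hW hc hmu hZ0 htau hdt hZ hind htw htwind htwmono htword hf fM).
exact: (async_same_law hW hc hmu hZ0 htau hdt hZ hind htw htwind htwmono htword).
Qed.
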